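(* There is an algorithm which, given a signed tree model with $p$ transversal pairs of an $n$-vertex unweighted graph $G$ and a vertex $v\in V(G)$, outputs a shortest-path tree of $G$ rooted at $v$ in time $O(p\log n)$.
   Context: A transversal pair of a rooted tree $T$ is an unordered pair $uv$ of distinct nodes neither of which is an ancestor of the other; $u\preceq_T v$ means $u$ is an ancestor of $v$ (possibly equal). Two transversal pairs $u_1v_1,u_2v_2$ cross if one of $u_1,v_1$ is a strict ancestor of one of $u_2,v_2$ and vice versa. A signed tree model is a triple $(T,A,B)$ with $T$ a full binary rooted tree and $A,B$ disjoint sets of pairwise non-crossing transversal pairs; the number of transversal pairs is $|A|+|B|$. A pair $u'v'\in A\cup B$ covers a pair of nodes $u,v$ if $u'\preceq_T u$, $v'\preceq_T v$, and no other pair $u''v''\in A\cup B$ has $u'\preceq_T u''\preceq_T u$ and $v'\preceq_T v''\preceq_T v$. The model represents the graph on the leaves of $T$ in which two leaves are adjacent iff they are covered by a pair in $B$. A shortest-path tree rooted at $v$ is a spanning tree of the connected component of $v$ in which the distance from $v$ to every vertex equals its distance in $G$.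
   Formalization: The running time proved is O(n + p log n) rather than O(p log n); the literal bound fails, e.g. for K_{n/2,n/2}, which has a model with p = 1 while a shortest-path tree has n−1 edges to output. When n ≤ p log n the two bounds agree. *)

(* Defs.v *)
From mathcomp Require Import all_boot.

Set Implicit Arguments.
Unset Strict Implicit.
Unset Printing Implicit Defensive.

(** * Signed tree models *)

Section RootedTree.
Variable V : finType.
Implicit Type par : {ffun V -> option V}.

Definition children par (u : V) : {set V} := [set v | par v == Some u].

Definition ancestor par : rel V := connect [rel u v | par v == Some u].

Definition strict_ancestor par : rel V :=
  [rel u v | (u != v) && ancestor par u v].

(* Acyclicity is implied: the parent chain of every node ends in [r]. *)
Definition rooted_tree par : Prop :=
  exists r, par r = None /\ forall v, ancestor par r v.

Definition leaf par : pred V := fun u => children par u == set0.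

Definition full_binary par : Prop :=
  forall u, leaf par u \/ #|children par u| = 2.

(* Unordered pairs of nodes are sets [[set u; v]]. *)
Definition transversal par (P : {set V}) : Prop :=
  exists u v, [/\ P = [set u; v], u != v, ~~ ancestor par u v
                & ~~ ancestor par v u].

Definition cross par (P Q : {set V}) : Prop :=
  (exists x y, [/\ x \in P, y \in Q & strict_ancestor par x y]) /\
  (exists x y, [/\ x \in P, y \in Q & strict_ancestor par y x]).

Record signed_tree_model := SignedTreeModel {
  tree_parent : {ffun V -> option V};
  stm_A : {set {set V}};
  stm_B : {set {set V}};
  tree_rooted : rooted_tree tree_parent;
  tree_full_binary : full_binary tree_parent;
  stm_disjoint : [disjoint stm_A & stm_B];
  stm_transversal : forall P, P \in stm_A :|: stm_B -> transversal tree_parent P;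
  stm_noncrossing : forall P Q, P \in stm_A :|: stm_B ->
    Q \in stm_A :|: stm_B -> ~ cross tree_parent P Q
}.

Implicit Type M : signed_tree_model.

Definition num_pairs M : nat := #|stm_A M| + #|stm_B M|.

Definition covers M (P : {set V}) (u v : V) : Prop :=
  let anc := ancestor (tree_parent M) in
  exists u' v', [/\ P = [set u'; v'], anc u' u, anc v' v
    & forall u'' v'', [set u''; v''] \in stm_A M :|: stm_B M ->
        anc u' u'' -> anc u'' u -> anc v' v'' -> anc v'' v ->
        [set u''; v''] = P].

Definition leaf_of M := {x : V | leaf (tree_parent M) x}.

Definition represents M (G : rel (leaf_of M)) : Prop :=
  forall x y : leaf_of M,
    G x y <-> exists2 P, P \in stm_B M & covers M P (val x) (val y).

End RootedTree.

(** * Shortest-path trees *)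

Section ShortestPathTree.
Variable U : finType.
Implicit Types (G F : rel U) (v x y : U).

Definition walk_of_length G x y (d : nat) : Prop :=
  exists q : seq U, [/\ path G x q, last x q = y & size q = d].

Definition is_dist G x y (d : nat) : Prop :=
  walk_of_length G x y d /\ forall d', walk_of_length G x y d' -> d <= d'.

Definition acyclic F : Prop := forall c : seq U, 2 < size c -> ~ ucycle F c.

(* [F] is the edge relation of a spanning tree of the component of [v]. *)
Definition spanning_tree_of_component G v F : Prop :=
  [/\ symmetric F,
      forall x y, F x y -> [/\ connect G v x, connect G v y & G x y],
      forall x y, connect G v x -> connect G v y -> connect F x y
    & acyclic F].

Definition shortest_path_tree G v F : Prop :=
  spanning_tree_of_component G v F /\
  forall x d, connect G v x -> (is_dist F v x d <-> is_dist G v x d).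

Definition parent_edges (f : U -> option U) : rel U :=
  [rel x y | (f x == Some y) || (f y == Some x)].

End ShortestPathTree.

(** * Word RAM

    While-programs over finitely many registers and a random-access memory
    of [2 ^ w] cells, all holding [w]-bit words.  Every arithmetic operation,
    memory access, register access, test and assignment takes unit time. *)

Inductive binop := OpAdd | OpSub | OpMul | OpDiv | OpLt | OpEq.

Inductive expr :=
  | Const of nat
  | Reg of nat
  | Fetch of expr
  | Op of binop & expr & expr.

Inductive cmd :=
  | Skip
  | Assign of nat & expr
  | Store of expr & expr
  | Seq of cmd & cmd
  | If of expr & cmd & cmd
  | While of expr & cmd.

Record state := State { regs : nat -> nat; memory : nat -> nat }.

Definition upd (f : nat -> nat) (a x : nat) : nat -> nat :=
  fun b => if b == a then x else f b.

(* [OpSub] is truncated at 0, division by 0 gives 0, and comparisons give 0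
   or 1. *)
Definition eval_op (o : binop) (x y : nat) : nat :=
  match o with
  | OpAdd => x + y
  | OpSub => x - y
  | OpMul => x * y
  | OpDiv => x %/ y
  | OpLt => x < y
  | OpEq => x == y
  end.

Fixpoint eval (w : nat) (s : state) (e : expr) : nat :=
  match e with
  | Const k => k %% 2 ^ w
  | Reg r => regs s r
  | Fetch a => memory s (eval w s a)
  | Op o e1 e2 => eval_op o (eval w s e1) (eval w s e2) %% 2 ^ w
  end.

Fixpoint cost (e : expr) : nat :=
  match e with
  | Const _ => 1
  | Reg _ => 1
  | Fetch a => (cost a).+1
  | Op _ e1 e2 => (cost e1 + cost e2).+1
  end.

(* [exec w c s t s']: started in [s], the program [c] halts after [t] time
   units in [s']. *)
Inductive exec (w : nat) : cmd -> state -> nat -> state -> Prop :=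
  | ExecSkip s : exec w Skip s 1 s
  | ExecAssign r e s :
      exec w (Assign r e) s (cost e).+1
        (State (upd (regs s) r (eval w s e)) (memory s))
  | ExecStore a e s :
      exec w (Store a e) s (cost a + cost e).+1
        (State (regs s) (upd (memory s) (eval w s a) (eval w s e)))
  | ExecSeq c1 c2 s s1 s2 t1 t2 :
      exec w c1 s t1 s1 -> exec w c2 s1 t2 s2 ->
      exec w (Seq c1 c2) s (t1 + t2) s2
  | ExecIfTrue e c1 c2 s s1 t :
      eval w s e != 0 -> exec w c1 s t s1 ->
      exec w (If e c1 c2) s (cost e + t).+1 s1
  | ExecIfFalse e c1 c2 s s1 t :
      eval w s e = 0 -> exec w c2 s t s1 ->
      exec w (If e c1 c2) s (cost e + t).+1 s1
  | ExecWhileTrue e c s s1 s2 t1 t2 :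
      eval w s e != 0 -> exec w c s t1 s1 -> exec w (While e c) s1 t2 s2 ->
      exec w (While e c) s (cost e + t1 + t2).+1 s2
  | ExecWhileFalse e c s :
      eval w s e = 0 -> exec w (While e c) s (cost e).+1 s.

Definition init_state (input : seq nat) : state :=
  State (fun=> 0) (fun a => nth 0 input a).

(** * Input and output formats *)

Section Encoding.
Variable m : nat.

Definition encode_opt (o : option 'I_m) : nat :=
  if o is Some x then (x : nat).+1 else 0.

(* [ps] lists every pair of [A] (sign [false]) and of [B] (sign [true])
   exactly once, in any order and with any orientation. *)
Definition lists_pairs (M : signed_tree_model 'I_m)
    (ps : seq ('I_m * 'I_m * bool)) : Prop :=
  perm_eq [seq ([set q.1.1; q.1.2], q.2) | q <- ps]
          ([seq (P, false) | P <- enum (stm_A M)] ++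
           [seq (P, true) | P <- enum (stm_B M)]).

Definition encode_input (M : signed_tree_model 'I_m)
    (ps : seq ('I_m * 'I_m * bool)) (v : 'I_m) : seq nat :=
  [:: m; size ps; v : nat] ++
  [seq encode_opt (tree_parent M i) | i <- enum 'I_m] ++
  flatten [seq [:: nat_of_ord q.1.1; nat_of_ord q.1.2; nat_of_bool q.2] | q <- ps].

(* Cell [x] holds the parent of the leaf [x] in the output tree (shifted by
   one), or 0 if [x] has none.  As [f v = None], the tree is oriented
   towards [v]. *)
Definition outputs_shortest_path_tree (M : signed_tree_model 'I_m)
    (G : rel (leaf_of M)) (v : leaf_of M) (s : state) : Prop :=
  exists f : leaf_of M -> option (leaf_of M),
    [/\ forall x : leaf_of M, memory s (val x) = encode_opt (omap val (f x)),
        f v = None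
      & shortest_path_tree G v (parent_edges f)].

End Encoding.

(* Main.v *)
Require Import Defs.
From mathcomp Require Import all_boot zify.

Set Implicit Arguments.
Unset Strict Implicit.
Unset Printing Implicit Defensive.

(**
Number the nodes of the tree in preorder, so that every node [u] is an interval
of positions and every pair [{u, v}] is a rectangle (together with its mirror
image).  Since pairs do not cross, these rectangles form a laminar family, and
[x], [y] are adjacent iff the innermost rectangle containing [(x, y)] is in [B].
Going down the tree from the root to [x] and painting, for every pair [{u, v}]
at a node [u] of the path, the interval of [v] with the sign of the pair (larger
intervals first) therefore leaves exactly the neighbourhood of [x] painted.

The painted sets are kept in persistent segment trees over the positions.
Painting an interval copies two search paths, so all the versions together have
[O(n + p log n)] nodes; the tree of [x] is inherited from its parent in the
signed tree model, and fully painted blocks are shared with one static tree.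
A breadth-first search then expands a vertex by a depth-first search in its
segment tree that never enters a node twice, not even for different vertices:
everything below a node seen before has been discovered already.  The total time
is linear in the number of nodes.
*)

(** * A language with arrays, compiled to the word RAM *)

(** Painting at a node overrides what its ancestors have painted, and non-crossing is what makes
    this harmless. Let [{u', v'}] be a pair at a strict ancestor [u'] of [u], and [{u, v}] a pair at
    [u], such that [v'] and [v] both lie above [y]. If [v'] were strictly below [v], the two pairs
    would cross, so the rectangle painted later is the inner one. At a single node, the intervals
    containing a given position are nested, and the preorder position of [v] lists them from the
    outside in. A bucket sort by that position therefore suffices, and it is linear.

    Sets are attached to all nodes of the tree and not only to its leaves, because the invariant has
    to pass from a parent to its child.

    Segment tree nodes are never modified once they belong to a version, and each of them stands for
    one block of positions. A visit made on behalf of one vertex is therefore valid for all others.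

    Memory beyond the input is initially 0, so arrays need no clearing. The number [n] of leaves
    enters only at the end: the program works with the [m] nodes of the tree, and
    [m + 1 = 2 * n]. *)

Inductive aexp :=
  | Cst of nat
  | Rg of nat
  | Get of nat & aexp
  | Mulc of nat & aexp
  | Bin of binop & aexp & aexp.

Inductive acmd :=
  | Asg of nat & aexp
  | Put of nat & aexp & aexp
  | Rd of nat & aexp
  | Wr of aexp & aexp
  | ASeq of acmd & acmd
  | AIf of aexp & acmd & acmd
  | AWhile of aexp & acmd
  | ASkip.

Record ast := Ast { rg : nat -> nat; ar : nat -> nat -> nat; io : nat -> nat }.

Definition seta (f : nat -> nat -> nat) j i x : nat -> nat -> nat :=
  fun j' => if j' == j then upd (f j) i x else f j'.

Fixpoint ev (s : ast) (e : aexp) : nat :=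
  match e with
  | Cst k => k
  | Rg r => rg s r
  | Get j e => ar s j (ev s e)
  | Mulc k e => k * ev s e
  | Bin o a b => eval_op o (ev s a) (ev s b)
  end.

(* Array [j] is interleaved with the others; the machine register 0 holds the
   length of the input, so that the arrays start above the input cells. *)
Definition address j (a : expr) : expr :=
  Op OpAdd (Op OpMul (Const 32) (Op OpAdd a (Reg 0))) (Const j).

Fixpoint compile_exp (e : aexp) : expr :=
  match e with
  | Cst k => Const k
  | Rg r => Reg r.+1
  | Get j e => Fetch (address j (compile_exp e))
  | Mulc k e => Op OpMul (Const k) (compile_exp e)
  | Bin o a b => Op o (compile_exp a) (compile_exp b)
  end.

Fixpoint compile (c : acmd) : cmd :=
  match c with
  | Asg r e => Assign r.+1 (compile_exp e)
  | Put j e1 e2 => Store (address j (compile_exp e1)) (compile_exp e2)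
  | Rd r e => Assign r.+1 (Fetch (compile_exp e))
  | Wr e1 e2 => Store (compile_exp e1) (compile_exp e2)
  | ASeq c1 c2 => Seq (compile c1) (compile c2)
  | AIf e c1 c2 => If (compile_exp e) (compile c1) (compile c2)
  | AWhile e c => While (compile_exp e) (compile c)
  | ASkip => Skip
  end.

Definition ecost (e : aexp) := cost (compile_exp e).

(* If all registers and array cells are below [X], then the value of [e] is at
   most [bnd e * X]. *)
Fixpoint bnd (e : aexp) : nat :=
  match e with
  | Cst k => k
  | Rg _ | Get _ _ => 1
  | Mulc k e => k * bnd e
  | Bin OpAdd a b => bnd a + bnd b
  | Bin OpMul a b => 33
  | Bin OpSub a _ | Bin OpDiv a _ => bnd a
  | Bin OpLt _ _ | Bin OpEq _ _ => 1
  end.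

(** The limits exclude overflow: values stay at most [32 * X], and an index of at most [8 * X] gives
    an address below [1024 * X], which the word size is assumed to accommodate. The 33 in [bnd]
    makes every product of two expressions ill-formed, so only multiplication by constants is
    left. *)
Fixpoint wf_exp (e : aexp) : bool :=
  (bnd e <= 32) &&
  match e with
  | Cst _ | Rg _ => true
  | Get j e => [&& j < 32, bnd e <= 8 & wf_exp e]
  | Mulc k e => (k <= 32) && wf_exp e
  | Bin _ a b => wf_exp a && wf_exp b
  end.

Fixpoint wf_cmd (c : acmd) : bool :=
  match c with
  | Asg _ e | Rd _ e => wf_exp e
  | Put j e1 e2 => [&& j < 32, bnd e1 <= 8, wf_exp e1 & wf_exp e2]
  | Wr e1 e2 => wf_exp e1 && wf_exp e2
  | ASeq c1 c2 => wf_cmd c1 && wf_cmd c2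
  | AIf e c1 c2 => [&& wf_exp e, wf_cmd c1 & wf_cmd c2]
  | AWhile e c => wf_exp e && wf_cmd c
  | ASkip => true
  end.

(* Expressions that stay below [X] without any proof obligation. *)
Fixpoint small (e : aexp) : bool :=
  match e with
  | Cst k => k <= 1
  | Rg _ | Get _ _ => true
  | Mulc _ _ => false
  | Bin OpSub a _ | Bin OpDiv a _ => small a
  | Bin OpLt _ _ | Bin OpEq _ _ => true
  | Bin _ _ _ => false
  end.

(** * Frame conditions read off the syntax *)

Fixpoint mod_regs (c : acmd) : seq nat :=
  match c with
  | Asg r _ | Rd r _ => [:: r]
  | ASeq c1 c2 | AIf _ c1 c2 => mod_regs c1 ++ mod_regs c2
  | AWhile _ c => mod_regs c
  | _ => [::]
  end.

Fixpoint mod_arrays (c : acmd) : seq nat :=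
  match c with
  | Put j _ _ => [:: j]
  | ASeq c1 c2 | AIf _ c1 c2 => mod_arrays c1 ++ mod_arrays c2
  | AWhile _ c => mod_arrays c
  | _ => [::]
  end.

Fixpoint writes_io (c : acmd) : bool :=
  match c with
  | Wr _ _ => true
  | ASeq c1 c2 | AIf _ c1 c2 => writes_io c1 || writes_io c2
  | AWhile _ c => writes_io c
  | _ => false
  end.

Definition keeps c s s' : Prop :=
  [/\ forall r, r \notin mod_regs c -> rg s' r = rg s r,
      forall j, j \notin mod_arrays c -> ar s' j = ar s j
    & ~~ writes_io c -> io s' = io s].

Lemma keeps_refl c s : keeps c s s.
Proof. by []. Qed.

Lemma keeps_trans c s1 s2 s3 : keeps c s1 s2 -> keeps c s2 s3 -> keeps c s1 s3.
Proof.
move=> [r1 a1 i1] [r2 a2 i2]; split.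
- by move=> r hr; rewrite r2 ?r1.
- by move=> j hj; rewrite a2 ?a1.
- by move=> h; rewrite i2 ?i1.
Qed.

(** * Timed semantics and weakest preconditions *)

Section Semantics.
Variables X B : nat.

Definition fits s e : Prop := if small e then True else ev s e < X.

(** The times are exactly those of the compiled commands; the 7 in [XPut] contains the six
    operations of the address computation. The conditions [ev s e < B] confine input and output to
    the cells below the arrays. *)
Inductive aexec : acmd -> ast -> nat -> ast -> Prop :=
  | XSkip s : aexec ASkip s 1 s
  | XAsg r e s : fits s e ->
      aexec (Asg r e) s (ecost e).+1 (Ast (upd (rg s) r (ev s e)) (ar s) (io s))
  | XPut j e1 e2 s : fits s e2 ->
      aexec (Put j e1 e2) s (ecost e1 + ecost e2 + 7)
        (Ast (rg s) (seta (ar s) j (ev s e1) (ev s e2)) (io s))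
  | XRd r e s : ev s e < B ->
      aexec (Rd r e) s (ecost e).+2
        (Ast (upd (rg s) r (io s (ev s e))) (ar s) (io s))
  | XWr e1 e2 s : ev s e1 < B -> fits s e2 ->
      aexec (Wr e1 e2) s (ecost e1 + ecost e2).+1
        (Ast (rg s) (ar s) (upd (io s) (ev s e1) (ev s e2)))
  | XSeq c1 c2 s s1 s2 t1 t2 : aexec c1 s t1 s1 -> aexec c2 s1 t2 s2 ->
      aexec (ASeq c1 c2) s (t1 + t2) s2
  | XIfT e c1 c2 s s1 t : ev s e != 0 -> aexec c1 s t s1 ->
      aexec (AIf e c1 c2) s (ecost e + t).+1 s1
  | XIfF e c1 c2 s s1 t : ev s e = 0 -> aexec c2 s t s1 ->
      aexec (AIf e c1 c2) s (ecost e + t).+1 s1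
  | XWhileT e c s s1 s2 t1 t2 : ev s e != 0 -> aexec c s t1 s1 ->
      aexec (AWhile e c) s1 t2 s2 ->
      aexec (AWhile e c) s (ecost e + t1 + t2).+1 s2
  | XWhileF e c s : ev s e = 0 -> aexec (AWhile e c) s (ecost e).+1 s.

Lemma aexec_keeps c s t s' : aexec c s t s' -> keeps c s s'.
Proof.
have sub_l (T : eqType) (x : T) a b : x \notin a ++ b -> x \notin a.
  by rewrite mem_cat negb_or => /andP[].
have sub_r (T : eqType) (x : T) a b : x \notin a ++ b -> x \notin b.
  by rewrite mem_cat negb_or => /andP[].
elim=> {c s t s'} //.
- by move=> r e s _; split=> //= r'; rewrite inE /upd => /negbTE->.
- by move=> j e1 e2 s _; split=> //= j'; rewrite inE /seta => /negbTE->.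
- by move=> r e s _; split=> //= r'; rewrite inE /upd => /negbTE->.
- move=> c1 c2 s s1 s2 t1 t2 _ [r1 a1 i1] _ [r2 a2 i2]; split=> /=.
  + by move=> r hr; rewrite r2 ?r1 ?(sub_l _ _ _ _ hr) ?(sub_r _ _ _ _ hr).
  + by move=> j hj; rewrite a2 ?a1 ?(sub_l _ _ _ _ hj) ?(sub_r _ _ _ _ hj).
  + by rewrite negb_or => /andP[h1 h2]; rewrite i2 ?i1.
- move=> e c1 c2 s s1 t _ _ [r1 a1 i1]; split=> /=.
  + by move=> r /sub_l /r1.
  + by move=> j /sub_l /a1.
  + by rewrite negb_or => /andP[/i1].
- move=> e c1 c2 s s1 t _ _ [r1 a1 i1]; split=> /=.
  + by move=> r /sub_r /r1.
  + by move=> j /sub_r /a1.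
  + by rewrite negb_or => /andP[_ /i1].
- move=> e c s s1 s2 t1 t2 _ _ k1 _ k2; exact: (@keeps_trans (AWhile e c) _ _ _ k1 k2).
Qed.

(** The postcondition also receives the elapsed time. A loop is not unfolded: its precondition is
    the mere existence of a run, to be obtained from an invariant. *)
Fixpoint wp (c : acmd) (Q : nat -> ast -> Prop) (s : ast) : Prop :=
  match c with
  | ASkip => Q 1 s
  | Asg r e => fits s e /\
      Q (ecost e).+1 (Ast (upd (rg s) r (ev s e)) (ar s) (io s))
  | Put j e1 e2 => fits s e2 /\
      Q (ecost e1 + ecost e2 + 7)
        (Ast (rg s) (seta (ar s) j (ev s e1) (ev s e2)) (io s))
  | Rd r e => ev s e < B /\
      Q (ecost e).+2 (Ast (upd (rg s) r (io s (ev s e))) (ar s) (io s))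
  | Wr e1 e2 => (ev s e1 < B /\ fits s e2) /\
      Q (ecost e1 + ecost e2).+1
        (Ast (rg s) (ar s) (upd (io s) (ev s e1) (ev s e2)))
  | ASeq c1 c2 => wp c1 (fun t1 => wp c2 (fun t2 => Q (t1 + t2))) s
  | AIf e c1 c2 =>
      (ev s e != 0 -> wp c1 (fun t => Q (ecost e + t).+1) s) /\
      (ev s e = 0 -> wp c2 (fun t => Q (ecost e + t).+1) s)
  | AWhile e c => exists t s', aexec (AWhile e c) s t s' /\ Q t s'
  end.

Lemma wpP c Q s : wp c Q s <-> exists t s', aexec c s t s' /\ Q t s'.
Proof.
split.
  elim: c Q s => //=.
  - by move=> r e Q s [h1 h2]; do 2!eexists; split; [exact: XAsg|].
  - by move=> j e1 e2 Q s [h1 h2]; do 2!eexists; split; [exact: XPut|].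
  - by move=> r e Q s [h1 h2]; do 2!eexists; split; [exact: XRd|].
  - by move=> e1 e2 Q s [[h0 h1] h2]; do 2!eexists; split; [exact: XWr|].
  - move=> c1 IH1 c2 IH2 Q s /IH1[t1 [s1 [h1 /IH2[t2 [s2 [h2 h]]]]]].
    by exists (t1 + t2), s2; split=> //; apply: XSeq h1 h2.
  - move=> e c1 IH1 c2 IH2 Q s [hT hF].
    have [h0|h0] := eqVneq (ev s e) 0.
      have /IH2[t [s' [h1 h2]]] := hF h0.
      by do 2!eexists; split; [exact: XIfF h0 h1|].
    have /IH1[t [s' [h1 h2]]] := hT h0.
    by do 2!eexists; split; [exact: XIfT h0 h1|].
  - by move=> Q s h; exists 1, s; split=> //; constructor.
case=> t [s' [h q]]; elim: h Q q => //= {c s t s'}.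
- by move=> c1 c2 s s1 s2 t1 t2 _ IH1 _ IH2 Q q; apply: IH1; apply: IH2.
- move=> e c1 c2 s s1 t h _ IH Q q; split=> [_|h0]; first exact: IH.
  by rewrite h0 in h.
- move=> e c1 c2 s s1 t h _ IH Q q; split=> [h0|_]; last exact: IH.
  by rewrite h in h0.
- move=> e c s s1 s2 t1 t2 h h1 _ h2 _ Q q.
  by do 2!eexists; split; [exact: XWhileT h h1 h2|].
- by move=> e c s h Q q; do 2!eexists; split; [exact: XWhileF|].
Qed.

Lemma wp_conseq c (Q Q' : nat -> ast -> Prop) s : wp c Q s ->
  (forall t s', keeps c s s' -> Q t s' -> Q' t s') -> wp c Q' s.
Proof.
move=> /wpP[t [s' [h q]]] hQ; apply/wpP; exists t, s'; split=> //.
by apply: hQ q; apply: aexec_keeps h.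
Qed.

Lemma wp_seq c1 c2 Q s :
  wp c1 (fun t1 => wp c2 (fun t2 => Q (t1 + t2))) s -> wp (ASeq c1 c2) Q s.
Proof. by []. Qed.

Lemma wp_skip Q s : Q 1 s -> wp ASkip Q s.
Proof. by []. Qed.

Lemma wp_asg r e Q s : fits s e ->
  Q (ecost e).+1 (Ast (upd (rg s) r (ev s e)) (ar s) (io s)) -> wp (Asg r e) Q s.
Proof. by []. Qed.

Lemma wp_put j e1 e2 Q s : fits s e2 ->
  Q (ecost e1 + ecost e2 + 7)
    (Ast (rg s) (seta (ar s) j (ev s e1) (ev s e2)) (io s)) ->
  wp (Put j e1 e2) Q s.
Proof. by []. Qed.

Lemma wp_rd r e Q s : ev s e < B ->
  Q (ecost e).+2 (Ast (upd (rg s) r (io s (ev s e))) (ar s) (io s)) ->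
  wp (Rd r e) Q s.
Proof. by []. Qed.

Lemma wp_wr e1 e2 Q s : ev s e1 < B -> fits s e2 ->
  Q (ecost e1 + ecost e2).+1
    (Ast (rg s) (ar s) (upd (io s) (ev s e1) (ev s e2))) -> wp (Wr e1 e2) Q s.
Proof. by []. Qed.

Lemma wp_if e c1 c2 Q s :
  (ev s e != 0 -> wp c1 (fun t => Q (ecost e + t).+1) s) ->
  (ev s e = 0 -> wp c2 (fun t => Q (ecost e + t).+1) s) ->
  wp (AIf e c1 c2) Q s.
Proof. by []. Qed.

(* [I n s]: the loop still has to run for at most [n] time units; this bound is
   also the termination measure. *)
Lemma wp_while_left (I : nat -> ast -> Prop) n0 e c Q s0 :
  I n0 s0 ->
  (forall n s, keeps c s0 s -> I n s -> ev s e != 0 ->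
     wp c (fun t s' => exists2 n', n' + t + ecost e < n & I n' s') s) ->
  (forall n s, keeps c s0 s -> I n s -> ev s e = 0 ->
     ecost e < n /\ forall t, t + n <= n0 + (ecost e).+1 -> Q t s) ->
  wp (AWhile e c) Q s0.
Proof.
move=> I0 step exit.
suff main n s : I n s -> keeps c s0 s ->
    exists t s' n', [/\ aexec (AWhile e c) s t s', t + n' <= n + (ecost e).+1 &
      forall t', t' + n' <= n0 + (ecost e).+1 -> Q t' s'].
  have [t [s' [n' [h le q]]]] := main _ _ I0 (keeps_refl _ _).
  by exists t, s'; split=> //; apply: q.
elim/ltn_ind: n s => n IH s In ks.
have [h0|h0] := eqVneq (ev s e) 0.
  have [lt q] := exit _ _ ks In h0.
  by exists (ecost e).+1, s, n; split; [exact: XWhileF | rewrite addnC |].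
have /wpP[t1 [s1 [h1 [n' lt I1]]]] := step _ _ ks In h0.
have ks1 := keeps_trans ks (aexec_keeps h1).
have [|t2 [s2 [n2 [h2 le2 q]]]] := IH n' _ s1 I1 ks1; first lia.
exists (ecost e + t1 + t2).+1, s2, n2; split=> //; last by lia.
exact: XWhileT h0 h1 h2.
Qed.

(** The form for loops whose remaining budget is of no use after the exit. *)
Lemma wp_while (I : nat -> ast -> Prop) n0 e c Q s0 :
  I n0 s0 ->
  (forall n s, keeps c s0 s -> I n s -> ev s e != 0 ->
     wp c (fun t s' => exists2 n', n' + t + ecost e < n & I n' s') s) ->
  (forall n s, keeps c s0 s -> I n s -> ev s e = 0 ->
     ecost e < n /\ forall t, t <= n0 -> Q t s) ->
  wp (AWhile e c) Q s0.
Proof.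
move=> I0 step exit; apply: (wp_while_left I0 step) => n s ks In h0.
have [lt q] := exit n s ks In h0; split=> // t ht; apply: q; lia.
Qed.

(** * Simulation on the word RAM *)

Section Simulation.
Variable w : nat.
Hypothesis X_gt1 : 1 < X.
Hypothesis BX : B <= X.
Hypothesis XW : 1024 * X <= 2 ^ w.

Definition bounded s : Prop :=
  [/\ forall r, rg s r < X, forall j i, ar s j i < X & forall a, io s a < X].

Definition simulates s (z : state) : Prop :=
  [/\ forall r, regs z r.+1 = rg s r, regs z 0 = B,
      forall j i, j < 32 -> memory z (32 * (i + B) + j) = ar s j i
    & forall a, a < B -> memory z a = io s a].

Lemma ev_bnd s e : bounded s -> wf_exp e -> ev s e <= bnd e * X.
Proof.
case=> hr ha _; elim: e => [k|r|j e IH|k e IH|o a IHa b IHb] /=.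
- by move=> _; rewrite leq_pmulr //; lia.
- by rewrite mul1n => _; apply: ltnW.
- by rewrite mul1n => _; apply: ltnW.
- by case/and3P=> _ _ /IH; rewrite -mulnA leq_mul2l => ->; rewrite orbT.
- case/and3P=> hb /IHa {}IHa /IHb {}IHb; case: o hb => //= _; first lia.
  + exact: leq_trans (leq_subr _ _) IHa.
  + exact: leq_trans (leq_div _ _) IHa.
  + by case: ltnP => _; lia.
  + by case: eqP => _; lia.
Qed.

Lemma small_lt s e : bounded s -> small e -> ev s e < X.
Proof.
case=> hr ha _; elim: e => [k|r|j e IH|k e IH|o a IHa b IHb] //=.
- by move=> hk; apply: leq_ltn_trans hk X_gt1.
- case: o => //= h.
  + exact: leq_ltn_trans (leq_subr _ _) (IHa h).
  + exact: leq_ltn_trans (leq_div _ _) (IHa h).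
  + exact: leq_ltn_trans (leq_b1 _) X_gt1.
  + exact: leq_ltn_trans (leq_b1 _) X_gt1.
Qed.

Lemma fits_lt s e : bounded s -> fits s e -> ev s e < X.
Proof. by move=> bs; rewrite /fits; case: ifP => // h _; apply: small_lt. Qed.

Lemma eval_address s z j a v : simulates s z -> j < 32 -> v <= 8 * X ->
  eval w z a = v -> eval w z (address j a) = 32 * (v + B) + j.
Proof.
case=> _ z0 _ _ hj hv ha /=; rewrite ha z0.
have small32 k : k <= 32 -> k %% 2 ^ w = k by move=> hk; rewrite modn_small //; lia.
rewrite (small32 32) // (small32 j (ltnW hj)).
rewrite [(v + B) %% _]modn_small; last by lia.
rewrite [(32 * _) %% _]modn_small; last by lia.
by rewrite modn_small //; lia.
Qed.

Lemma eval_compile s z e : simulates s z -> bounded s -> wf_exp e ->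
  eval w z (compile_exp e) = ev s e.
Proof.
move=> sz bs; elim: e => [k|r|j e IH|k e IH|o a IHa b IHb].
- by rewrite /= andbT => hk; rewrite modn_small //; lia.
- by case: sz => /= ->.
- rewrite [wf_exp _]/= => /and3P[hj h8 he].
  have le8 : ev s e <= 8 * X.
    by apply: leq_trans (ev_bnd bs he) _; rewrite leq_mul2r h8 orbT.
  change (memory z (eval w z (address j (compile_exp e))) = ev s (Get j e)).
  by rewrite (eval_address sz hj le8 (IH he)); case: sz => _ _ ->.
- move=> wfe; have hb := ev_bnd bs wfe.
  move: wfe hb => /= /and3P[h1 hk he] hb.
  have hkb : (k * bnd e) * X <= 32 * X by rewrite leq_mul2r h1 orbT.
  by rewrite IH // [k %% _]modn_small ?modn_small //; lia.
- move=> wfe; have hb := ev_bnd bs wfe.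
  have hkb : bnd (Bin o a b) * X <= 32 * X.
    by rewrite leq_mul2r; case/andP: wfe => ->; rewrite orbT.
  have lt : ev s (Bin o a b) < 2 ^ w by lia.
  move: wfe => /and3P[_ ha hb'].
  by rewrite /= IHa // IHb // modn_small.
Qed.

Lemma bounded_regs s r x : bounded s -> x < X ->
  bounded (Ast (upd (rg s) r x) (ar s) (io s)).
Proof. by case=> *; split=> //= r'; rewrite /upd; case: ifP. Qed.

Lemma bounded_arrays s j i x : bounded s -> x < X ->
  bounded (Ast (rg s) (seta (ar s) j i x) (io s)).
Proof.
case=> *; split=> //= j' i'; rewrite /seta.
by case: ifP => // _; rewrite /upd; case: ifP.
Qed.

Lemma bounded_io s a x : bounded s -> x < X ->
  bounded (Ast (rg s) (ar s) (upd (io s) a x)).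
Proof. by case=> *; split=> //= a'; rewrite /upd; case: ifP. Qed.

Lemma aexec_simulation c s t s' : aexec c s t s' -> forall z,
  wf_cmd c -> simulates s z -> bounded s ->
  exists z', [/\ exec w (compile c) z t z', simulates s' z' & bounded s'].
Proof.
elim=> {c s t s'}.
- by move=> s z _ ? ?; exists z; split=> //; constructor.
- move=> r e s fe z /= wfe sz bs; eexists; split; first exact: ExecAssign.
    case: (sz) => h1 h2 h3 h4; split=> //= r'.
    by rewrite /upd eqSS (eval_compile sz) //; case: ifP.
  by apply: bounded_regs => //; apply: fits_lt.
- move=> j e1 e2 s fe z /= /and4P[hj h8 we1 we2] sz bs; eexists; split.
  + have -> : ecost e1 + ecost e2 + 7 =
      (cost (address j (compile_exp e1)) + ecost e2).+1.
      by rewrite /ecost /=; lia.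
    exact: ExecStore.
  + have le8 : ev s e1 <= 8 * X.
      by apply: leq_trans (ev_bnd bs we1) _; rewrite leq_mul2r h8 orbT.
    rewrite (eval_address sz hj le8 (eval_compile sz bs we1)).
    rewrite (eval_compile sz) //.
    case: (sz) => h1 h2 h3 h4; split=> //=.
      move=> j' i' hj'; rewrite /seta /upd.
      have [->|nj] := eqVneq j' j.
        have -> : (32 * (i' + B) + j == 32 * (ev s e1 + B) + j) = (i' == ev s e1).
          by apply/eqP/eqP; lia.
        by case: (i' == _) => //; rewrite h3.
      by rewrite ifF ?h3 //; apply/eqP; move/eqP: nj; lia.
    by move=> a ha; rewrite /upd ifF ?h4 //; apply/eqP; lia.
  + by apply: bounded_arrays => //; apply: fits_lt.
- move=> r e s hB z /= wfe sz bs; eexists; split; first exact: ExecAssign.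
    case: (sz) => h1 h2 h3 h4; split=> //= r'.
    by rewrite /upd eqSS (eval_compile sz) // h4 //; case: ifP.
  by apply: bounded_regs => //; case: bs.
- move=> e1 e2 s hB fe z /= /andP[we1 we2] sz bs; eexists; split.
  + exact: ExecStore.
  + rewrite !(eval_compile sz) //.
    case: (sz) => h1 h2 h3 h4; split=> //=.
      by move=> j' i' hj'; rewrite /upd ifF ?h3 //; apply/eqP; lia.
    by move=> a ha; rewrite /upd; case: ifP => // _; apply: h4.
  + by apply: bounded_io => //; apply: fits_lt.
- move=> c1 c2 s s1 s2 t1 t2 _ IH1 _ IH2 z /= /andP[w1 w2] sz bs.
  have [z1 [x1 sz1 bs1]] := IH1 z w1 sz bs.
  have [z2 [x2 sz2 bs2]] := IH2 z1 w2 sz1 bs1.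
  by exists z2; split=> //; apply: ExecSeq x1 x2.
- move=> e c1 c2 s s1 t h _ IH z /= /and3P[we w1 w2] sz bs.
  have [z1 [x1 sz1 bs1]] := IH z w1 sz bs.
  exists z1; split=> //; apply: ExecIfTrue x1.
  by rewrite (eval_compile sz).
- move=> e c1 c2 s s1 t h _ IH z /= /and3P[we w1 w2] sz bs.
  have [z1 [x1 sz1 bs1]] := IH z w2 sz bs.
  exists z1; split=> //; apply: ExecIfFalse x1.
  by rewrite (eval_compile sz).
- move=> e c s s1 s2 t1 t2 h _ IH1 _ IH2 z wc sz bs; move: (wc) => /= /andP[we w1].
  have [z1 [x1 sz1 bs1]] := IH1 z w1 sz bs.
  have [z2 [x2 sz2 bs2]] := IH2 z1 wc sz1 bs1.
  exists z2; split=> //; apply: ExecWhileTrue x1 x2.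
  by rewrite (eval_compile sz).
- move=> e c s h z /= /andP[we w1] sz bs.
  exists z; split=> //; apply: ExecWhileFalse.
  by rewrite (eval_compile sz).
Qed.

End Simulation.
End Semantics.

Arguments upd f a x b /.
Arguments seta f j i x j' /.
Arguments fits X s e /.
Arguments ecost e /.
Arguments wp : simpl never.

Ltac side := rewrite /=; first [by [] | lia | idtac].

Ltac step :=
  lazymatch goal with
  | |- wp _ _ (ASeq _ _) _ _ => apply: wp_seq; step
  | |- wp _ _ (Asg _ _) _ _ => apply: wp_asg; [side | rewrite /=]
  | |- wp _ _ (Put _ _ _) _ _ => apply: wp_put; [side | rewrite /=]
  | |- wp _ _ (Rd _ _) _ _ => apply: wp_rd; [side | rewrite /=]
  | |- wp _ _ (Wr _ _) _ _ => apply: wp_wr; [side | side | rewrite /=]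
  | |- wp _ _ (AIf _ _ _) _ _ => apply: wp_if; rewrite /=
  | |- wp _ _ ASkip _ _ => apply: wp_skip; rewrite /=
  end.

(** * The program *)

Notation rM := 0 (only parsing).
Notation rP := 1 (only parsing).
Notation rV := 2 (only parsing).
Notation rN := 3 (only parsing).
Notation rT := 4 (only parsing).
Notation rU := 5 (only parsing).
Notation rA := 6 (only parsing).
Notation rB := 7 (only parsing).
Notation rX := 8 (only parsing).
Notation rE := 9 (only parsing).
Notation rF := 10 (only parsing).
Notation rG := 11 (only parsing).
Notation rR := 12 (only parsing).
Notation rC := 13 (only parsing).
Notation rH := 14 (only parsing).
Notation rQ := 15 (only parsing).
Notation rD := 16 (only parsing).
Notation rS := 17 (only parsing).

(* Tree nodes and items are numbered from 1, and 0 means none.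
   [aHd], [aNx]: child lists, later [aNx] is the escape pointer of the preorder;
   [aPos]: preorder position; [aTp]: parent in the tree;
   [aL], [aR], [aVal]: segment tree nodes (children, and the tree node at a leaf);
   [aU], [aV], [aS]: items, i.e. oriented pairs with their sign;
   [aHd1], [aNx1] and [aHd2], [aNx2]: the items bucketed by [aV] and by [aU];
   [aRoot]: segment tree of a node; [aVis], [aStk]: visited nodes and stack;
   [aPar], [aDisc], [aQ]: output, discovered leaves and queue. *)
Notation aHd := 0 (only parsing).
Notation aNx := 1 (only parsing).
Notation aPos := 2 (only parsing).
Notation aVal := 3 (only parsing).
Notation aL := 4 (only parsing).
Notation aR := 5 (only parsing).
Notation aU := 6 (only parsing).
Notation aV := 7 (only parsing).
Notation aS := 8 (only parsing).
Notation aHd1 := 9 (only parsing).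
Notation aNx1 := 10 (only parsing).
Notation aHd2 := 11 (only parsing).
Notation aNx2 := 12 (only parsing).
Notation aRoot := 13 (only parsing).
Notation aVis := 14 (only parsing).
Notation aStk := 15 (only parsing).
Notation aPar := 16 (only parsing).
Notation aDisc := 17 (only parsing).
Notation aQ := 18 (only parsing).
Notation aTp := 19 (only parsing).

Notation "c1 ;; c2" := (ASeq c1 c2) (at level 60, right associativity).
Notation "a .+ b" := (Bin OpAdd a b) (at level 50, left associativity).
Notation "a .- b" := (Bin OpSub a b) (at level 50, left associativity).
Notation "a ./ b" := (Bin OpDiv a b) (at level 40, left associativity).
Notation "a .< b" := (Bin OpLt a b) (at level 70).

(** [rP] ends up as the number of items, two orientations for each pair, and [rV] is shifted because
    tree nodes are numbered from 1. *)
Definition ph_read : acmd :=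
  Rd rM (Cst 0) ;; Rd rP (Cst 1) ;; Rd rV (Cst 2) ;;
  Asg rV (Rg rV .+ Cst 1) ;; Asg rP (Mulc 2 (Rg rP)).

(** The power of two has to exceed [m] strictly: the end of an interval can be [m] itself and must
    still be a position of the segment tree. *)
Definition ph_size : acmd :=
  Asg rN (Cst 1) ;;
  AWhile (Rg rN .< Rg rM .+ Cst 1) (Asg rN (Mulc 2 (Rg rN))).

(** The root has parent code 0, so it is the only entry of the list of 0. Hence [aHd] at 0 is the
    root, and 0 looks like an inner node, which [discover] relies on. *)
Definition ph_children : acmd :=
  Asg rT (Cst 0) ;;
  AWhile (Rg rT .< Rg rM)
   (Rd rA (Rg rT .+ Cst 3) ;;
    Asg rT (Rg rT .+ Cst 1) ;;
    Put aTp (Rg rT) (Rg rA) ;;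
    Put aNx (Rg rT) (Get aHd (Rg rA)) ;;
    Put aHd (Rg rA) (Rg rT)).

(* After the traversal [aNx] maps every node to the node that follows its
   subtree in preorder. *)
Definition ph_traverse : acmd :=
  Asg rT (Cst 0) ;; Asg rU (Get aHd (Cst 0)) ;;
  AWhile (Rg rU)
   (Put aVal (Rg rN .+ Rg rT) (Rg rU) ;;
    Put aPos (Rg rU) (Rg rT) ;;
    Asg rT (Rg rT .+ Cst 1) ;;
    Asg rA (Get aHd (Rg rU)) ;;
    AIf (Rg rA)
     (Put aNx (Get aNx (Rg rA)) (Get aNx (Rg rU)) ;; Asg rU (Rg rA))
     (Asg rU (Get aNx (Rg rU)))) ;;
  Put aPos (Cst 0) (Rg rT).

(** The static tree has heap numbering: its root is 1, and the leaf of position [t] is [rN + t],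
    where the traversal has already stored the tree node. Node 0, whose children are both 0, is the
    empty tree of every height. A sign 0 or 1 is thus itself the root of a constant set. *)
Definition ph_full : acmd :=
  Asg rT (Cst 1) ;;
  AWhile (Rg rT .< Rg rN)
   (Put aL (Rg rT) (Mulc 2 (Rg rT)) ;;
    Put aR (Rg rT) (Mulc 2 (Rg rT) .+ Cst 1) ;;
    Asg rT (Rg rT .+ Cst 1)).

(** Item [t] (counted from 0) is the pair [t / 2], read in the direction given by the parity of
    [t]. *)
Definition ph_items : acmd :=
  Asg rT (Cst 0) ;;
  AWhile (Rg rT .< Rg rP)
   (Asg rC (Rg rT ./ Cst 2) ;;
    Asg rD (Rg rT .- Mulc 2 (Rg rC)) ;;
    Asg rX (Rg rM .+ Mulc 3 (Rg rC) .+ Cst 3) ;;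
    Rd rA (Rg rX .+ Rg rD) ;;
    Rd rB (Rg rX .+ Cst 1 .- Rg rD) ;;
    Rd rS (Rg rX .+ Cst 2) ;;
    Asg rA (Rg rA .+ Cst 1) ;;
    Asg rB (Rg rB .+ Cst 1) ;;
    Asg rT (Rg rT .+ Cst 1) ;;
    Put aU (Rg rT) (Rg rA) ;;
    Put aV (Rg rT) (Rg rB) ;;
    Put aS (Rg rT) (Rg rS) ;;
    Put aNx1 (Rg rT) (Get aHd1 (Rg rB)) ;;
    Put aHd1 (Rg rB) (Rg rT)).

Definition ph_sort_inner : acmd :=
  AWhile (Rg rE)
   (Asg rU (Get aU (Rg rE)) ;;
    Put aNx2 (Rg rE) (Get aHd2 (Rg rU)) ;;
    Put aHd2 (Rg rU) (Rg rE) ;;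
    Asg rE (Get aNx1 (Rg rE))).

(** The second pass of a bucket sort. Positions are scanned from the last to the first and items are
    pushed at the front, so the list of every [u] ends up in increasing preorder of [v], ancestors
    before descendants. *)
Definition ph_sort : acmd :=
  Asg rT (Rg rM) ;;
  AWhile (Rg rT)
   (Asg rT (Rg rT .- Cst 1) ;;
    Asg rE (Get aHd1 (Get aVal (Rg rN .+ Rg rT))) ;;
    ph_sort_inner).

(* Builds, from the node [rF] on, a copy of the search path for the position
   [rX]; its left side hangs from the tree [rA], its right side from [rB]. *)
Definition splice_loop : acmd :=
  AWhile (Rg rH)
   (Asg rF (Rg rF .+ Cst 1) ;;
    Put aVal (Rg rC) (Cst 0) ;;
    AIf (Rg rX .< Rg rH)
     (Put aL (Rg rC) (Rg rF) ;;
      Put aR (Rg rC) (Get aR (Rg rB)) ;;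
      Asg rA (Get aL (Rg rA)) ;;
      Asg rB (Get aL (Rg rB)))
     (Asg rX (Rg rX .- Rg rH) ;;
      Put aL (Rg rC) (Get aL (Rg rA)) ;;
      Put aR (Rg rC) (Rg rF) ;;
      Asg rA (Get aR (Rg rA)) ;;
      Asg rB (Get aR (Rg rB))) ;;
    Asg rC (Rg rF) ;;
    Asg rH (Rg rH ./ Cst 2)).

(** The final leaf takes its value from [rB], so the position [rX] itself belongs to the right
    side. *)
Definition splice : acmd :=
  Asg rC (Rg rF) ;; Asg rH (Rg rN ./ Cst 2) ;;
  splice_loop ;;
  Put aL (Rg rC) (Cst 0) ;; Put aR (Rg rC) (Cst 0) ;;
  Put aVal (Rg rC) (Get aVal (Rg rB)) ;;
  Asg rF (Rg rF .+ Cst 1).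

(** An interval is painted by two cuts. At its left end the old version is continued by the constant
    tree of the sign, giving [rG]; at its right end, found through the escape pointer, [rG] is
    continued by the old version. *)
Definition ph_paint : acmd :=
  AWhile (Rg rE)
   (Asg rX (Get aPos (Get aV (Rg rE))) ;;
    Asg rA (Rg rR) ;; Asg rB (Get aS (Rg rE)) ;; Asg rG (Rg rF) ;;
    splice ;;
    Asg rX (Get aPos (Get aNx (Get aV (Rg rE)))) ;;
    Asg rA (Rg rG) ;; Asg rB (Rg rR) ;; Asg rR (Rg rF) ;;
    splice ;;
    Asg rE (Get aNx2 (Rg rE))).

(** In preorder the version of the parent is complete when it is inherited. The root inherits node
    0, the empty set. New nodes start at [2 * rN], just above the static tree. *)
Definition ph_versions : acmd :=
  Asg rF (Mulc 2 (Rg rN)) ;; Asg rT (Cst 0) ;;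
  AWhile (Rg rT .< Rg rM)
   (Asg rU (Get aVal (Rg rN .+ Rg rT)) ;;
    Asg rR (Get aRoot (Get aTp (Rg rU))) ;;
    Asg rE (Get aHd2 (Rg rU)) ;;
    ph_paint ;;
    Put aRoot (Rg rU) (Rg rR) ;;
    Asg rT (Rg rT .+ Cst 1)).

Definition push : acmd :=
  AIf (Get aVis (Rg rA)) ASkip
   (Put aVis (Rg rA) (Cst 1) ;;
    Put aStk (Rg rA) (Rg rE) ;;
    Asg rE (Rg rA)).

(** The sum is nonzero for inner nodes of the signed tree model, for leaves already discovered, and
    for the value 0 of inner or unpainted segment tree nodes, as the child list of 0 is not
    empty. *)
Definition discover : acmd :=
  AIf (Get aHd (Rg rB) .+ Get aDisc (Rg rB)) ASkip
   (Put aDisc (Rg rB) (Cst 1) ;;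
    Put aPar (Rg rB) (Rg rX) ;;
    Put aQ (Rg rQ) (Rg rB) ;;
    Asg rQ (Rg rQ .+ Cst 1)).

(* Stack top [rE], current vertex [rX], queue head [rH] and tail [rQ]. *)
Definition ph_expand : acmd :=
  AWhile (Rg rE)
   (Asg rU (Rg rE) ;;
    Asg rE (Get aStk (Rg rE)) ;;
    Asg rB (Get aVal (Rg rU)) ;;
    discover ;;
    Asg rA (Get aL (Rg rU)) ;; push ;;
    Asg rA (Get aR (Rg rU)) ;; push).

(** Node 0 is marked as visited in advance, so that [push] never puts it on the stack, where 0 means
    the end. *)
Definition ph_bfs : acmd :=
  Put aVis (Cst 0) (Cst 1) ;;
  Put aDisc (Rg rV) (Cst 1) ;;
  Put aQ (Cst 0) (Rg rV) ;;
  Asg rH (Cst 0) ;; Asg rQ (Cst 1) ;; Asg rE (Cst 0) ;;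
  AWhile (Rg rH .< Rg rQ)
   (Asg rX (Get aQ (Rg rH)) ;;
    Asg rH (Rg rH .+ Cst 1) ;;
    Asg rA (Get aRoot (Rg rX)) ;; push ;;
    ph_expand).

Definition ph_output : acmd :=
  Asg rT (Cst 0) ;;
  AWhile (Rg rT .< Rg rM)
   (Wr (Rg rT) (Get aPar (Rg rT .+ Cst 1)) ;;
    Asg rT (Rg rT .+ Cst 1)).

Definition program : acmd :=
  ph_read ;; ph_size ;; ph_children ;; ph_traverse ;; ph_full ;; ph_items ;;
  ph_sort ;; ph_versions ;; ph_bfs ;; ph_output.

Lemma wf_program : wf_cmd program.
Proof. by []. Qed.

(** * Linked lists in arrays *)

Fixpoint chain (nx : nat -> nat) (h : nat) (s : seq nat) : Prop :=
  if s is x :: s' then [/\ h = x, x != 0 & chain nx (nx x) s'] else h = 0.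

Lemma eq_chain nx nx' h s : {in s, nx =1 nx'} -> chain nx h s -> chain nx' h s.
Proof.
elim: s h => //= x s IH h eq_nx [-> nz c]; split=> //.
rewrite -eq_nx ?mem_head //; apply: IH => // y ys.
by apply: eq_nx; rewrite inE ys orbT.
Qed.

Lemma chain_upd nx z x h s : z \notin s -> chain nx h s -> chain (upd nx z x) h s.
Proof.
move=> zs; apply: eq_chain => y ys; rewrite /upd.
by case: eqP zs => // <-; rewrite ys.
Qed.

Lemma chain_head0 nx h s : chain nx h s -> (h == 0) = (s == [::]).
Proof. by case: s => [->|x s [-> /negbTE-> _]]. Qed.

(** A single list [s], latest insertion first, describes the contents and the order of all buckets
    at once. *)
Definition buckets (nx hd : nat -> nat) (key : nat -> nat) (s : seq nat) : Prop :=
  forall k, chain nx (hd k) [seq e <- s | key e == k].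

Lemma buckets_cons nx hd key s e : e != 0 -> e \notin s -> buckets nx hd key s ->
  buckets (upd nx e (hd (key e))) (upd hd (key e) e) key (e :: s).
Proof.
move=> e0 es bk k /=.
have ns : e \notin [seq e0 <- s | key e0 == k] by rewrite mem_filter negb_and es orbT.
rewrite [key e == k]eq_sym; have [->|nk] := eqVneq k (key e); last first.
  by apply: chain_upd (bk _).
split=> //=; rewrite eqxx.
by apply: chain_upd (bk _); rewrite mem_filter negb_and es orbT.
Qed.

(** * The phases that are simple loops *)

Section Loops.
Variables X B : nat.
Local Notation wp := (wp X B).

Lemma wp_size s m : rg s rM = m -> 0 < m -> 4 * m < X ->
  wp ph_size (fun t s' => exists k,
    [/\ t <= 20 * m + 20, rg s' rN = 2 ^ k, m < 2 ^ k & 2 ^ k <= 2 * m]) s.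
Proof.
move=> hM m0 hX; rewrite /ph_size; step.
(* Doubling raises [2 ^ k] by at least one, so a budget linear in [m + 1 - 2 ^ k] pays for every
   round. *)
pose I n s := exists k, [/\ rg s rN = 2 ^ k, 2 ^ k <= 2 * m
  & 14 * (m + 1 - 2 ^ k) + 7 <= n].
apply: (@wp_while _ _ I (14 * m + 7)).
- by exists 0; split=> //=; lia.
- move=> n {}s' [kr _ _] [k [eN le hn]] /=.
  have eM : rg s' rM = m by rewrite kr.
  rewrite eM eN eqb0 negbK => lt.
  step; rewrite eN.
  exists (14 * (m + 1 - 2 ^ k.+1) + 7); first by rewrite expnS; lia.
  exists k.+1; split=> //; first by rewrite /= expnS.
  by rewrite expnS; lia.
- move=> n s' [kr _ _] [k [eN le hn]] /=.
  rewrite (kr rM) //= hM eN => /eqP; rewrite eqb0 -leqNgt => lt.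
  split; first by lia.
  move=> t ht; exists k; split=> //; lia.
Qed.

Lemma rev_iotaS t : rev (iota 1 t.+1) = t.+1 :: rev (iota 1 t).
Proof. by rewrite -[t.+1]addn1 iotaD cats1 rev_rcons add1n addn1. Qed.

Lemma wp_children s m tp : rg s rM = m -> m + 3 <= B -> m < X ->
  (forall t, t < m -> io s (t + 3) = tp t.+1) -> (forall i, ar s aHd i = 0) ->
  wp ph_children (fun t s' => [/\ t <= 110 * m + 50,
     buckets (ar s' aNx) (ar s' aHd) tp (rev (iota 1 m))
   & forall e, 0 < e <= m -> ar s' aTp e = tp e]) s.
Proof.
move=> hM hB hX hio hd0; rewrite /ph_children; step.
pose I n s := exists t, [/\ rg s rT = t, t <= m, 100 * (m - t) + 10 <= n,
  buckets (ar s aNx) (ar s aHd) tp (rev (iota 1 t))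
  & forall e, 0 < e <= t -> ar s aTp e = tp e].
apply: (@wp_while _ _ I (100 * m + 10)).
- exists 0; split=> //=; [lia|by move=> e; lia].
- move=> n {}s' [kr _ kio] [t [eT le hn hb ht]] /=.
  have eM : rg s' rM = m by rewrite kr.
  rewrite eM eT eqb0 negbK => lt.
  do 5!step; rewrite kio //= eT hio //.
  exists (100 * (m - t.+1) + 10); first lia.
  exists t.+1; split=> //=; [lia| |].
    rewrite rev_iotaS addn1; apply: buckets_cons => //.
    by rewrite mem_rev mem_iota; lia.
  move=> e he; rewrite addn1; case: eqP => [->|ne] //; apply: ht; lia.
- move=> n s' [kr _ _] [t [eT le hn hb ht]] /=.
  rewrite (kr rM) //= hM eT => /eqP; rewrite eqb0 -leqNgt => lt.
  have et : t = m by lia.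
  rewrite et in hb ht.
  split; first by lia.
  by move=> t' ht'; split=> //; lia.
Qed.

Lemma wp_full s N : rg s rN = N -> 2 * N < X -> 0 < N ->
  wp ph_full (fun t s' => [/\ t <= 110 * N + 50,
     forall i, ar s' aL i = if 0 < i < N then 2 * i else ar s aL i
   & forall i, ar s' aR i = if 0 < i < N then (2 * i).+1 else ar s aR i]) s.
Proof.
move=> hN hX N0; rewrite /ph_full; step.
pose I n s' := exists t, [/\ rg s' rT = t, 0 < t <= N, 100 * (N - t) + 10 <= n,
    forall i, ar s' aL i = if 0 < i < t then 2 * i else ar s aL i
   & forall i, ar s' aR i = if 0 < i < t then (2 * i).+1 else ar s aR i].
apply: (@wp_while _ _ I (100 * N + 10)).
- by exists 1; split=> //=; try lia; move=> i; case: ifP => //; lia.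
- move=> n {}s' [kr _ _] [t [eT le hn hl hr]] /=.
  have eN : rg s' rN = N by rewrite kr.
  rewrite eN eT eqb0 negbK => lt.
  do 3!step; rewrite eT.
  exists (100 * (N - t.+1) + 10); first lia.
  exists t.+1; split=> //=; try lia.
    move=> i; rewrite hl; have [->|ni] := eqVneq i t.
      by rewrite ifT //; lia.
    by have -> : (0 < i < t) = (0 < i < t.+1) by lia.
  move=> i; rewrite hr; have [->|ni] := eqVneq i t.
    by rewrite ifT ?addn1 //; lia.
  by have -> : (0 < i < t) = (0 < i < t.+1) by lia.
- move=> n s' [kr _ _] [t [eT le hn hl hr]] /=.
  rewrite (kr rN) //= hN eT => /eqP; rewrite eqb0 -leqNgt => lt.
  have et : t = N by lia.
  rewrite et in hl hr.
  split; first by lia.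
  by move=> t' ht'; split=> //; lia.
Qed.

Lemma wp_items s m p iu iv sg : rg s rM = m -> rg s rP = 2 * p ->
  m + 3 * p + 3 <= B -> m < X -> m + 3 * p + 3 < X ->
  (forall t, t < 2 * p -> [/\
     (io s (m + 3 * (t %/ 2) + 3 + (t - 2 * (t %/ 2)))).+1 = iu t.+1,
     (io s (m + 3 * (t %/ 2) + 3 + 1 - (t - 2 * (t %/ 2)))).+1 = iv t.+1
   & io s (m + 3 * (t %/ 2) + 3 + 2) = sg t.+1]) ->
  (forall t, 0 < t <= 2 * p -> iu t <= m /\ iv t <= m) ->
  (forall i, ar s aHd1 i = 0) ->
  wp ph_items (fun t s' => [/\ t <= 610 * p + 50,
     buckets (ar s' aNx1) (ar s' aHd1) iv (rev (iota 1 (2 * p)))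
   & forall e, 0 < e <= 2 * p ->
       [/\ ar s' aU e = iu e, ar s' aV e = iv e & ar s' aS e = sg e]]) s.
Proof.
move=> hM hP hB hX hX' hio hle hd0; rewrite /ph_items; step.
pose I n s := exists t, [/\ rg s rT = t, t <= 2 * p,
  300 * (2 * p - t) + 10 <= n,
  buckets (ar s aNx1) (ar s aHd1) iv (rev (iota 1 t))
  & forall e, 0 < e <= t ->
       [/\ ar s aU e = iu e, ar s aV e = iv e & ar s aS e = sg e]].
apply: (@wp_while _ _ I (600 * p + 10)).
- exists 0; split=> //=; [lia|by move=> e; lia].
- move=> n {}s' [kr _ kio] [t [eT le hn hb ht]] /=.
  have eM : rg s' rM = m by rewrite kr.
  have eP : rg s' rP = 2 * p by rewrite kr.
  rewrite eP eT eqb0 negbK => lt.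
  have [e1 e2 e3] := hio t lt.
  have [l1 l2] := hle t.+1 lt.
  do 3!step.
  rewrite (kio isT) eM eT; do 11!step.
  rewrite !addn1 in e1 e2 *; rewrite eT e1 e2 e3.
  exists (300 * (2 * p - t.+1) + 10); first lia.
  exists t.+1; split=> //.
    rewrite rev_iotaS; apply: buckets_cons => //.
    by rewrite mem_rev mem_iota; lia.
  move=> e he /=; case: eqP => [->|ne] //; apply: ht; lia.
- move=> n s' [kr _ _] [t [eT le hn hb ht]] /=.
  rewrite (kr rP) //= hP eT => /eqP; rewrite eqb0 -leqNgt => lt.
  have et : t = 2 * p by lia.
  rewrite et in hb ht.
  split; first by lia.
  by move=> t' ht'; split=> //; lia.
Qed.

Lemma wp_output s m : rg s rM = m -> m <= B -> m < X ->
  wp ph_output (fun t s' => t <= 110 * m + 50 /\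
     forall i, i < m -> io s' i = ar s aPar i.+1) s.
Proof.
move=> hM hB hX; rewrite /ph_output; step.
pose I n s' := exists t, [/\ rg s' rT = t, t <= m, 100 * (m - t) + 10 <= n
  & forall i, i < t -> io s' i = ar s aPar i.+1].
apply: (@wp_while _ _ I (100 * m + 10)).
- by exists 0; split=> //=; lia.
- move=> n {}s' [kr ka _] [t [eT le hn ht]] /=.
  have eM : rg s' rM = m by rewrite kr.
  rewrite eM eT eqb0 negbK => lt.
  step.
  step; rewrite ka //= eT.
  exists (100 * (m - t.+1) + 10); first lia.
  exists t.+1; split=> //=; first lia.
  by move=> i hi; case: eqP => [->|ne]; [rewrite addn1 | apply: ht; lia].
- move=> n s' [kr _ _] [t [eT le hn ht]] /=.
  rewrite (kr rM) //= hM eT => /eqP; rewrite eqb0 -leqNgt => lt.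
  have et : t = m by lia.
  rewrite et in ht.
  split; first by lia.
  by move=> t' ht'; split=> //; lia.
Qed.
End Loops.

(** * The bucket sort *)

Section Sort.
Variables X B : nat.
Local Notation wp := (wp X B).

Lemma wp_sort_inner s (iu : nat -> nat) (bl D : seq nat) :
  chain (ar s aNx1) (rg s rE) bl -> uniq (bl ++ D) ->
  (forall e, e \in bl -> ar s aU e = iu e) ->
  buckets (ar s aNx2) (ar s aHd2) iu D ->
  wp ph_sort_inner (fun t s' => t <= 100 * size bl + 10 /\
    buckets (ar s' aNx2) (ar s' aHd2) iu (rev bl ++ D)) s.
Proof.
move=> hc hu hU hb.
pose I n s' := exists (a r : seq nat), [/\ bl = a ++ r, chain (ar s aNx1) (rg s' rE) r,
  100 * size r + 10 <= n & buckets (ar s' aNx2) (ar s' aHd2) iu (rev a ++ D)].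
apply: (@wp_while _ _ I (100 * size bl + 10)).
- by exists [::], bl; split.
- move=> n {}s' [kr ka _] [a [r [ebl hr hn hb']]] /=.
  rewrite (chain_head0 hr); case: r hr ebl hn => [//|e r] /= [eE e0 hr] ebl hn _.
  have ein : e \in bl by rewrite ebl mem_cat mem_head orbT.
  do 4!step; rewrite eE (ka aNx1) // (ka aU) // hU //.
  exists (100 * size r + 10); first by lia.
  exists (rcons a e), r; split=> //; first by rewrite cat_rcons.
  rewrite rev_rcons /=; apply: buckets_cons => //.
  move: hu; rewrite ebl -catA cat_uniq => /and3P[_ /hasPn ha].
  rewrite cat_uniq => /and3P[/= /andP[er _] /hasPn hD _].
  rewrite mem_cat mem_rev negb_or; apply/andP; split.
    by have := ha e; rewrite /= mem_head; apply.
  by apply/negP => /hD; rewrite /= mem_head.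
- move=> n s' _ [a [r [ebl hr hn hb']]] /= h0.
  have := chain_head0 hr; rewrite h0 eqxx => /esym/eqP er.
  rewrite er cats0 in ebl; rewrite ebl; split; first by lia.
  by [].
Qed.

Definition by_pos (od : seq nat) (iv : nat -> nat) : rel nat :=
  fun e f => index (iv e) od <= index (iv f) od.

(** The inserted list [D] consists of the items whose [iv] has position at least [t], in sorted
    order. A round reverses one bucket, which is harmless because all its items have the same
    position. *)
Lemma wp_sort s N m (od l1 : seq nat) (iu iv : nat -> nat) : rg s rM = m -> rg s rN = N ->
  size od = m -> uniq od ->
  (forall t, t < m -> ar s aVal (N + t) = nth 0 od t) ->
  uniq l1 -> buckets (ar s aNx1) (ar s aHd1) iv l1 ->
  (forall e, e \in l1 -> ar s aU e = iu e /\ iv e \in od) ->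
  (forall i, ar s aHd2 i = 0) ->
  wp ph_sort (fun t s' => t <= 200 * m + 200 * size l1 + 100 /\
    exists l2, [/\ buckets (ar s' aNx2) (ar s' aHd2) iu l2, perm_eq l2 l1
      & pairwise (by_pos od iv) l2]) s.
Proof.
move=> hM hN so uo hval ul hb1 hU hd0; rewrite /ph_sort; step.
pose I n s' := exists t (D : seq nat), [/\ rg s' rT = t /\ t <= m,
  perm_eq D [seq e <- l1 | t <= index (iv e) od],
  pairwise (by_pos od iv) D,
  150 * t + 150 * (size l1 - size D) + 10 <= n
  & buckets (ar s' aNx2) (ar s' aHd2) iu D].
apply: (@wp_while _ _ I (150 * m + 150 * size l1 + 10)).
- exists m, [::]; split=> //=; [|lia].
  rewrite (eq_in_filter (a2 := pred0)) ?filter_pred0 // => e /hU[_ he].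
  by apply/negbTE; rewrite -ltnNge -so index_mem.
- move=> n {}s' [kr ka _] [t [D [[eT le] pD sD hn hb]]] /=.
  rewrite eT => t0.
  have eN : rg s' rN = N by rewrite kr.
  do 2!step; rewrite eN eT (ka aHd1 isT) (ka aVal isT) /=.
  set bl := [seq e <- l1 | iv e == nth 0 od t.-1].
  have inod i : i < m -> nth 0 od i \in od by move=> ?; rewrite mem_nth ?so.
  have blk e : e \in l1 -> (iv e == nth 0 od t.-1) = (index (iv e) od == t.-1).
    move=> /hU[_ he]; apply/eqP/eqP => [->|<-]; last by rewrite nth_index.
    by rewrite index_uniq ?so //; lia.
  have pD' : perm_eq (rev bl ++ D) [seq e <- l1 | t - 1 <= index (iv e) od].
    apply: (@perm_trans _ (bl ++ D)); first by rewrite perm_cat2r perm_rev.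
    apply: (perm_trans _ (permEl (perm_filterC (fun e => iv e == nth 0 od t.-1)
              [seq e <- l1 | t - 1 <= index (iv e) od]))).
    rewrite -!filter_predI.
    rewrite [X in perm_eq _ (X ++ _)](eq_in_filter
      (a2 := fun e => iv e == nth 0 od t.-1)) => [|e el]; last first.
      by rewrite /= blk //; case: eqP => //= ->; lia.
    rewrite perm_cat2l.
    rewrite [X in perm_eq _ X](eq_in_filter
      (a2 := fun e => t <= index (iv e) od)) //.
    by move=> e el; rewrite /= blk //; move/eqP: t0; lia.
  have subD e : e \in D -> t <= index (iv e) od.
    by rewrite (perm_mem pD) mem_filter => /andP[].
  have bl_sz : size bl + size D <= size l1.
    have := perm_size pD'; rewrite size_cat size_rev => ->.
    by rewrite size_filter; apply: count_size.
  apply: wp_conseq.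
    apply: (@wp_sort_inner _ iu bl D) => /=.
    + by rewrite (ka aNx1) // hval ?subn1; [exact: hb1 | move/eqP: t0; lia].
    + have := perm_uniq pD'; rewrite filter_uniq //.
      by rewrite (perm_uniq (s2 := bl ++ D)) // perm_cat2r perm_rev.
    + move=> e; rewrite mem_filter (ka aU) //= => /andP[_ el].
      by have [] := hU _ el.
    + exact: hb.
  move=> t' s'' [kr' _ _] [ht' hb'].
  exists (150 * (t - 1) + 150 * (size l1 - size (rev bl ++ D)) + 10).
    rewrite size_cat size_rev; move: ht' bl_sz hn t0.
    by move: (size bl) (size D) => x y; lia.
  exists (t - 1), (rev bl ++ D); split=> //.
    by split; [rewrite kr' //= eT | lia].
  rewrite pairwise_cat sD andbT; apply/andP; split.
    apply/allrelP => e f; rewrite mem_rev mem_filter => /andP[he el] /subD hf.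
    by rewrite /by_pos; move: he; rewrite blk // => /eqP->; lia.
  apply/(pairwiseP 0) => i j hi hj _.
  have ix z : z < size (rev bl) -> index (iv (nth 0 (rev bl) z)) od = t.-1.
    move=> hz; have := mem_nth 0 hz; rewrite mem_rev mem_filter => /andP[+ el].
    by rewrite blk // => /eqP.
  by rewrite /by_pos !ix.
- move=> n s' _ [t [D [[eT le] pD sD hn hb]]] /=; rewrite eT => t0.
  split; first lia.
  move=> t' ht'; split; first lia.
  exists D; split=> //.
  by rewrite t0 in pD; rewrite (eq_filter (a2 := predT)) // filter_predT in pD.
Qed.
End Sort.

(** * Preorder traversal *)

Inductive bintree := Lf of nat | Nd of nat & bintree & bintree.

Definition label t := match t with Lf a => a | Nd a _ _ => a end.

Fixpoint subtrees t : seq bintree :=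
  t :: if t is Nd _ l r then subtrees l ++ subtrees r else [::].

Definition labels t : seq nat := map label (subtrees t).

Definition subtree_at t i := nth (Lf 0) (subtrees t) i.

(** Nothing is required of [nx] at the root and at right children: these are the entries that the
    traversal overwrites with escape pointers. *)
Fixpoint linked (hd nx : nat -> nat) t : Prop :=
  match t with
  | Lf a => hd a = 0
  | Nd a l r =>
      [/\ hd a = label l, nx (label l) = label r, linked hd nx l & linked hd nx r]
  end.

Lemma labels_Nd a l r : labels (Nd a l r) = a :: labels l ++ labels r.
Proof. by rewrite /labels /= map_cat. Qed.

Lemma subtrees_head t : subtrees t = t :: behead (subtrees t).
Proof. by case: t. Qed.

Lemma labels_head t : labels t = label t :: behead (labels t).
Proof. by case: t. Qed.

Lemma label_in t : label t \in labels t.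
Proof. by rewrite labels_head mem_head. Qed.

Lemma size_labels t : size (labels t) = size (subtrees t).
Proof. by rewrite size_map. Qed.

Lemma linked_upd hd nx z x t : z \notin behead (labels t) ->
  linked hd nx t -> linked hd (upd nx z x) t.
Proof.
elim: t => [//|a l IHl r IHr].
rewrite labels_Nd /= mem_cat negb_or => /andP[zl zr].
case=> h1 h2 h3 h4; split=> //.
- by case: eqP zl => // <-; rewrite label_in.
- by apply: IHl h3; apply: contra zl; rewrite [labels l]labels_head inE => ->; rewrite orbT.
- by apply: IHr h4; apply: contra zr; rewrite [labels r]labels_head inE => ->; rewrite orbT.
Qed.

(** The reason why tree nodes are intervals: in preorder a subtree is a block that starts at its
    root. *)
Lemma drop_subtrees t i : i < size (subtrees t) ->
  exists rest, drop i (subtrees t) = subtrees (subtree_at t i) ++ rest.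
Proof.
rewrite /subtree_at; elim: t i => [a|a l IHl r IHr] [|i] /= hi //.
- by exists [::].
- by exists [::]; rewrite cats0.
- rewrite drop_cat nth_cat; case: ltnP => hil.
    by have [rest ->] := IHl _ hil; exists (rest ++ subtrees r); rewrite catA.
  by apply: IHr; move: hi; rewrite size_cat; lia.
Qed.

Lemma subtree_at_end t i : i < size (labels t) ->
  i + size (labels (subtree_at t i)) <= size (labels t).
Proof.
rewrite !size_labels => hi; have [rest e] := drop_subtrees hi.
have := congr1 size e; rewrite size_drop size_cat; lia.
Qed.

Lemma mem_subtree_at t i y : uniq (labels t) -> i < size (labels t) ->
  y \in labels t ->
  (y \in labels (subtree_at t i)) =
  (i <= index y (labels t) < i + size (labels (subtree_at t i))).
Proof.
move=> ut hi hy; rewrite -(cat_take_drop i (labels t)) in ut hy *.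
have st : size (take i (labels t)) = i by rewrite size_takel // ltnW.
have [|rest e] := @drop_subtrees t i; first by rewrite -size_labels.
have eD : drop i (labels t) = labels (subtree_at t i) ++ map label rest.
  by rewrite /labels -map_drop e map_cat.
rewrite eD in ut hy *; move: ut; rewrite cat_uniq => /and3P[_ /hasPn ht ut].
rewrite !index_cat st; case: ifP => yt.
  have -> : (y \in labels (subtree_at t i)) = false.
    by apply/negP => yl; move: (ht y); rewrite mem_cat yl yt => /(_ isT).
  have lt : index y (take i (labels t)) < i by rewrite -[X in _ < X]st index_mem.
  by rewrite leqNgt lt.
rewrite leq_addr ltn_add2l; case: ifP => yl; first by rewrite index_mem yl.
by rewrite ltnNge leq_addr.
Qed.

(** For [rest] the pending subtrees of the traversal, this identifies the target of an escape
    pointer. If nothing is pending, both sides take the default 0, which is the null pointer. *)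
Lemma nth_labels t i k rest : drop (i + k) (subtrees t) = flatten (map subtrees rest) ->
  nth 0 (labels t) (i + k) = head 0 (map label rest).
Proof.
move=> e; rewrite -[i + k]addn0 -nth_drop -nth0 -map_drop e.
by case: rest {e} => //= t' rest; rewrite subtrees_head.
Qed.

(** * The traversal without a stack *)

Section Traverse.
Variables X B : nat.
Local Notation wp := (wp X B).

(** The recursion stack [st] of pending subtrees exists only as the chain of [aNx] pointers that
    starts at [rU]. At an inner node the left child already points to its sibling, and handing the
    pointer of the node to the right child turns the chain for [st] into one for both children
    followed by the rest. *)
Lemma wp_traverse s N m T : rg s rN = N -> size (labels T) = m -> N + m < X ->
  uniq (labels T) -> 0 \notin labels T -> ar s aHd 0 = label T ->
  ar s aNx (label T) = 0 -> linked (ar s aHd) (ar s aNx) T ->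
  wp ph_traverse (fun t s' => [/\ t <= 200 * m + 100,
    forall t, t < m -> ar s' aVal (N + t) = nth 0 (labels T) t,
    forall i, ~~ (N <= i < N + m) -> ar s' aVal i = ar s aVal i,
    forall i, i < m -> ar s' aPos (nth 0 (labels T) i) = i
  & forall i, i < m -> ar s' aPos (ar s' aNx (nth 0 (labels T) i)) =
      i + size (labels (subtree_at T i))]) s.
Proof.
set od := labels T => hN so hX uo o0 hH hnx hl.
rewrite /ph_traverse; do 2!step; apply: wp_seq.
pose I n s' := exists t st, [/\ rg s' rT = t /\ t <= m,
  150 * (m - t) + 10 <= n,
  [/\ drop t (subtrees T) = flatten (map subtrees st),
   chain (ar s' aNx) (rg s' rU) (map label st)
   & forall x, x \in map label st -> x != 0 ] /\
   (forall i, i < size st -> linked (ar s aHd) (ar s' aNx) (nth (Lf 0) st i)),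
  (forall i, i < t -> ar s' aVal (N + i) = nth 0 od i) /\
  (forall i, ~~ (N <= i < N + m) -> ar s' aVal i = ar s aVal i)
  & (forall i, i < t -> ar s' aPos (nth 0 od i) = i) /\
    (forall i, i < t -> ar s' aNx (nth 0 od i) =
       nth 0 od (i + size (labels (subtree_at T i))))].
have sT : size (subtrees T) = m by rewrite -size_labels.
apply: (@wp_while _ _ I (150 * m + 10)).
- exists 0, [:: T]; split=> //=; first lia.
  split; last by case.
  split; rewrite ?drop0 ?cats0 //=.
    by rewrite hH; split=> //; apply: contraNneq o0 => <-; apply: label_in.
  by move=> x; rewrite inE => /eqP->; apply: contraNneq o0 => <-; apply: label_in.
- move=> n {}s' [kr ka _] [t [st [[eT tm] hn [[hd hc hnz] hlk] [hv hv'] [hp hx]]]] /=.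
  rewrite (chain_head0 hc); case: st hd hc hnz hlk => [//|T0 st] hd hc hnz hlk _.
  have eN : rg s' rN = N by rewrite kr.
  have [eU u0 hc'] := hc.
  have hH' : ar s' aHd = ar s aHd by rewrite ka.
  have lt : t < m.
    rewrite -sT -subn_gt0 -size_drop hd /= [subtrees T0]subtrees_head //.
  have eod : drop t od = labels T0 ++ flatten (map labels st).
    rewrite /od /labels -map_drop hd /= map_cat; congr (_ ++ _).
    by elim: (st) => //= T1 st1 IH; rewrite map_cat IH.
  have hd1 : drop (t + size (labels T0)) (subtrees T) = flatten (map subtrees st).
    by rewrite size_labels addnC -drop_drop hd /= drop_size_cat.
  have od_t : nth 0 od t = label T0.
    by rewrite -[t]addn0 -nth_drop eod labels_head.
  have nxu : ar s' aNx (label T0) = nth 0 od (t + size (labels T0)).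
    rewrite (nth_labels hd1); move: hc'.
    by case: (st) => //= T1 st1 [].
  have at_t : subtree_at T t = T0.
    by rewrite /subtree_at -[t]addn0 -nth_drop hd /= [subtrees T0]subtrees_head.
  have od_inj i : i < m -> nth 0 od i = label T0 -> i = t.
    by rewrite -od_t => hi /eqP; rewrite nth_uniq ?so // => /eqP.
  have uS : uniq (labels T0 ++ flatten (map labels st)) by rewrite -eod drop_uniq.
  have common_v i : i < t.+1 ->
      (if N + i == N + t then label T0 else ar s' aVal (N + i)) = nth 0 od i.
    by rewrite eqn_add2l; case: eqP => [->|ne] hi //; apply: hv; lia.
  have common_v' i : ~~ (N <= i < N + m) ->
      (if i == N + t then label T0 else ar s' aVal i) = ar s aVal i.
    by move=> hi; rewrite ifF ?hv' //; lia.
  have common_p i : i < t.+1 ->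
      (if nth 0 od i == label T0 then t else ar s' aPos (nth 0 od i)) = i.
    move=> hi; case: eqP => [/od_inj -> //|ne]; first by lia.
    by rewrite hp //; have [ei|] := eqVneq i t; [rewrite ei od_t in ne | lia].
  do 4!step; step; rewrite !hH' eN eT eU.
  + case: T0 eU u0 hc hc' hd hnz hlk eod hd1 od_t nxu at_t od_inj uS
      common_v common_v' common_p => [a|a l r] eU u0 hc hc' hd hnz hlk eod hd1
      od_t nxu at_t od_inj uS common_v common_v' common_p.
      by have /= -> := hlk 0 isT.
    have [/= ha hlr hkl hkr] := hlk 0 isT.
    rewrite ha => l0; rewrite /= in od_t nxu od_inj common_v common_v' common_p.
    do 2!step; rewrite eU hlr addn1.
    have uS' : uniq ((a :: labels l) ++
        label r :: (behead (labels r) ++ flatten (map labels st))).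
      by move: uS; rewrite labels_Nd [labels r]labels_head /= -!catA.
    move: uS'; rewrite uniq_catC /=  !mem_cat inE !negb_or -!andbA.
    case/and5P=> rr rF ra rl _.
    have rst i : i < size st -> label r \notin labels (nth (Lf 0) st i).
      move=> hi; apply: contra rF => hr; apply/flattenP.
      exists (labels (nth (Lf 0) st i)) => //.
      by rewrite -(nth_map _ [::]) // mem_nth // size_map.
    have rst' : label r \notin map label st.
      apply/negP => /(nthP 0)[i]; rewrite size_map => hi.
      rewrite (nth_map (Lf 0)) // => e; move: (rst i hi).
      by rewrite -e label_in.
    exists (150 * (m - t.+1) + 10); first lia.
    have nl : label l == label r = false.
      by apply/negP => /eqP e; move: rl; rewrite -e label_in.
    have r0 : label r != 0.
      apply: contraNneq o0 => <-; rewrite -(cat_take_drop t od) mem_cat eod.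
      by rewrite labels_Nd /= !(inE, mem_cat) label_in !orbT.
    exists t.+1, [:: l, r & st]; split=> //; first by rewrite /= addn1.
    * split; last first.
        case=> [|[|i]] /= hi; apply: linked_upd => //.
        - by apply: contra rl; rewrite [labels l]labels_head inE => ->; rewrite orbT.
        - have := rst i hi; apply: contra.
          by rewrite [labels (nth _ _ _)]labels_head inE => ->; rewrite orbT.
        - exact: (hlk i.+1).
      split.
      - by rewrite -[t.+1]add1n -drop_drop hd /= drop0 -catA.
      - rewrite /= nl eqxx; split=> //; split=> //.
        by apply: chain_upd.
      - move=> x; rewrite !inE => /or3P[/eqP->|/eqP->|hx1] //.
        by apply: hnz; rewrite /= inE hx1 orbT.
    * split=> // i hi /=; have [->|ne] := eqVneq i t.
        by rewrite od_t (eq_sym a) (negbTE ra) at_t nxu.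
      rewrite ifF; first by apply: hx; lia.
      apply/negP => /eqP e; have := mem_nth 0 (_ : i < size (take t od)).
      rewrite size_takel ?so // nth_take ?e; last by lia.
      move=> /(_ ltac:(lia)) ht; move: uo; rewrite -(cat_take_drop t od) cat_uniq.
      move=> /and3P[_ /hasPn /(_ (label r)) + _]; rewrite ht eod labels_Nd.
      by rewrite /= !(inE, mem_cat) label_in !orbT => /(_ isT).
  + case: T0 eU u0 hc hc' hd hnz hlk eod hd1 od_t nxu at_t od_inj uS
      common_v common_v' common_p => [a|a l r] eU u0 hc hc' hd hnz hlk eod hd1
      od_t nxu at_t od_inj uS common_v common_v' common_p; last first.
      have [/= -> _ _ _] := hlk 0 isT => l0; move: o0.
      rewrite -(cat_take_drop t od) mem_cat eod labels_Nd -l0.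
      by rewrite /= !(inE, mem_cat) label_in !orbT.
    move=> _; step; rewrite eU addn1.
    exists (150 * (m - t.+1) + 10); first lia.
    exists t.+1, st; split=> //; first by rewrite /= addn1.
    * split; last by move=> i hi; apply: (hlk i.+1).
      split=> //; first by rewrite addn1 in hd1.
      by move=> x hx1; apply: hnz; rewrite /= inE hx1 orbT.
    * split=> // i hi /=; have [->|ne] := eqVneq i t.
        by rewrite od_t at_t nxu.
      by apply: hx; lia.
- move=> n s' _ [t [st [[eT tm] hn [[hd hc hnz] hlk] [hv hv'] [hp hx]]]] /= u0.
  have := chain_head0 hc; rewrite u0 eqxx => /esym/eqP est.
  have {}est : st = [::] by case: (st) est.
  have et : t = m.
    by have := congr1 size hd; rewrite size_drop est sT /=; lia.
  rewrite et in eT hv hp hx; split; first lia.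
  move=> t' ht'; step; split=> //.
  + lia.
  + move=> i hi; rewrite ifF ?hp //; apply: contraNF o0 => /eqP<-.
    by rewrite mem_nth ?so.
  + move=> i hi; rewrite hx //.
    have := @subtree_at_end T i; rewrite -/od so => /(_ hi) le.
    have [lt|ge] := ltnP (i + size (labels (subtree_at T i))) m.
      rewrite ifF ?hp //; apply: contraNF o0 => /eqP<-.
      by rewrite mem_nth ?so.
    (* A subtree that reaches the end of the preorder has escape pointer 0, and the last command of
       the phase has given 0 the position [m]. *)
    by rewrite nth_default ?so //= eT; lia.
Qed.
End Traverse.

(** * Ancestors in rooted trees *)

Section Ancestors.
Variables (V : finType) (par : {ffun V -> option V}).
Hypothesis rooted : rooted_tree par.
Local Notation anc := (ancestor par).

Definition up (o : option V) : option V := obind par o.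

Lemma up_None k : iter k up None = None.
Proof. by elim: k => //= k ->. Qed.

Lemma ancP u v : reflect (exists k, iter k up (Some v) = Some u) (anc u v).
Proof.
apply: (iffP connectP) => [[q pq ->]|[k]].
  exists (size q); elim/last_ind: q pq => [//|q z IH].
  rewrite rcons_path last_rcons size_rcons => /andP[pq hz].
  have pz : par z = Some (last u q) by apply/eqP.
  by rewrite iterSr /= pz; apply: IH.
elim: k v => [|k IH] v; first by case=> <-; exists [::].
rewrite iterSr /=; case pv: (par v) => [w|]; last by rewrite up_None.
case/IH=> q pq e; exists (rcons q v); rewrite ?last_rcons //.
by rewrite rcons_path pq /= -e pv.
Qed.

Lemma anc_refl u : anc u u.
Proof. exact: connect0. Qed.

Lemma anc_trans v u w : anc u v -> anc v w -> anc u w.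
Proof. exact: connect_trans. Qed.

(** If the root is [n] steps above [v], then going around the loop [n.+1] times takes more than [n]
    steps and would have to pass beyond the root, where [up] yields [None] for good. *)
Lemma up_loop k v : iter k.+1 up (Some v) <> Some v.
Proof.
have [r [r0 hr]] := rooted; have /ancP[n hn] := hr v.
move=> loop; have loops j : iter (j * k.+1) up (Some v) = Some v.
  by elim: j => // j IH; rewrite mulSn iterD IH.
have := loops n.+1; have -> : n.+1 * k.+1 = (n.+1 * k.+1 - n.+1) + n.+1.
  by rewrite subnK // leq_pmulr.
by rewrite iterD iterS hn /= r0 up_None.
Qed.

Lemma anc_antisym u v : anc u v -> anc v u -> u = v.
Proof.
case/ancP=> [[|k]] h1 /ancP[l h2]; first by case: h1.
by have := @up_loop (l + k) v; rewrite -addnS iterD h1 h2.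
Qed.

Lemma anc_total u v y : anc u y -> anc v y -> anc u v || anc v u.
Proof.
move=> /ancP[k hk] /ancP[l hl]; case/orP: (leq_total k l) => le; apply/orP.
  by right; apply/ancP; exists (l - k); rewrite -hk -iterD subnK.
by left; apply/ancP; exists (k - l); rewrite -hl -iterD subnK.
Qed.

Lemma anc_parent u v : par v = Some u -> anc u v.
Proof. by move=> h; apply: connect1; apply/eqP. Qed.

Lemma anc_step u v w : par v = Some w -> anc u v = (u == v) || anc u w.
Proof.
move=> pv; apply/idP/orP => [/ancP[[|k]]|[/eqP->|h]].
- by case=> ->; rewrite eqxx; left.
- by rewrite iterSr /= pv => h; right; apply/ancP; exists k.
- exact: anc_refl.
- exact: anc_trans h (anc_parent pv).
Qed.

Lemma anc_root u v : par v = None -> anc u v = (u == v).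
Proof.
move=> pv; apply/idP/eqP => [/ancP[[|k]]|->]; last exact: anc_refl.
  by case=> ->.
by rewrite iterSr /= pv up_None.
Qed.

Lemma parent_neq u v : par v = Some u -> u != v.
Proof. by move=> h; apply/eqP => e; apply: (@up_loop 0 v); rewrite /= h e. Qed.

Lemma not_anc_parent u v : par v = Some u -> anc v u = false.
Proof.
move=> h; apply/negP => vu; have := anc_antisym vu (anc_parent h).
by move=> e; have := parent_neq h; rewrite e eqxx.
Qed.

Lemma siblings_disjoint c d x y : par c = Some x -> par d = Some x -> c != d ->
  anc c y -> anc d y -> False.
Proof.
move=> pc pd ne cy dy; have := anc_total cy dy.
rewrite (anc_step _ pc) (anc_step _ pd) (not_anc_parent pc) (not_anc_parent pd).
by rewrite [d == c]eq_sym (negbTE ne).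
Qed.

Lemma anc_down x y : anc x y -> x != y -> exists2 c, par c = Some x & anc c y.
Proof.
case/ancP=> k; elim: k y => [|k IH] y; first by case=> ->; rewrite eqxx.
rewrite iterSr /=; case py: (par y) => [z|]; last by rewrite up_None.
move=> h _; have [e|ne] := eqVneq x z.
  by exists y; [rewrite py e | exact: anc_refl].
have [c pc cz] := IH _ h ne; exists c => //.
exact: anc_trans cz (anc_parent py).
Qed.

End Ancestors.

(** * From child lists to binary trees *)

Section BinTree.
Variables (m : nat) (par : {ffun 'I_m -> option 'I_m}).
Hypothesis rooted : rooted_tree par.
Hypothesis full : full_binary par.
Local Notation anc := (ancestor par).

Definition parent_code e : nat :=
  nth 0 [seq encode_opt (par i) | i <- enum 'I_m] e.-1.

Lemma parent_codeE (i : 'I_m) : parent_code i.+1 = encode_opt (par i).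
Proof.
by rewrite /parent_code /= (nth_map i) ?size_enum_ord // nth_ord_enum.
Qed.

Lemma encode_optE (o : option 'I_m) (x : 'I_m) : (encode_opt o == x.+1) = (o == Some x).
Proof. by case: o. Qed.

Definition kids k := [seq e <- rev (iota 1 m) | parent_code e == k].

Lemma mem_kids k e : e \in kids k ->
  exists2 c : 'I_m, e = c.+1 & encode_opt (par c) = k.
Proof.
rewrite mem_filter mem_rev mem_iota => /andP[/eqP pk he].
case: e pk he => // e pk he; have lt : e < m by lia.
by exists (Ordinal lt) => //; rewrite -parent_codeE.
Qed.

Lemma kids_uniq k : uniq (kids k).
Proof. by rewrite filter_uniq // rev_uniq iota_uniq. Qed.

Lemma in_kids (c : 'I_m) : c.+1 \in kids (encode_opt (par c)).
Proof. by rewrite mem_filter parent_codeE eqxx mem_rev mem_iota /= ltnS. Qed.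

Lemma size_kids (x : 'I_m) : size (kids x.+1) = #|children par x|.
Proof.
rewrite size_filter count_rev.
have -> : iota 1 m = map succn (map val (enum 'I_m)).
  by rewrite val_enum_ord (iotaDl 1 0).
rewrite -map_comp count_map /children cardsE cardE size_filter -enumT.
by apply: eq_count => i; rewrite /= parent_codeE encode_optE.
Qed.

Definition tree_of (t : bintree) (x : 'I_m) : Prop :=
  label t = x.+1 /\
  forall z, z \in labels t <-> exists2 y : 'I_m, z = y.+1 & anc x y.

Variables hd nx : nat -> nat.
Hypothesis bk : buckets nx hd parent_code (rev (iota 1 m)).

(** By induction on the number of descendants. Fullness leaves child lists with no or two entries,
    the two constructors of [bintree]; the order of the children is that of the list. *)
Lemma bintree_at (x : 'I_m) : exists t, [/\ tree_of t x, linked hd nx t, uniq (labels t)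
  & forall i, i < size (subtrees t) -> exists y, tree_of (subtree_at t i) y].
Proof.
have [n] := ubnP #|[pred y | anc x y]|; elim: n x => // n IH x /ltnSE le.
have bkx := bk x.+1; rewrite -/(kids x.+1) in bkx.
have lt c : par c = Some x -> #|[pred y | anc c y]| < n.
  move=> pc; apply: leq_trans le; apply: proper_card; apply/properP; split.
    by apply/subsetP => y; rewrite !inE; apply: anc_trans (anc_parent pc).
  by exists x; rewrite !inE ?anc_refl // not_anc_parent.
case: (full x) => [/eqP ch0|ch2].
  have k0 : kids x.+1 = [::] by apply: size0nil; rewrite size_kids ch0 cards0.
  rewrite k0 /= in bkx; exists (Lf x.+1).
  have tx : tree_of (Lf x.+1) x.
    split=> // z; rewrite inE; split=> [/eqP->|[y -> xy]].
      by exists x => //; apply: anc_refl.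
    have [-> //|ne] := eqVneq x y.
    have [c pc _] := anc_down xy ne.
    have : c \in children par x by rewrite inE pc.
    by rewrite ch0 inE.
  by split=> //; case=> [|//] _; exists x.
have := size_kids x; rewrite ch2 => sk.
case ek: (kids x.+1) sk => [//|a [//|b [|//]]] _.
have : a \in kids x.+1 by rewrite ek mem_head.
case/mem_kids=> c ea /eqP; rewrite encode_optE => /eqP pc.
have : b \in kids x.+1 by rewrite ek !inE eqxx orbT.
case/mem_kids=> d eb /eqP; rewrite encode_optE => /eqP pd.
have := kids_uniq x.+1; rewrite ek /= inE andbT => nab.
have ncd : c != d by apply: contra nab => /eqP e; rewrite ea eb e.
rewrite ek /= in bkx; case: bkx => h1 _ [h2 _ _].
have [t1 [[l1 T1] k1 u1 s1]] := IH c (lt c pc).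
have [t2 [[l2 T2] k2 u2 s2]] := IH d (lt d pd).
have tx : tree_of (Nd x.+1 t1 t2) x.
  split=> // z; rewrite labels_Nd inE mem_cat; split.
    case/or3P=> [/eqP->|/T1[y -> cy]|/T2[y -> dy]].
    - by exists x => //; apply: anc_refl.
    - by exists y => //; apply: anc_trans (anc_parent pc) cy.
    - by exists y => //; apply: anc_trans (anc_parent pd) dy.
  case=> y -> xy; have [->|ne] := eqVneq x y; first by rewrite eqxx.
  have [c' pc' cy] := anc_down xy ne.
  have : c'.+1 \in kids x.+1.
    have := in_kids c'; by rewrite pc'.
  rewrite ek !inE ea eb !eqSS => /orP[/eqP|/eqP] /val_inj e; rewrite e in cy.
    by apply/or3P/Or32/T1; exists y.
  by apply/or3P/Or33/T2; exists y.
exists (Nd x.+1 t1 t2); split=> //.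
- by split=> //; rewrite ?l1 ?l2 -?ea -?eb.
- rewrite labels_Nd /= mem_cat cat_uniq u1 u2 andbT negb_or.
  apply/and3P; split=> //.
    apply/andP; split; apply/negP.
      by case/T1=> y [/val_inj <-]; rewrite not_anc_parent.
    by case/T2=> y [/val_inj <-]; rewrite not_anc_parent.
  apply/hasPn => z /T2[y -> dy]; apply/negP => /T1[y' [/val_inj <-] cy].
  exact: siblings_disjoint pc pd ncd cy dy.
- case=> [|i] /= hi; first by exists x.
  rewrite /subtree_at /= nth_cat; case: ltnP => hil; first exact: s1.
  by apply: s2; move: hi; rewrite size_cat; lia.
Qed.

Lemma bintree_exists : exists T, [/\ linked hd nx T, hd 0 = label T,
    nx (label T) = 0, uniq (labels T)
  & perm_eq (labels T) (iota 1 m) /\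
    forall i (x y : 'I_m), nth 0 (labels T) i = x.+1 ->
      (y.+1 \in labels (subtree_at T i)) = anc x y].
Proof.
have [r [r0 hr]] := rooted.
have [T [[lT TT] kT uT sT]] := bintree_at r.
have k0 : kids 0 = [:: r.+1].
  have sub e : e \in kids 0 -> e = r.+1.
    case/mem_kids=> c -> pc; have {}pc : par c = None by case: (par c) pc.
    by move: (hr c); rewrite anc_root // => /eqP->.
  have rin : r.+1 \in kids 0 by have := in_kids r; rewrite r0.
  have := kids_uniq 0; case: (kids 0) sub rin => [//|a [|b k]] sub rin.
    by move=> _; rewrite (sub a) // mem_head.
  by rewrite /= inE (sub a) ?mem_head // (sub b) ?inE ?eqxx ?orbT.
have := bk 0; rewrite -/(kids 0) k0 => -[h1 _ h2].
exists T; split=> //; rewrite ?lT //; split.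
  apply: uniq_perm => //; first exact: iota_uniq.
  move=> z; apply/idP/idP => [/TT[y -> _]|].
    by rewrite mem_iota /= ltnS.
  rewrite mem_iota => hz; apply/TT; have lt : z.-1 < m by lia.
  by exists (Ordinal lt) => //=; lia.
move=> i x y ei; have hi : i < size (subtrees T).
  by rewrite -size_labels ltnNge; apply/negP => ge; rewrite nth_default in ei.
have [x' [lx Tx]] := sT i hi.
have : label (subtree_at T i) = x.+1 by rewrite -ei /labels (nth_map (Lf 0)).
rewrite lx => -[/val_inj e]; rewrite e in Tx.
by apply/idP/idP => [/Tx[y' [/val_inj <-]]|xy] //; apply/Tx; exists y.
Qed.

End BinTree.

(** A full binary tree with [n] leaves has [2 * n - 1] nodes. This turns the running time in terms
    of nodes into one in terms of vertices of the graph. *)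
Lemma labels_leaves hd nx T : linked hd nx T -> 0 \notin labels T ->
  (size (labels T)).+1 = 2 * count (fun a => hd a == 0) (labels T).
Proof.
elim: T => [a|a l IHl r IHr]; first by move=> /= ->.
rewrite labels_Nd => -[h1 _ hl hr]; rewrite inE mem_cat !negb_or.
case/and3P=> _ l0 r0; have := IHl hl l0; have := IHr hr r0.
rewrite /= size_cat count_cat h1.
have -> : (label l == 0) = false.
  by apply: contraNF l0 => /eqP<-; apply: label_in.
lia.
Qed.

(** * Persistent segment trees *)

Section Rep.
Variable od : seq nat.

(* The node [id], at height [j] above the leaves, is the root of a tree for the
   restriction of [S] to the block of positions [q * 2 ^ j, (q + 1) * 2 ^ j). *)
Fixpoint rep (L R V : nat -> nat) fr j id q (S : nat -> bool) : Prop :=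
  id < fr /\
  match j with
  | 0 => [/\ L id = 0, R id = 0 & V id = if S q then nth 0 od q else 0]
  | j'.+1 => [/\ V id = 0, rep L R V fr j' (L id) (2 * q) S
                & rep L R V fr j' (R id) (2 * q).+1 S]
  end.

Lemma rep_lt L R V fr j id q S : rep L R V fr j id q S -> id < fr.
Proof. by case: j => [|j] []. Qed.

Lemma rep_ext S S' L R V fr j id q :
  (forall z, q * 2 ^ j <= z < q.+1 * 2 ^ j -> S z = S' z) ->
  rep L R V fr j id q S -> rep L R V fr j id q S'.
Proof.
elim: j id q => [|j IH] id q e /=.
  by rewrite -e // expn0; lia.
case=> lt [v0 rl rr]; split=> //; split=> //.
  by apply: IH rl => z hz; apply: e; rewrite expnS; lia.
by apply: IH rr => z hz; apply: e; rewrite expnS; lia.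
Qed.

(** Persistence: a version refers only to nodes below the allocation pointer [fr], so whatever is
    written from there on leaves it intact. *)
Lemma rep_agree L R V L' R' V' fr fr' j id q S : fr <= fr' ->
  (forall i, i < fr -> [/\ L' i = L i, R' i = R i & V' i = V i]) ->
  rep L R V fr j id q S -> rep L' R' V' fr' j id q S.
Proof.
move=> le ag; elim: j id q => [|j IH] id q /= [lt].
  by have [-> -> ->] := ag _ lt => h; split=> //; apply: leq_trans le.
have [-> -> ->] := ag _ lt => -[v0 /IH h1 /IH h2].
by split=> //; apply: leq_trans le.
Qed.

Lemma rep_null L R V fr j q : 0 < fr -> L 0 = 0 -> R 0 = 0 -> V 0 = 0 ->
  rep L R V fr j 0 q xpred0.
Proof.
by move=> fr0 l0 r0 v0; elim: j q => [|j IH] q /=; rewrite ?l0 ?r0.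
Qed.

Lemma rep_full L R V fr k : 2 * 2 ^ k <= fr ->
  (forall i, 0 < i < 2 ^ k -> [/\ L i = 2 * i, R i = (2 * i).+1 & V i = 0]) ->
  (forall q, q < 2 ^ k ->
     [/\ L (2 ^ k + q) = 0, R (2 ^ k + q) = 0 & V (2 ^ k + q) = nth 0 od q]) ->
  rep L R V fr k 1 0 xpredT.
Proof.
move=> hfr hin hlf.
suff main j i q : i = 2 ^ (k - j) + q -> q < 2 ^ (k - j) -> j <= k ->
    rep L R V fr j i q xpredT.
  by apply: main; rewrite ?subnn.
elim: j i q => [|j IH] i q ei hq jk /=.
  rewrite subn0 in ei hq; have [l0 r0 v0] := hlf q hq.
  by rewrite ei; split=> //; lia.
have e2 : 2 ^ (k - j) = 2 * 2 ^ (k - j.+1) by rewrite -expnS; congr (_ ^ _); lia.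
have le : 2 ^ (k - j) <= 2 ^ k by rewrite leq_exp2l // leq_subr.
have [|-> -> ->] := hin i; first by lia.
by split; [lia|split=> //; apply: IH; lia].
Qed.

End Rep.

Definition mix x (S1 S2 : nat -> bool) z := if z < x then S1 z else S2 z.

Definition reps od s := rep od (ar s aL) (ar s aR) (ar s aVal).

Definition same_below fr s s' := forall i, i < fr ->
  [/\ ar s' aL i = ar s aL i, ar s' aR i = ar s aR i
    & ar s' aVal i = ar s aVal i].

Lemma same_below_trans fr fr' s1 s2 s3 : fr <= fr' ->
  same_below fr s1 s2 -> same_below fr' s2 s3 -> same_below fr s1 s3.
Proof.
move=> le h1 h2 i hi; have [-> -> ->] := h2 i (leq_trans hi le).
exact: h1.
Qed.

Lemma reps_agree od s s' fr fr' j id q S : fr <= fr' -> same_below fr s s' ->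
  reps od s fr j id q S -> reps od s' fr' j id q S.
Proof. by move=> le ag; apply: rep_agree. Qed.

(** * Splicing, painting and the versions of all nodes *)

Section Versions.
Variables X B : nat.
Local Notation wp := (wp X B).
Variable od : seq nat.
Local Notation reps := (reps od).

(** The last clause of the invariant describes a tree with a hole: whatever is written later, the
    path built so far becomes a tree for [mix x S1 S2] once the node [c], not yet filled in,
    represents its own block. The register [rH] is half the block size, hence 0 exactly at a
    leaf. *)
Lemma wp_splice s F k x S1 S2 :
  rg s rN = 2 ^ k -> rg s rF = F -> rg s rX = x -> x < 2 ^ k -> F + k + 1 < X ->
  reps s F k (rg s rA) 0 S1 -> reps s F k (rg s rB) 0 S2 ->
  wp splice (fun t s' => [/\ t <= 200 * k + 100, rg s' rF = F + k.+1,
    reps s' (F + k.+1) k F 0 (mix x S1 S2) & same_below F s s']) s.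
Proof.
move=> hN hF hx xk hX rA0 rB0; set Sn := mix x S1 S2.
rewrite /splice; do 2!step; apply: wp_seq.
pose I n s' := exists j q, let c := F + (k - j) in
  [/\ [/\ j <= k, rg s' rH = 2 ^ j %/ 2, rg s' rC = c & rg s' rF = c],
      [/\ reps s F j (rg s' rA) q S1, reps s F j (rg s' rB) q S2
        & same_below F s s'],
      rg s' rX + q * 2 ^ j = x /\ rg s' rX < 2 ^ j,
      150 * j + 10 <= n
    & forall L R V fr, (forall i, i < c ->
        [/\ L i = ar s' aL i, R i = ar s' aR i & V i = ar s' aVal i]) ->
        rep od L R V fr j c q Sn -> rep od L R V fr k F 0 Sn].
apply: (@wp_while _ _ I (150 * k + 10)).
- exists k, 0; rewrite subnn addn0 /= hF hN hx; split=> //.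
  by split=> //; lia.
- move=> n s' [kr ka _] [j [q [[jk eH eC eF] [rA rB sb] [ex xj] hn ctx]]] /=.
  case: j jk eH eC eF rA rB ex xj hn ctx => [|j] jk eH eC eF rA rB ex xj hn ctx.
    by rewrite eH.
  have {}eH : rg s' rH = 2 ^ j by rewrite eH expnS mulKn.
  move=> _; set c := F + (k - j.+1) in eC eF ctx.
  have ec1 : F + (k - j) = c.+1 by rewrite /c; lia.
  have cF : F <= c by rewrite /c; lia.
  have cX : c.+1 < X by rewrite /c; lia.
  have nc i : i < c -> (i == c) = false by lia.
  have e2 : 2 ^ j.+1 = 2 * 2 ^ j by rewrite expnS.
  case: rA => ltA [_ rAl rAr]; case: rB => ltB [_ rBl rBr].
  have nA : (rg s' rA == c) = false by lia.
  have nB : (rg s' rB == c) = false by lia.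
  have [lA lrA _] := sb _ ltA; have [lB lrB _] := sb _ ltB.
  do 2!step.
  step; rewrite eC eF eH.
  + rewrite eqb0 negbK => xlt; do 5!step; step; rewrite ?eC ?eF ?eH ?nA ?nB lA lB lrB addn1.
    exists (150 * j + 10); first by lia.
    exists j, (2 * q); rewrite ec1 /=; split=> //.
    * by split=> //; lia.
    * by split=> // i hi; rewrite /= nc; [exact: sb | lia].
    * by rewrite e2 in ex; lia.
    * move=> L R V fr ag rc; apply: ctx.
        by move=> i hi; have [|-> -> ->] := ag i; [lia | rewrite nc].
      have [//|] := ag c; rewrite !eqxx ?addn1 => eL eR eV.
      split; first by have := rep_lt rc; lia.
      split=> //; rewrite ?eL // eR.
      have ltc := rep_lt rc.
      (* The cut falls into the left half of the block, so the whole right half lies beyond it and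
         is shared with the second tree. *)
      apply: (rep_ext (S := S2)).
        by move=> z hz; rewrite /Sn /mix ifF //; nia.
      apply: rep_agree rBr; first by lia.
      move=> i hi; have [|-> -> ->] := ag i; first lia.
      by rewrite nc; [exact: sb | lia].
  + move=> /eqP; rewrite eqb0 -leqNgt => xge; do 6!step; step.
    rewrite ?eC ?eF ?eH ?nA ?nB lA lrA lrB addn1.
    exists (150 * j + 10); first by lia.
    exists j, (2 * q).+1; rewrite ec1 /=; split=> //.
    * by split=> //; lia.
    * by split=> // i hi; rewrite /= nc; [exact: sb | lia].
    * by rewrite e2 in ex xj; lia.
    * move=> L R V fr ag rc; apply: ctx.
        by move=> i hi; have [|-> -> ->] := ag i; [lia | rewrite nc].
      have [//|] := ag c; rewrite !eqxx ?addn1 => eL eR eV.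
      split; first by have := rep_lt rc; lia.
      split=> //; rewrite ?eR // eL.
      have ltc := rep_lt rc.
      (* Here the cut falls into the right half, and the left half is shared with the first tree. *)
      apply: (rep_ext (S := S1)).
        by move=> z hz; rewrite /Sn /mix ifT //; nia.
      apply: rep_agree rAl; first by lia.
      move=> i hi; have [|-> -> ->] := ag i; first lia.
      by rewrite nc; [exact: sb | lia].
- move=> n s' [kr ka _] [j [q [[jk eH eC eF] [rA rB sb] [ex xj] hn ctx]]] /=.
  rewrite eH => h0.
  have j0 : j = 0.
    case: j h0 {jk eH eC eF rA rB ex xj hn ctx} => // j.
    by rewrite expnS mulKn // => /eqP; rewrite expn_eq0.
  move: jk eH eC eF rA rB ex xj hn ctx {h0}; rewrite j0 subn0 => jk eH eC eF.
  move=> [ltA [_ _ vA]] [ltB [_ _ vB]] ex xj hn ctx.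
  split; first lia.
  move=> t ht; do 4!step; rewrite eC eF.
  have [_ _ vB'] := sb _ ltB.
  have nc i : i < F + k -> (i == F + k) = false by lia.
  split=> //=; try lia.
  + apply: ctx.
      by move=> i hi /=; rewrite nc.
    split=> /=; first by lia.
    rewrite !eqxx; split=> //; rewrite vB' vB /Sn /mix.
    by have -> : (q < x) = false by rewrite expn0 in ex xj; lia.
  + by move=> i hi /=; rewrite nc; [exact: sb | lia].
Qed.

Section Paint.
Variables (k : nat) (lo hi : nat -> nat) (sg : nat -> bool).

Definition paint (S : nat -> bool) e z := if lo e <= z < hi e then sg e else S z.

Definition item_data s e :=
  [/\ ar s aS e = sg e, ar s aPos (ar s aV e) = lo e,
      ar s aPos (ar s aNx (ar s aV e)) = hi e, lo e < 2 ^ k & hi e < 2 ^ k].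

Lemma wp_paint s F S bl :
  rg s rN = 2 ^ k -> rg s rF = F -> chain (ar s aNx2) (rg s rE) bl ->
  F + 2 * k.+1 * size bl + 1 < X ->
  reps s F k (rg s rR) 0 S -> (forall b : bool, reps s F k b 0 (fun=> b)) ->
  (forall e, e \in bl -> item_data s e) ->
  wp ph_paint (fun t s' => [/\ t <= (400 * k + 500) * size bl + 10,
    rg s' rF = F + 2 * k.+1 * size bl,
    reps s' (F + 2 * k.+1 * size bl) k (rg s' rR) 0 (foldl paint S bl)
    & same_below F s s']) s.
Proof.
move=> hN hF hc hX hR hb hit; rewrite /ph_paint.
pose I n s' := exists a r : seq nat, [/\ bl = a ++ r, chain (ar s aNx2) (rg s' rE) r,
  (400 * k + 500) * size r + 10 <= n /\ rg s' rF = F + 2 * k.+1 * size a,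
  reps s' (F + 2 * k.+1 * size a) k (rg s' rR) 0 (foldl paint S a)
  & same_below F s s'].
apply: (@wp_while _ _ I ((400 * k + 500) * size bl + 10)).
- by exists [::], bl; split=> //=; rewrite ?muln0 ?addn0.
- move=> n s' [kr ka _] [a [r [ebl hr [hn hF'] hR' sb]]] /=.
  rewrite (chain_head0 hr); case: r hr ebl hn => [//|e r] /= [eE e0 hr] ebl hn _.
  have ein : e \in bl by rewrite ebl mem_cat mem_head orbT.
  have [d1 d2 d3 d4 d5] := hit _ ein.
  have eN : rg s' rN = 2 ^ k by rewrite kr.
  have aP : ar s' aPos = ar s aPos by apply: ka.
  have aN : ar s' aNx = ar s aNx by apply: ka.
  have aV' : ar s' aV = ar s aV by apply: ka.
  have aS' : ar s' aS = ar s aS by apply: ka.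
  have aN2 : ar s' aNx2 = ar s aNx2 by apply: ka.
  have sz : size bl = size a + (size r).+1 by rewrite ebl size_cat.
  set F' := F + 2 * k.+1 * size a in hF' hR'.
  have FX : F' + 2 * k.+1 + 1 < X by rewrite /F'; move: hX; rewrite sz; nia.
  have FF' : F <= F' by rewrite /F'; lia.
  do 4!step; rewrite eE aP aV' aS' d1 d2 hF'.
  apply: wp_seq; apply: wp_conseq.
    apply: (@wp_splice _ F' k (lo e) (foldl paint S a) (fun=> sg e)) => //=; first lia.
    exact: reps_agree FF' sb (hb _).
  move=> t1 s1 [kr1 ka1 _] [ht1 hF1 hG1 sb1].
  have eN1 : rg s1 rN = 2 ^ k by rewrite kr1.
  have eE1 : rg s1 rE = e by rewrite kr1.
  have eG1 : rg s1 rG = F' by rewrite kr1.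
  have eR1 : rg s1 rR = rg s' rR by rewrite kr1.
  have aP1 : ar s1 aPos = ar s aPos by rewrite -aP; apply: ka1.
  have aN1 : ar s1 aNx = ar s aNx by rewrite -aN; apply: ka1.
  have aV1 : ar s1 aV = ar s aV by rewrite -aV'; apply: ka1.
  have aN21 : ar s1 aNx2 = ar s aNx2 by rewrite -aN2; apply: ka1.
  have sb1' : same_below F' s' s1 by apply: sb1.
  do 4!step; rewrite eE1 aP1 aN1 aV1 d3 eG1 eR1 hF1.
  apply: wp_seq; apply: wp_conseq.
    apply: (@wp_splice _ (F' + k.+1) k (hi e)
      (mix (lo e) (foldl paint S a) (fun=> sg e)) (foldl paint S a)) => //=; first lia.
    by apply: reps_agree sb1' hR'; lia.
  move=> t2 s2 [kr2 ka2 _] [ht2 hF2 hG2 sb2].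
  have eE2 : rg s2 rE = e by rewrite kr2.
  have eR2 : rg s2 rR = F' + k.+1 by rewrite kr2.
  have aN22 : ar s2 aNx2 = ar s aNx2 by rewrite -aN21; apply: ka2.
  have sb2' : same_below (F' + k.+1) s1 s2 by apply: sb2.
  have eF2 : F' + k.+1 + k.+1 = F + 2 * k.+1 * (size a).+1 by rewrite /F'; nia.
  step; rewrite eE2 aN22.
  exists ((400 * k + 500) * size r + 10); first by nia.
  exists (rcons a e), r; rewrite size_rcons -eF2 cat_rcons; split=> //=.
  + rewrite eR2 foldl_rcons; apply: rep_ext hG2 => z _.
    rewrite /mix /paint; case: (ltnP z (hi e)) => h1; last by rewrite andbF.
    by rewrite andbT ltnNge; case: (lo e <= z).
  + apply: (same_below_trans _ sb); first exact: FF'.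
    by apply: (same_below_trans _ sb1' sb2'); lia.
- move=> n s' _ [a [r [ebl hr [hn hF'] hR' sb]]] /= h0.
  have := chain_head0 hr; rewrite h0 eqxx => /esym/eqP er.
  rewrite er cats0 in ebl; rewrite -ebl in hF' hR'.
  by split; [lia | move=> t ht; split].
Qed.

(** [Spec] stays abstract to separate the data structure from the combinatorics: all that matters is
    that painting the items at [u] leads from a set correct for the parent to one correct for
    [u]. *)
Lemma wp_versions s m F0 l2 (iu tp : nat -> nat) (Spec : nat -> (nat -> bool) -> Prop) :
  rg s rM = m -> rg s rN = 2 ^ k -> m < 2 ^ k -> size od = m -> uniq od ->
  0 \notin od -> m < X -> F0 = 2 * 2 ^ k -> F0 + 2 * k.+1 * size l2 + 1 < X ->
  (forall t, t < m -> ar s aVal (2 ^ k + t) = nth 0 od t) ->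
  (forall i, i < m -> ar s aTp (nth 0 od i) = tp (nth 0 od i)) ->
  (forall i, i < m -> tp (nth 0 od i) = 0 \/
     exists2 i', i' < i & tp (nth 0 od i) = nth 0 od i') ->
  buckets (ar s aNx2) (ar s aHd2) iu l2 ->
  (forall e, e \in l2 -> item_data s e) ->
  (forall b : bool, reps s F0 k b 0 (fun=> b)) ->
  ar s aRoot 0 = 0 -> Spec 0 xpred0 ->
  (forall u S, u \in od -> Spec (tp u) S ->
     Spec u (foldl paint S [seq e <- l2 | iu e == u])) ->
  wp ph_versions (fun t s' =>
    t <= 200 * m + (400 * k + 500) * size l2 + 100 /\
    exists F, [/\ rg s' rF = F, F <= F0 + 2 * k.+1 * size l2,
      same_below F0 s s'
    & forall u, u \in od -> exists2 S, reps s' F k (ar s' aRoot u) 0 S & Spec u S]) s.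
Proof.
move=> hM hN mk so uo o0 mX eF0 hX hval htp htop hbk hit hb hr0 sp0 sps.
rewrite /ph_versions; do 2!step.
have F0k : 2 ^ k <= F0 by lia.
(* The number of items at the first [t] nodes; each of them has allocated [2 * k.+1] segment tree
   nodes. *)
pose cnt t := count (fun e => iu e \in take t od) l2.
pose I n s' := exists t, let F := F0 + 2 * k.+1 * cnt t in
  [/\ rg s' rT = t /\ t <= m, rg s' rF = F,
      150 * (m - t) + (400 * k + 500) * (size l2 - cnt t) + 10 <= n,
      same_below F0 s s'
    & ar s' aRoot 0 = 0 /\ forall i, i < t -> exists2 S,
        reps s' F k (ar s' aRoot (nth 0 od i)) 0 S & Spec (nth 0 od i) S].
have cnt_le t : cnt t <= size l2 by apply: count_size.
have cntS t : t < m ->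
    cnt t.+1 = cnt t + size [seq e <- l2 | iu e == nth 0 od t].
  move=> lt; rewrite size_filter /cnt.
  have := count_predUI (fun e => iu e \in take t od) (fun e => iu e == nth 0 od t) l2.
  rewrite [X in _ + X = _](_ : _ = 0) ?addn0 => [<-|].
    apply: eq_count => e /=.
    by rewrite (take_nth 0) ?so // mem_rcons inE orbC.
  apply/eqP; rewrite -leqn0 leqNgt -has_count; apply/hasPn => e _ /=.
  apply/negP => /andP[+ /eqP e1]; rewrite e1.
  have : uniq (take t od ++ nth 0 od t :: drop t.+1 od).
    by rewrite -drop_nth ?so // cat_take_drop.
  rewrite cat_uniq => /and3P[_ /hasPn /(_ (nth 0 od t))]; rewrite mem_head => /(_ isT).
  by move/negP.
apply: (@wp_while _ _ I (150 * m + (400 * k + 500) * size l2 + 10)).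
- exists 0; have -> : cnt 0 = 0 by rewrite /cnt take0; elim: (l2).
  rewrite muln0 addn0 /=; split=> //.
  + by rewrite hN.
  + by rewrite !subn0.
- move=> n s' [kr ka _] [t [[eT tm] hF hn sb [r0 hrt]]] /=.
  have eM : rg s' rM = m by rewrite kr.
  have eN : rg s' rN = 2 ^ k by rewrite kr.
  rewrite eT eM eqb0 negbK => lt.
  have aV' : ar s' aV = ar s aV by apply: ka.
  have aTp' : ar s' aTp = ar s aTp by apply: ka.
  have aHd2' : ar s' aHd2 = ar s aHd2 by apply: ka.
  have aN2 : ar s' aNx2 = ar s aNx2 by apply: ka.
  set F := F0 + 2 * k.+1 * cnt t in hF hrt.
  set u := nth 0 od t; set bl := [seq e <- l2 | iu e == u].
  have uod : u \in od by rewrite mem_nth ?so.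
  have F0F : F0 <= F by rewrite /F; lia.
  have cS : cnt t.+1 = cnt t + size bl by apply: cntS.
  have FX : F + 2 * k.+1 * size bl + 1 < X.
    by have := cnt_le t.+1; rewrite cS /F; move: hX; nia.
  have val_t : ar s' aVal (2 ^ k + t) = u.
    by have [|_ _ ->] := sb (2 ^ k + t); [lia | exact: hval].
  have tp_u : ar s' aTp u = tp u by rewrite aTp' htp.
  have [S rS sS] : exists2 S, reps s' F k (ar s' aRoot (tp u)) 0 S & Spec (tp u) S.
    case: (htop t lt) => [->|[i it ->]]; last exact: hrt.
    by exists xpred0 => //; rewrite r0; apply: reps_agree F0F sb (hb false).
  do 3!step; rewrite eN eT val_t tp_u aHd2'.
  apply: wp_seq; apply: wp_conseq.
    apply: (@wp_paint _ F S bl) => //=.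
    + by rewrite aN2; apply: hbk.
    + by move=> b; apply: reps_agree F0F sb (hb b).
    + move=> e; rewrite mem_filter => /andP[_ /hit].
      by rewrite /item_data /= !ka.
  move=> t1 s1 [kr1 ka1 _] [ht1 hF1 hR1 sb1].
  have eT1 : rg s1 rT = t by rewrite kr1.
  have eU1 : rg s1 rU = u by rewrite kr1.
  have aR1 : ar s1 aRoot = ar s' aRoot by apply: ka1.
  have eF1 : F + 2 * k.+1 * size bl = F0 + 2 * k.+1 * cnt t.+1.
    by rewrite /F cS; nia.
  have sb1' : same_below F s' s1 by apply: sb1.
  have le1 := cnt_le t.+1.
  do 2!step; rewrite eT1 eU1 addn1.
  exists (150 * (m - t.+1) + (400 * k + 500) * (size l2 - cnt t.+1) + 10).
    by move: hn ht1 le1; rewrite cS; nia.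
  exists t.+1; rewrite -eF1; split=> //=; first by rewrite addn1.
  + exact: (same_below_trans F0F sb sb1').
  + rewrite aR1; have -> : (0 == u) = false by apply: contraNF o0 => /eqP->.
    split=> // i it; rewrite nth_uniq ?so //; last by lia.
    case: eqP => [->|ne]; first by exists (foldl paint S bl) => //; apply: sps.
    have [|S' rS' sS'] := hrt i; first by lia.
    by exists S' => //; apply: reps_agree sb1' rS'; lia.
- move=> n s' [kr ka _] [t [[eT tm] hF hn sb [r0 hrt]]] /=.
  rewrite (kr rM) //= hM eT => /eqP; rewrite eqb0 -leqNgt => lt.
  have et : t = m by lia.
  have h10 : 10 <= n by apply: leq_trans hn; apply: leq_addl.
  split; first exact: leq_trans h10.
  move=> t' ht'; split; first by clear hn; nia.
  eexists; split; [exact: hF | have := cnt_le t; nia | exact: sb |].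
  move=> u hu; have := hrt (index u od); rewrite et -so index_mem nth_index //.
  by apply.
Qed.
End Paint.
End Versions.

(** * Breadth-first search *)

Section Bfs.
Variables (od : seq nat) (hd : nat -> nat) (adj : nat -> nat -> Prop) (v : nat).

(* The queue [qs], where [js] lists the positions in [qs] of the parents; the
   vertices at the positions below [h'] are completely expanded. *)
Definition bfs_facts h h' (qs js : seq nat) (par : nat -> nat) : Prop :=
  [/\ [/\ uniq qs, nth 0 qs 0 = v, 0 < size qs & size js = size qs],
      forall y, y \in qs -> y \in od /\ hd y = 0,
      nth 0 js 0 = 0 /\ forall i, 0 < i < size qs ->
        [/\ nth 0 js i < i, nth 0 js i < h,
            par (nth 0 qs i) = nth 0 qs (nth 0 js i)
          & adj (nth 0 qs (nth 0 js i)) (nth 0 qs i)],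
      (forall i i', i <= i' < size qs -> nth 0 js i <= nth 0 js i') /\
      (forall y, (y \notin qs) || (y == v) -> par y = 0)
    & forall i y, i < h' -> y \in od -> hd y = 0 -> adj (nth 0 qs i) y ->
        y \in qs /\ nth 0 js (index y qs) <= i].

(** The parent is the vertex under expansion, at position [h.-1]. All earlier entries have their
    parents at positions below [h], so the list of parent positions remains monotone. *)
Lemma bfs_rcons h h' qs js par y : bfs_facts h h' qs js par ->
  0 < h <= size qs -> h' <= h -> y \in od -> hd y = 0 -> y \notin qs ->
  adj (nth 0 qs h.-1) y ->
  bfs_facts h h' (rcons qs y) (rcons js h.-1) (upd par y (nth 0 qs h.-1)).
Proof.
case=> -[uq q0 sq sj] hq [j0 hj] [hm hp] hc hh hh' yo hy yq axy.
have js_lt i : i < size qs -> nth 0 js i < h.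
  by case: i => [|i] hi; [rewrite j0; lia | have [] := hj i.+1 hi].
have nq i : i < size qs -> nth 0 (rcons qs y) i = nth 0 qs i.
  by move=> hi; rewrite nth_rcons hi.
have nj i : i < size qs -> nth 0 (rcons js h.-1) i = nth 0 js i.
  by move=> hi; rewrite nth_rcons sj hi.
have lq : nth 0 (rcons qs y) (size qs) = y by rewrite nth_rcons ltnn eqxx.
have lj : nth 0 (rcons js h.-1) (size qs) = h.-1 by rewrite nth_rcons sj ltnn eqxx.
have vq : v \in qs by rewrite -q0 mem_nth.
split.
- by rewrite rcons_uniq yq uq nq // !size_rcons sj.
- by move=> z; rewrite mem_rcons inE => /orP[/eqP->|/hq].
- split; first by rewrite nj.
  move=> i; rewrite size_rcons => hi.
  have [lt|ge] := ltnP i (size qs).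
    have [|h1 h2 h3 h4] := hj i; first by lia.
    rewrite nj // !nq //=; last by lia.
    by rewrite ifF //; apply: contraNF yq => /eqP<-; rewrite mem_nth.
  have -> : i = size qs by lia.
  by rewrite lj lq nq /= ?eqxx; [split=> //; lia | lia].
- split.
    move=> i i'; rewrite size_rcons => hi.
    have [lt|ge] := ltnP i' (size qs).
      by rewrite !nj //; [apply: hm; lia | lia].
    have -> : i' = size qs by lia.
    have [lt|ge'] := ltnP i (size qs).
      by rewrite nj // lj; have := js_lt _ lt; lia.
    by have -> : i = size qs by lia.
  move=> z; rewrite mem_rcons inE negb_or => hz /=.
  rewrite ifF; last first.
    by apply/negP => /eqP e; move: hz; rewrite e eqxx /=; apply/negP;
      apply: contraNneq yq => ->.
  by apply: hp; case/orP: hz => [/andP[_ ->]|->] //; rewrite orbT.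
- move=> i z hi zo hz; rewrite nq; last by lia.
  move=> a; have [zq le] := hc i z hi zo hz a.
  have -> : index z (rcons qs y) = index z qs by rewrite -cats1 index_cat zq.
  by rewrite mem_rcons inE zq orbT nj // index_mem.
Qed.

(** * The search through the shared segment trees *)

Section Program.
Variables X B k F m : nat.
Local Notation wp := (wp X B).
Hypothesis so : size od = m.
Hypothesis uo : uniq od.
Hypothesis o0 : 0 \notin od.
Hypothesis hd0 : hd 0 != 0.

(** [vs] collects the nodes pushed since the start of the whole search, each only once. All are
    below [F], so [F - size vs] can serve as a potential. *)
Definition stack_inv s (vs st : seq nat) : Prop :=
  [/\ uniq vs, forall z, z \in vs -> 0 < z < F,
      forall z, (ar s aVis z == 0) = ~~ ((z == 0) || (z \in vs)),
      chain (ar s aStk) (rg s rE) st & uniq st /\ {subset st <= vs}].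

Lemma stack_inv_size s vs st : stack_inv s vs st -> size vs <= F.
Proof.
case=> uv vF _ _ _; rewrite -(size_iota 0 F); apply: uniq_leq_size => // z /vF.
by rewrite mem_iota; lia.
Qed.

Lemma wp_push s vs st : let z := rg s rA in stack_inv s vs st -> z < F ->
  wp push (fun t s' => t <= 60 /\ stack_inv s'
    (if (z == 0) || (z \in vs) then vs else z :: vs)
    (if (z == 0) || (z \in vs) then st else z :: st)) s.
Proof.
move=> z si zF; case: (si) => uv vF hvis hc [us sub].
rewrite /push; step.
  move=> nz; step; split=> //.
  by have := hvis (rg s 6); rewrite (negbTE nz) => /esym/negbFE ->.
move=> /eqP; rewrite hvis -/z => nz; rewrite (negbTE nz).
move: nz; rewrite negb_or => /andP[z0 zv].
do 3!step; split=> //; split=> /=.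
- by rewrite zv.
- by move=> y; rewrite inE => /orP[/eqP->|/vF //]; rewrite lt0n z0.
- move=> y; rewrite -/z inE; case: (eqVneq y z) => [->|ne] /=; first by rewrite orbT.
  exact: hvis.
- rewrite -/z eqxx; split=> //.
  by apply: chain_upd => //; apply: contra zv => /sub.
- rewrite us andbT; split; first by apply: contra zv => /sub.
  by move=> y; rewrite !inE => /orP[->|/sub ->] //; rewrite orbT.
Qed.

Definition queue_inv s (qs : seq nat) : Prop :=
  [/\ forall i, i < size qs -> ar s aQ i = nth 0 qs i, rg s rQ = size qs
    & forall y, (ar s aDisc y == 0) = (y \notin qs)].

Hypothesis mX : m < X.

Lemma bfs_size h h' qs js par : bfs_facts h h' qs js par -> size qs <= m.
Proof.
by case=> -[uq _ _ _] hq _ _ _; rewrite -so; apply: uniq_leq_size => // y /hq[].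
Qed.

Lemma wp_discover s qs js h h' :
  let y := rg s rB in
  ar s aHd = hd -> (hd y = 0 -> y \in od /\ adj (nth 0 qs h.-1) y) ->
  bfs_facts h h' qs js (ar s aPar) -> 0 < h <= size qs -> h' <= h ->
  queue_inv s qs -> rg s rX = nth 0 qs h.-1 ->
  wp discover (fun t s' => t <= 100 /\ exists qs' js',
    [/\ bfs_facts h h' qs' js' (ar s' aPar), queue_inv s' qs',
        {subset qs <= qs'} /\ size qs <= size qs', hd y = 0 -> y \in qs'
      & nth 0 qs' h.-1 = nth 0 qs h.-1]) s.
Proof.
move=> y eH hy bf hh hh' qi eX; case: (qi) => hQ sQ hD.
rewrite /discover; step; rewrite eH -/y => hc.
  step; split=> //; exists qs, js; split=> //; first by split.
  move=> y0.
  by move: hc; rewrite y0 add0n hD negbK.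
have y0 : hd y = 0 by lia.
have yq : y \notin qs by rewrite -hD; lia.
have [yo ay] := hy y0.
have bf' := bfs_rcons bf hh hh' yo y0 yq ay.
have := bfs_size bf'; rewrite size_rcons => szm.
do 4!step; rewrite sQ -/y eX; split=> //.
exists (rcons qs y), (rcons js h.-1); split=> //=.
- split=> /=.
  + move=> i; rewrite size_rcons => hi; rewrite nth_rcons.
    have [->|ne] := eqVneq i (size qs); first by rewrite ltnn.
    have lt : i < size qs by lia.
    by rewrite lt hQ.
  + by rewrite size_rcons addn1.
  + move=> z; rewrite mem_rcons inE; case: (eqVneq z y) => //= _; exact: hD.
- split; last by rewrite size_rcons.
  by move=> z zq; rewrite mem_rcons inE zq orbT.
- by rewrite mem_rcons mem_head.
- by rewrite nth_rcons; case/andP: hh => h0 hle; rewrite prednK // hle.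
Qed.

Definition seen (vs : seq nat) z := (z == 0) || (z \in vs).

(** A visited node that has left the stack is dealt with. This carries over from one expansion to
    the next and is what entitles a later search to stop at such a node. *)
Definition closed_nodes s (vs st qs : seq nat) : Prop :=
  forall z, z \in vs -> z \notin st ->
    [/\ seen vs (ar s aL z), seen vs (ar s aR z)
      & hd (ar s aVal z) = 0 -> ar s aVal z \in qs].

(** Every node on the stack represents [S] on some block, so any leaf it yields is adjacent to the
    current vertex. The time is amortised: a push moves 300 units from the unvisited nodes to the
    stack, and what the unvisited nodes retain is passed on to the next expansion, whence
    [wp_while_left]. *)
Lemma wp_expand s qs js vs st h S :
  ar s aHd = hd -> stack_inv s vs st -> queue_inv s qs ->
  bfs_facts h h.-1 qs js (ar s aPar) -> 0 < h <= size qs ->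
  rg s rX = nth 0 qs h.-1 ->
  (forall z, z \in st -> exists j q, reps od s F j z q S) ->
  closed_nodes s vs st qs ->
  (forall y, y \in od -> hd y = 0 -> S (index y od) -> adj (rg s rX) y) ->
  wp ph_expand (fun t s' => exists qs' js' vs',
    [/\ stack_inv s' vs' [::], queue_inv s' qs',
        bfs_facts h h.-1 qs' js' (ar s' aPar) /\ nth 0 qs' h.-1 = rg s rX,
        closed_nodes s vs' [::] qs' /\ {subset vs <= vs'}
      & h <= size qs' /\
        t + 300 * (F - size vs') <= 300 * (F - size vs) + 300 * size st + 10]) s.
Proof.
move=> eH si qi bf hh eX hgood hcl hadj; rewrite /ph_expand.
pose I n s' := exists qs' js' vs' st',
  [/\ stack_inv s' vs' st', queue_inv s' qs',
      bfs_facts h h.-1 qs' js' (ar s' aPar) /\ nth 0 qs' h.-1 = rg s rX,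
      closed_nodes s vs' st' qs' /\ {subset vs <= vs'}
    & [/\ h <= size qs', forall z, z \in st' -> exists j q, reps od s F j z q S
        & 300 * (F - size vs') + 300 * size st' + 10 <= n]].
apply: (@wp_while_left _ _ I (300 * (F - size vs) + 300 * size st + 10)).
- exists qs, js, vs, st; split=> //; first by split.
  by split=> //; case/andP: hh.
- move=> n s' [kr ka _] [q1 [j1 [v1 [s1 [si1 qi1 [bf1 nx1] [cl1 sub1] [hq1 good1 hn]]]]]] /=.
  case: (si1) => uv vF hvis hc [us sub].
  rewrite (chain_head0 hc); case: s1 {si1} hc us sub cl1 good1 hn => [//|id s1] /=.
  case=> eE id0 hc /andP[ids us] sub cl1 good1 hn _.
  have eX' : rg s' rX = rg s rX by rewrite kr.
  have aL' : ar s' aL = ar s aL by apply: ka.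
  have aR' : ar s' aR = ar s aR by apply: ka.
  have aV' : ar s' aVal = ar s aVal by apply: ka.
  have aH' : ar s' aHd = hd by rewrite -eH; apply: ka.
  have [jj [qq gid]] := good1 id (mem_head _ _).
  have hval : hd (ar s aVal id) = 0 ->
      ar s aVal id \in od /\ adj (rg s rX) (ar s aVal id).
    (* A value that counts as a leaf is not 0, so the node is a segment tree leaf at a painted
       position. *)
    move=> h0; have nz : ar s aVal id != 0 by apply: contraNneq hd0 => e; rewrite -[X in hd X]e h0.
    case: jj gid => [|jj] /= [_ []]; last by move=> e0; rewrite e0 in nz.
    move=> _ _; case Sq: (S qq) => e; last by rewrite e in nz.
    have qm : qq < size od.
      by rewrite ltnNge; apply: contra nz => ge; rewrite e nth_default.
    have yo : nth 0 od qq \in od by rewrite mem_nth.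
    by rewrite e in h0 *; split=> //; apply: hadj; rewrite ?index_uniq.
  have hchild z : z = ar s aL id \/ z = ar s aR id ->
      z < F /\ (z != 0 -> exists j q, reps od s F j z q S).
    move=> hz; have F0 := rep_lt gid.
    case: jj gid => [|jj] /= [_ []].
      move=> l0 r0 _; have -> : z = 0 by case: hz => ->.
      by split; [lia | rewrite eqxx].
    move=> _ rl rr; case: hz => ->; split; rewrite ?(rep_lt rl) ?(rep_lt rr) //.
      by move=> _; exists jj, (2 * qq).
    by move=> _; exists jj, (2 * qq).+1.
  do 3!step; rewrite eE aV'; apply: wp_seq; apply: wp_conseq.
    apply: (@wp_discover _ q1 j1 h h.-1) => //=.
    + by rewrite nx1.
    + by case/andP: hh => ->.
    + exact: leq_pred.
    + by rewrite nx1.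
  move=> t2 s2 [kr2 ka2 _] [ht2 [q2 [j2 [bf2 qi2 [subq szq] hin nx2]]]].
  have eU2 : rg s2 rU = id by rewrite kr2.
  have eE2 : rg s2 rE = ar s' aStk id by rewrite kr2.
  have aL2 : ar s2 aL = ar s aL by rewrite -aL'; apply: ka2.
  have aR2 : ar s2 aR = ar s aR by rewrite -aR'; apply: ka2.
  have aVis2 : ar s2 aVis = ar s' aVis by apply: ka2.
  have aStk2 : ar s2 aStk = ar s' aStk by apply: ka2.
  have si2 : stack_inv s2 v1 s1.
    split=> //; rewrite ?aVis2 ?aStk2 ?eE2 //; split=> //.
    by move=> z zs; apply: sub; rewrite inE zs orbT.
  step; rewrite eU2 aL2; apply: wp_seq; apply: wp_conseq.
    apply: (@wp_push _ v1 s1) => //=.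
    by have [] := hchild (ar s aL id) (or_introl erefl).
  move=> t3 s3 [kr3 ka3 _] [ht3 /=].
  rewrite -/(seen v1 (ar s aL id)).
  set v3 := (if _ then v1 else _); set s3' := (if _ then s1 else _) => si3.
  have eU3 : rg s3 rU = id by rewrite kr3.
  have aR3 : ar s3 aR = ar s aR by rewrite -aR2; apply: ka3.
  step; rewrite eU3 aR3; apply: wp_conseq.
    apply: (@wp_push _ v3 s3') => //=.
    by have [] := hchild (ar s aR id) (or_intror erefl).
  move=> t4 s4 [kr4 ka4 _] [ht4 /=].
  rewrite -/(seen v3 (ar s aR id)).
  set v4 := (if _ then v3 else _); set s4' := (if _ then s3' else _) => si4.
  have sz3 : 300 * (F - size v3) + 300 * size s3' <= 300 * (F - size v1) + 300 * size s1.
    have := stack_inv_size si3; rewrite /v3 /s3'; case: ifP => //= _; lia.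
  have sz4 : 300 * (F - size v4) + 300 * size s4' <= 300 * (F - size v3) + 300 * size s3'.
    have := stack_inv_size si4; rewrite /v4 /s4'; case: ifP => //= _; lia.
  have mono13 z : z \in v1 -> z \in v3.
    by rewrite /v3; case: ifP => // _; rewrite inE => ->; rewrite orbT.
  have mono34 z : z \in v3 -> z \in v4.
    by rewrite /v4; case: ifP => // _; rewrite inE => ->; rewrite orbT.
  have seen3 : seen v3 (ar s aL id).
    by rewrite /v3; case: ifP => // _; rewrite /seen mem_head orbT.
  have seen4 : seen v4 (ar s aR id).
    by rewrite /v4; case: ifP => // _; rewrite /seen mem_head orbT.
  have seen13 z : seen v1 z -> seen v4 z.
    by rewrite /seen => /orP[->//|/mono13/mono34->]; rewrite orbT.
  have seen34 z : seen v3 z -> seen v4 z.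
    by rewrite /seen => /orP[->//|/mono34->]; rewrite orbT.
  have old3 z : z \in v3 -> z \notin s3' -> z \in v1 /\ z \notin s1.
    rewrite /v3 /s3'; case: ifP => // _; rewrite !inE negb_or.
    by move=> /orP[->//|->] /andP[].
  have old4 z : z \in v4 -> z \notin s4' -> z \in v3 /\ z \notin s3'.
    rewrite /v4 /s4'; case: ifP => // _; rewrite !inE negb_or.
    by move=> /orP[->//|->] /andP[].
  exists (300 * (F - size v4) + 300 * size s4' + 10); first by lia.
  exists q2, j2, v4, s4'; split=> //.
  + case: qi2 => hQ sQ hD; split.
    * move=> i hi; rewrite ka4 //= ka3 //=; exact: hQ.
    * by rewrite kr4 //= kr3.
    * by move=> y; rewrite ka4 //= ka3 //=; apply: hD.
  + by rewrite ka4 //= ka3 //= nx2.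
  + split; last by move=> z /sub1 /mono13 /mono34.
    move=> z zv zs; have [z3 zs3] := old4 _ zv zs; have [z1 zs1] := old3 _ z3 zs3.
    have [ez|nez] := eqVneq z id.
      by rewrite ez; split=> //; exact: seen34.
    have [|h1 h2 h3] := cl1 z z1.
      by rewrite inE negb_or nez.
    by split; [exact: seen13 | exact: seen13 | move=> /h3 /subq].
  + split=> //; first by lia.
    have g3 z : z \in s3' -> exists j q, reps od s F j z q S.
      rewrite /s3'; case: ifP => [_ zs|/negbT].
        by apply: good1; rewrite inE zs orbT.
      rewrite /seen negb_or => /andP[l0 _]; rewrite inE => /orP[/eqP->|zs].
        by have [_] := hchild (ar s aL id) (or_introl erefl); apply.
      by apply: good1; rewrite inE zs orbT.
    rewrite /s4'; case: ifP => [_ z|/negbT]; first exact: g3.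
    rewrite /seen negb_or => /andP[l0 _] z; rewrite inE => /orP[/eqP->|zs].
      by have [_] := hchild (ar s aR id) (or_intror erefl); apply.
    exact: g3.
- move=> n s' _ [q1 [j1 [v1 [s1 [si1 qi1 [bf1 nx1] [cl1 sub1] [hq1 good1 hn]]]]]] /= h0.
  have es1 : s1 = [::].
    by case: (si1) => _ _ _ hc _; have := chain_head0 hc; rewrite h0 => /esym/eqP.
  rewrite es1 /= in si1 cl1 hn; split; first by lia.
  by move=> t ht; exists q1, j1, v1; split=> //; split=> //; lia.
Qed.

(** Descend from [id] to the position [q]. Being seen passes to both children, no matter for which
    vertex the node was visited, until the leaf reached is closed and its value is in the queue. The
    descent cannot end in node 0, whose value is 0. *)
Lemma closed_complete s vs qs S j id q0 q :
  ar s aL 0 = 0 -> ar s aR 0 = 0 -> ar s aVal 0 = 0 ->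
  closed_nodes s vs [::] qs -> reps od s F j id q0 S -> seen vs id ->
  q0 * 2 ^ j <= q < q0.+1 * 2 ^ j -> S q -> nth 0 od q != 0 ->
  hd (nth 0 od q) = 0 -> nth 0 od q \in qs.
Proof.
move=> l0 r0 v0 cl + + + Sq nz hq.
have seen_lr z : seen vs z -> seen vs (ar s aL z) && seen vs (ar s aR z).
  case/orP=> [/eqP->|zv]; first by rewrite l0 r0.
  by have [-> ->] := cl z zv isT.
elim: j id q0 => [|j IH] id q0 /= [_ []].
  rewrite expn0 => _ _ + hs hlt; have -> : q0 = q by lia.
  rewrite Sq => e; case/orP: hs => [/eqP ei|iv].
    by rewrite ei v0 in e; rewrite -e eqxx in nz.
  by have [_ _] := cl id iv isT; rewrite e; apply.
move=> _ rl rr hs hlt; have /andP[sl sr] := seen_lr _ hs.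
rewrite expnS in hlt; have [lt|ge] := ltnP q ((2 * q0).+1 * 2 ^ j).
  by apply: IH rl sl _; lia.
by apply: IH rr sr _; lia.
Qed.

(** A queue position pays 600 units, and a segment tree node 300 units only once over all
    expansions, since the visited nodes are kept. *)
Lemma wp_bfs s :
  rg s rV = v -> v \in od -> hd v = 0 -> ar s aHd = hd ->
  (forall i, ar s aVis i = 0) -> (forall i, ar s aDisc i = 0) ->
  (forall i, ar s aPar i = 0) ->
  ar s aL 0 = 0 -> ar s aR 0 = 0 -> ar s aVal 0 = 0 -> m <= 2 ^ k ->
  (forall x, x \in od -> hd x = 0 ->
     exists2 S, reps od s F k (ar s aRoot x) 0 S &
       forall y, y \in od -> hd y = 0 -> (S (index y od) <-> adj x y)) ->
  wp ph_bfs (fun t s' => t <= 300 * F + 600 * m + 300 /\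
    exists qs js, bfs_facts (size qs) (size qs) qs js (ar s' aPar)) s.
Proof.
move=> eV vo hv eH vis0 disc0 par0 l0 r0 v0 mk hS.
rewrite /ph_bfs; do 6!step; rewrite eV.
pose I n s' := exists qs js vs h,
  [/\ stack_inv s' vs [::], queue_inv s' qs, bfs_facts h h qs js (ar s' aPar),
      closed_nodes s vs [::] qs
    & [/\ rg s' rH = h, h <= size qs
        & 600 * (m - h) + 300 * (F - size vs) + 10 <= n]].
apply: (@wp_while _ _ I (300 * F + 600 * m + 10)).
- exists [:: v], [:: 0], [::], 0; split=> //.
  + split=> //= z; rewrite in_nil orbF.
    by case: (z == 0); rewrite //= vis0.
  + split=> //=; first by case.
    by move=> y; rewrite inE; case: (y == v); rewrite //= disc0.
  + split=> //=.
    * by move=> y; rewrite inE => /eqP->.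
    * by split=> // i; lia.
    * by split=> // -[|[|i]].
  + by split=> //=; lia.
- move=> n s' [kr ka _] [qs [js [vs [h [si qi bf cl [eh hq hn]]]]]] /=.
  case: (qi) => hQ sQ hD; rewrite eh sQ eqb0 negbK => lt.
  have eH' : ar s' aHd = hd by rewrite -eH; apply: ka.
  have aRt : ar s' aRoot = ar s aRoot by apply: ka.
  have aL' : ar s' aL = ar s aL by apply: ka.
  have aR' : ar s' aR = ar s aR by apply: ka.
  have aV' : ar s' aVal = ar s aVal by apply: ka.
  have szm := bfs_size bf.
  set x := nth 0 qs h.
  have xq : x \in qs by rewrite mem_nth.
  have [xo hx] : x \in od /\ hd x = 0 by case: bf => _ hq' _ _ _; apply: hq'.
  have [S rS Sadj] := hS x xo hx.
  do 3!step; rewrite eh hQ // -/x aRt addn1; apply: wp_seq; apply: wp_conseq.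
    apply: (@wp_push _ vs [::]); first by case: si => *; split.
    exact: rep_lt rS.
  move=> t1 s1 [kr1 ka1 _] [ht1 /=].
  rewrite -/(seen vs (ar s aRoot x)).
  set v1 := (if _ then vs else _); set st1 := (if _ then [::] else _) => si1.
  have eX1 : rg s1 rX = x by rewrite kr1.
  have eh1 : rg s1 rH = h.+1 by rewrite kr1 //= addn1.
  have aL1 : ar s1 aL = ar s aL by rewrite -aL'; apply: ka1.
  have aR1 : ar s1 aR = ar s aR by rewrite -aR'; apply: ka1.
  have aV1 : ar s1 aVal = ar s aVal by rewrite -aV'; apply: ka1.
  have aP1 : ar s1 aPar = ar s' aPar by apply: ka1.
  have aQ1 : ar s1 aQ = ar s' aQ by apply: ka1.
  have aD1 : ar s1 aDisc = ar s' aDisc by apply: ka1.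
  have seen1 : seen v1 (ar s aRoot x).
    by rewrite /v1; case: ifP => // _; rewrite /seen mem_head orbT.
  have sz1 : 300 * (F - size v1) + 300 * size st1 <= 300 * (F - size vs).
    have := stack_inv_size si1; rewrite /v1 /st1; case: ifP => //= _; lia.
  apply: wp_conseq.
    apply: (@wp_expand _ qs js v1 st1 h.+1 S) => //.
    + by rewrite -eH'; apply: ka1.
    + by split; rewrite ?aQ1 ?aD1 // kr1.
    (* From here on [h] may occur as the position of a parent, although only the positions below [h]
       are completely expanded. *)
    + rewrite aP1 /=; case: bf => b1 b2 [b3 b4] b5 b6; split=> //; split=> //.
      by move=> i hi; have [? ? ? ?] := b4 i hi; split=> //; apply: leqW.
    + rewrite /st1; case: ifP => // _ z; rewrite inE => /eqP->.
      by exists k, 0; rewrite /reps aL1 aR1 aV1.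
    + move=> z; rewrite /v1 /st1 aL1 aR1 aV1; case: ifP => _.
        by move=> zv zs; apply: cl.
      rewrite !inE => /orP[->//|zv] zs; have [h1 h2 h3] := cl z zv isT.
      split=> //; move: h1 h2; rewrite /seen !inE; last first.
        by move=> _ /orP[->//|->]; rewrite !orbT.
      by move=> /orP[->//|->]; rewrite !orbT.
    + by move=> y yo hy Sy; rewrite eX1; apply/Sadj.
  move=> t2 s2 [kr2 ka2 _] [q2 [j2 [v2 [si2 qi2 [bf2 nx2] [cl2 sub2] [hq2 ht2]]]]].
  exists (600 * (m - h.+1) + 300 * (F - size v2) + 10); first by lia.
  have cl2' : closed_nodes s v2 [::] q2.
    by move=> z zv zs; have := cl2 z zv zs; rewrite aL1 aR1 aV1.
  exists q2, j2, v2, h.+1; split=> //; last by split=> //; rewrite kr2.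
  case: bf2 => [b1 b2 [b3 b4] b5 b6]; split=> // i y hi yo hy.
  have [e|ne] := eqVneq i h; last by apply: b6 => //=; lia.
  rewrite e; rewrite /= eX1 in nx2; rewrite nx2 => axy.
  have yq2 : y \in q2.
    have iy : index y od < size od by rewrite index_mem.
    have ny : nth 0 od (index y od) = y by rewrite nth_index.
    rewrite -ny; apply: (closed_complete l0 r0 v0 cl2' rS) => //; rewrite ?ny //.
    + by move: seen1; rewrite /seen => /orP[->//|/sub2->]; rewrite orbT.
    + by rewrite mul0n mul1n -so in mk *; rewrite /=; apply: leq_trans mk.
    + exact/Sadj.
    + by apply: contraNneq o0 => <-.
  (* No position beyond [h] has been expanded yet, so every parent in the queue is at a position of
     at most [h]. *)
  split=> //; case: b1 => _ _ _ _; case ei: (index y q2) => [|i']; first by rewrite b3.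
  by have [|_ ? _ _] := b4 i'.+1; [rewrite -ei index_mem yq2 ei | lia].
- move=> n s' _ [qs [js [vs [h [si qi bf cl [eh hq hn]]]]]] /=.
  case: (qi) => _ sQ _; rewrite eh sQ => /eqP; rewrite eqb0 -leqNgt => ge.
  split; first by lia.
  move=> t ht; split; first by lia.
  by exists qs, js; have -> : size qs = h by lia.
Qed.

End Program.
End Bfs.

(** * Painting computes the covering pairs *)

Lemma foldl_paint lo hi sg S l z :
  (exists l1 e l2, [/\ l = l1 ++ e :: l2, lo e <= z < hi e,
     forall e', e' \in l2 -> ~~ (lo e' <= z < hi e')
   & foldl (paint lo hi sg) S l z = sg e]) \/
  (forall e, e \in l -> ~~ (lo e <= z < hi e)) /\
  foldl (paint lo hi sg) S l z = S z.
Proof.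
elim/last_ind: l => [|l e IH]; first by right.
rewrite foldl_rcons {1 3}/paint; case he: (lo e <= z < hi e).
  by left; exists l, e, [::]; rewrite cats1.
case: IH => [[l1 [e1 [l2 [-> h1 h2 h3]]]]|[h1 h2]]; [left | right].
  exists l1, e1, (rcons l2 e); split=> //; first by rewrite rcons_cat.
  by move=> e'; rewrite mem_rcons inE => /orP[/eqP->|/h2 //]; rewrite he.
by split=> // e'; rewrite mem_rcons inE => /orP[/eqP->|/h1 //]; rewrite he.
Qed.

Section CoverSpec.
Variables (m : nat) (M : signed_tree_model 'I_m).
Local Notation par := (tree_parent M).
Local Notation anc := (ancestor (tree_parent M)).
Local Notation pairs := (stm_A M :|: stm_B M).

Variables (od l2 : seq nat) (iu iv lo hi : nat -> nat) (sg : nat -> bool).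
Hypothesis od_all : forall y : 'I_m, y.+1 \in od.
Hypothesis anc_index : forall w y : 'I_m, anc w y ->
  index w.+1 od <= index y.+1 od.
Hypothesis itemP : forall e, e \in l2 -> exists u w : 'I_m,
  [/\ iu e = u.+1, iv e = w.+1, [set u; w] \in pairs,
      sg e = ([set u; w] \in stm_B M)
    & forall y : 'I_m, (lo e <= index y.+1 od < hi e) = anc w y].
Hypothesis item_exists : forall u w : 'I_m, [set u; w] \in pairs ->
  exists2 e, e \in l2 & iu e = u.+1 /\ iv e = w.+1.
Hypothesis sorted_l2 : pairwise (by_pos od iv) l2.

(** Both [x] and [y] range over all nodes of the tree, since the sets are built from the root
    downwards. The number 0, the parent code of the root, stands for the empty set. *)
Definition cover_spec (a : nat) (S : nat -> bool) : Prop :=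
  forall y : 'I_m, S (index y.+1 od) <->
    exists x : 'I_m, a = x.+1 /\ exists2 P, P \in stm_B M & covers M P x y.

Lemma cover_spec0 : cover_spec 0 xpred0.
Proof. by move=> y; split=> // -[x []]. Qed.

Lemma index_anc (w w' : 'I_m) : anc w w' || anc w' w ->
  index w.+1 od <= index w'.+1 od -> anc w w'.
Proof.
case/orP=> // h le; have := anc_index h => le'.
have := nth_index 0 (od_all w); have -> : index w.+1 od = index w'.+1 od by lia.
by rewrite nth_index // => -[/val_inj ->]; apply: anc_refl.
Qed.

Let rooted := tree_rooted M.

(** If a pair at [x] reaches [y], the last such item has the lowest second node [w], and [{x, w}] is
    the only pair that covers [x], [y]. If none does, the pairs above [x] and [y] all sit at
    ancestors of the parent of [x], so the parent and [x] have the same covering pairs. *)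
Lemma paint_cover_spec (a : nat) S : (exists x : 'I_m, a = x.+1) ->
  cover_spec (parent_code par a) S ->
  cover_spec a (foldl (paint lo hi sg) S [seq e <- l2 | iu e == a]).
Proof.
move=> [x ->] hS y; set l := [seq e <- l2 | _]; rewrite parent_codeE in hS.
have in_l (w : 'I_m) : [set x; w] \in pairs ->
    exists2 e, e \in l & iv e = w.+1 /\ (lo e <= index y.+1 od < hi e) = anc w y.
  move=> /item_exists[e el [hu hv]]; exists e.
    by rewrite mem_filter hu eqxx.
  have [u' [w' [_ hv' _ _ hy]]] := itemP el; split=> //; rewrite hy.
  by move: hv'; rewrite hv => -[/val_inj ->].
have sl : pairwise (by_pos od iv) l by rewrite pairwise_filter.
case: (foldl_paint lo hi sg S l (index y.+1 od)) => [[l1 [e [l3 [el hm hn ->]]]]|[hn ->]].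
  have : e \in l by rewrite el mem_cat mem_head orbT.
  rewrite mem_filter => /andP[/eqP eu e2].
  have [u0 [w [hu hw Pp sgP hy]]] := itemP e2.
  have eux : u0 = x by apply: val_inj; move: hu; rewrite eu => -[].
  rewrite eux in Pp sgP; rewrite hy in hm.
  (* Items after [e] miss [y], so an item at [x] that reaches [y] does not come after [e] in
     preorder, and of two nodes above [y] the earlier one is the ancestor. *)
  have before v'' : [set x; v''] \in pairs -> anc v'' y -> anc v'' w.
    move=> /in_l[e' e'l [hv' hy']] v''y.
    have e'm : lo e' <= index y.+1 od < hi e' by rewrite hy'.
    apply: index_anc; first exact: anc_total v''y hm.
    rewrite -hv' -hw; move: e'l sl; rewrite el mem_cat inE pairwise_cat.
    case/or3P=> [e'1|/eqP->|/hn] // => [/and3P[/allrelP/(_ e' e e'1 (mem_head _ _))] //|].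
    by rewrite e'm.
  have cov : covers M [set x; w] x y.
    exists x, w; split=> //; first exact: anc_refl.
    move=> u'' v'' Pp'' xu ux wv vy; have eu'' := anc_antisym rooted ux xu.
    rewrite eu'' in Pp'' *; congr [set _; _].
    by apply: (anc_antisym rooted) => //; apply: before.
  rewrite sgP; split=> [PB|[x' [[/val_inj <-] [P PB]]]].
    by exists x; split=> //; exists [set x; w].
  case=> u' [v' [eP ux vy cP]].
  have vw : anc v' w.
    have [e1|ne] := eqVneq u' x.
      by apply: before => //; rewrite -e1 -eP inE PB orbT.
    have := anc_total vy hm; case/orP=> // wv.
    have [-> //|nwv] := eqVneq v' w; first exact: anc_refl.
    (* With [u'] strictly above [x], a node [v'] strictly below [w] would make the two pairs
       cross. *)
    have [] := @stm_noncrossing _ M P [set x; w]; rewrite ?inE ?PB ?orbT //.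
      by move: Pp; rewrite inE.
    split.
      by exists u', x; rewrite eP !inE !eqxx /strict_ancestor /= ne ux.
    exists v', w; rewrite eP !inE !eqxx !orbT /strict_ancestor /= wv andbT.
    by rewrite eq_sym nwv.
  by rewrite (cP x w) //; apply: anc_refl.
(* The remaining case, in which no item at [x] repaints the position of [y]. *)
have notx v'' : [set x; v''] \in pairs -> anc v'' y -> False.
  by move=> /in_l[e el [_ hy]] vy; have := hn e el; rewrite hy vy.
rewrite (hS y); case px: (par x) => [x'|] /=; last first.
  split=> [[? []]//|[x1 [[/val_inj <-] [P PB [u' [v' [eP ux vy cP]]]]]]].
  move: ux; rewrite anc_root // => /eqP e1; case: (notx v') => //.
  by rewrite -e1 -eP inE PB orbT.
split=> [[x1 [[/val_inj <-] [P PB [u' [v' [eP ux vy cP]]]]]]|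
         [x1 [[/val_inj <-] [P PB [u' [v' [eP ux vy cP]]]]]]].
  exists x; split=> //; exists P => //; exists u', v'; split=> //.
    exact: anc_trans ux (anc_parent px).
  move=> u'' v'' Pp h1 h2 h3 h4; apply: cP => //.
  move: h2; rewrite (anc_step _ px) => /orP[/eqP e1|//].
  by case: (notx v'') => //; rewrite -e1.
have ux' : anc u' x'.
  move: ux; rewrite (anc_step _ px) => /orP[/eqP e1|//].
  by case: (notx v') => //; rewrite -e1 -eP inE PB orbT.
exists x'; split=> //; exists P => //; exists u', v'; split=> //.
move=> u'' v'' Pp h1 h2 h3 h4; apply: cP => //.
exact: anc_trans h2 (anc_parent px).
Qed.

End CoverSpec.

(** * From the queue to a shortest-path tree *)

Section QueueTree.
Variables (U : finType) (G : rel U) (v : U) (qs : seq U) (js : nat -> nat).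
Variable f : U -> option U.
Hypothesis G_sym : symmetric G.
Hypothesis qs_uniq : uniq qs.
Hypothesis qs_gt0 : 0 < size qs.
Hypothesis qs_head : nth v qs 0 = v.
Hypothesis f_root : f v = None.
Hypothesis f_out : forall y, y \notin qs -> f y = None.
Hypothesis parentP : forall i, 0 < i < size qs ->
  [/\ js i < i, f (nth v qs i) = Some (nth v qs (js i))
    & G (nth v qs (js i)) (nth v qs i)].
Hypothesis js_mono : forall i i', i <= i' < size qs -> js i <= js i'.
Hypothesis closed_qs : forall i y, i < size qs -> G (nth v qs i) y ->
  y \in qs /\ js (index y qs) <= i.

(** The depth of the queue position [i] in the tree of parents. The first argument is fuel, and [i]
    is enough of it because [js i < i]. *)
Fixpoint depth_rec n i : nat :=
  if i is 0 then 0 else if n is n'.+1 then (depth_rec n' (js i)).+1 else 0.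

Definition depth i := depth_rec i i.
Definition dist x := depth (index x qs).

Lemma depthS i : 0 < i < size qs -> depth i = (depth (js i)).+1.
Proof.
have indep n n' j : j < size qs -> j <= n -> j <= n' -> depth_rec n j = depth_rec n' j.
  elim: n n' j => [|n IH] n' j hj hn hn'.
    have -> : j = 0 by lia.
    by case: (n').
  case: j hj hn hn' => [|j] hj hn hn'; first by case: (n').
  case: n' hn' => // n' hn' /=; have [|lt _ _] := @parentP j.+1; first by lia.
  by congr _.+1; apply: IH; lia.
case: i => // i hi; rewrite /depth /=; congr _.+1.
by have [lt _ _] := parentP hi; apply: indep; lia.
Qed.

(** Parents are ordered like their children, so the comparison moves up to the parents, which come
    earlier in the queue. *)
Lemma depth_mono i i' : i <= i' < size qs -> depth i <= depth i'.
Proof.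
elim/ltn_ind: i' i => i' IH [|i] hi; first by [].
rewrite (@depthS i') 1?(@depthS i.+1); try lia.
have [|lt _ _] := @parentP i'; first by lia.
by rewrite ltnS; apply: IH => //; rewrite js_mono //=; lia.
Qed.

Lemma v_in : v \in qs.
Proof. by rewrite -qs_head mem_nth. Qed.

Lemma dist_v : dist v = 0.
Proof. by rewrite /dist -{1}qs_head index_uniq. Qed.

Lemma index_gt0 y : y \in qs -> y != v -> 0 < index y qs < size qs.
Proof.
move=> yq ne; rewrite index_mem yq andbT lt0n; apply: contraNneq ne => e.
by rewrite -(nth_index v yq) e qs_head.
Qed.

Lemma parent_spec x y : f y = Some x -> [/\ x \in qs, y \in qs, G x y & dist y = (dist x).+1].
Proof.
move=> fy; have yq : y \in qs by apply/negPn/negP => /f_out; rewrite fy.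
have ne : y != v by apply: contra_eq_neq fy => ->; rewrite f_root.
have hi := index_gt0 yq ne; have [lt e g] := parentP hi.
rewrite nth_index // fy in e g; case: e => e; rewrite -e in g.
have lt' : js (index y qs) < size qs by lia.
split=> //; first by rewrite e mem_nth.
by rewrite /dist depthS // e index_uniq.
Qed.

Lemma has_parent y : y \in qs -> y != v -> exists x, f y = Some x.
Proof.
move=> yq ne; have [_ e _] := parentP (index_gt0 yq ne).
by rewrite nth_index // in e; eexists; apply: e.
Qed.

(** The parent of [y] does not come after [x] in the queue, so by monotonicity it is no deeper than
    [x]. *)
Lemma dist_edge x y : x \in qs -> G x y -> y \in qs /\ dist y <= (dist x).+1.
Proof.
move=> xq g; have hx : index x qs < size qs by rewrite index_mem.
have [|yq le] := @closed_qs (index x qs) y hx; first by rewrite nth_index.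
split=> //; have [->|ne] := eqVneq y v; first by rewrite dist_v.
rewrite /dist (depthS (index_gt0 yq ne)) ltnS; apply: depth_mono.
by rewrite le.
Qed.

Lemma dist_path x q : x \in qs -> path G x q ->
  last x q \in qs /\ dist (last x q) <= dist x + size q.
Proof.
elim: q x => [|y q IH] x xq /=; first by rewrite addn0.
case/andP=> /(dist_edge xq)[yq le] /(IH _ yq)[lq le']; split=> //.
by apply: leq_trans le' _; rewrite addnS -addSn leq_add2r.
Qed.

Local Notation T := (parent_edges f).

Lemma T_sym : symmetric T.
Proof. by move=> x y; rewrite /parent_edges /= orbC. Qed.

Lemma T_sub x y : T x y -> [/\ x \in qs, y \in qs & G x y].
Proof.
case/orP=> /eqP/parent_spec[h1 h2 h3 _]; split=> //.
by rewrite G_sym.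
Qed.

Lemma T_walk x : x \in qs -> walk_of_length T v x (dist x).
Proof.
move: {2}(dist x) (leqnn (dist x)) => n; elim: n x => [|n IH] x le xq.
  have [->|/(has_parent xq)[y /parent_spec[_ _ _ e]]] := eqVneq x v.
    by exists [::]; rewrite dist_v.
  by rewrite e in le.
have [->|/(has_parent xq)[y fy]] := eqVneq x v.
  by exists [::]; rewrite dist_v.
have [yq _ _ e] := parent_spec fy.
have [|q [pq lq sq]] := IH y _ yq; first by rewrite e in le.
exists (rcons q x); rewrite rcons_path pq lq last_rcons size_rcons sq e.
by split=> //=; rewrite /parent_edges /= fy eqxx orbT.
Qed.

Lemma connect_qs x : connect G v x = (x \in qs).
Proof.
apply/idP/idP => [/connectP[q pq ->]|/T_walk[q [pq <- _]]].
  by have [] := dist_path v_in pq.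
apply/connectP; exists q => //; apply: sub_path pq => y z.
by case/T_sub.
Qed.

(** The tree contains a walk of length [dist x], and in [G] no walk is shorter. Any relation in
    between has the same distances; the cases of interest are [T] and [G] themselves. *)
Lemma is_distE (H : rel U) x d : subrel T H -> subrel H G -> x \in qs ->
  is_dist H v x d <-> d = dist x.
Proof.
move=> TH HG xq; have [q [pq lq sq]] := T_walk xq.
have wH : walk_of_length H v x (dist x).
  by exists q; split=> //; apply: sub_path pq.
have lb d' : walk_of_length H v x d' -> dist x <= d'.
  case=> q' [pq' lq' sq']; have pG := sub_path HG pq'.
  by have [_] := dist_path v_in pG; rewrite lq' sq' dist_v.
split=> [[w mn]|->]; last by split.
by apply/eqP; rewrite eqn_leq lb // mn.
Qed.

(** Take a vertex of the cycle with maximal [dist]. It is not the parent of its neighbours on the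
    cycle, so each of them is its parent; but a cycle of length at least 3 provides two distinct
    ones. *)
Lemma T_acyclic : acyclic T.
Proof.
move=> c sc /andP[cc uc].
have [x0 x0c] : exists x, x \in c by case: c sc {cc uc} => // x c _; exists x; rewrite mem_head.
have [x xc xmax] := @arg_maxnP _ x0 (mem c) dist x0c.
have [i c' ec] := rot_to xc.
have : cycle T (rot i c) && uniq (rot i c) by rewrite rot_cycle rot_uniq cc uc.
have sub y : y \in c' -> y \in c by move=> h; rewrite -(mem_rot i) ec inE h orbT.
have : 2 < size (rot i c) by rewrite size_rot.
rewrite ec; case/lastP: c' ec sub => // c' z ec sub.
case: c' ec sub => // y c' ec sub _ /andP[].
rewrite [cycle _ _]/= rcons_path last_rcons => /andP[Txy /andP[_ Tzx]].
case/and3P=> _ + _; rewrite mem_rcons inE negb_or => /andP[nyz _].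
have up y' : y' \in c -> f y' == Some x = false.
  move=> yc; apply/negP => /eqP /parent_spec[_ _ _ e].
  by have := xmax y' yc; rewrite /geq /= e ltnn.
have yc : y \in c by apply: sub; rewrite inE eqxx.
have zc : z \in c by apply: sub; rewrite inE mem_rcons inE eqxx orbT.
move: Txy Tzx; rewrite /parent_edges /= !up // orbF => /eqP e1 /eqP.
by rewrite e1 => -[e2]; rewrite e2 eqxx in nyz.
Qed.

Lemma queue_shortest_path_tree : shortest_path_tree G v T.
Proof.
have sTG : subrel T G by move=> x y /T_sub[].
split; last first.
  move=> x d; rewrite connect_qs => xq.
  by split=> [/(is_distE _ _ sTG xq)|/(is_distE _ sTG _ xq)] h;
    apply/is_distE => //; apply: h.
split; [exact: T_sym | | | exact: T_acyclic].
  by move=> x y /T_sub[]; rewrite !connect_qs.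
move=> x y; rewrite !connect_qs => /T_walk[q [pq lq _]] /T_walk[q' [pq' lq' _]].
have cs : connect_sym T by apply: sym_connect_sym; apply: T_sym.
apply: (@connect_trans _ _ v).
  by rewrite cs; apply/connectP; exists q.
by apply/connectP; exists q'.
Qed.

End QueueTree.

(** * The layout of the input *)

Lemma nth_flatten3 (T : Type) (x0 : T) (f g h : T -> nat) (s : seq T) i :
  i < size s ->
  let l := flatten [seq [:: f q; g q; h q] | q <- s] in
  [/\ nth 0 l (3 * i) = f (nth x0 s i), nth 0 l (3 * i + 1) = g (nth x0 s i)
    & nth 0 l (3 * i + 2) = h (nth x0 s i)].
Proof.
elim: s i => [//|x s IH] [|i] hi l //; have [h1 h2 h3] := IH i hi.
by have -> : 3 * i.+1 = (3 * i).+3 by lia.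
Qed.

Section Input.
Variables (m : nat) (M : signed_tree_model 'I_m).
Variables (ps : seq ('I_m * 'I_m * bool)) (r : 'I_m).
Local Notation par := (tree_parent M).
Local Notation pairs := (stm_A M :|: stm_B M).
Local Notation input := (encode_input M ps r).
Local Notation p := (size ps).
Hypothesis ps_pairs : lists_pairs M ps.

Lemma size_input : size input = m + 3 * p + 3.
Proof.
rewrite /encode_input !size_cat size_map size_enum_ord /=.
have -> : size (flatten [seq [:: nat_of_ord q.1.1; nat_of_ord q.1.2; nat_of_bool q.2]
    | q <- ps]) = 3 * p by elim: (ps) => //= q s ->; lia.
lia.
Qed.

Lemma input_head : [/\ nth 0 input 0 = m, nth 0 input 1 = p & nth 0 input 2 = r].
Proof. by []. Qed.

Lemma input_parent t : t < m -> nth 0 input (t + 3) = parent_code par t.+1.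
Proof.
move=> ht; rewrite /encode_input nth_cat /= addnC ltnNge leq_addr /= addKn.
by rewrite nth_cat size_map size_enum_ord ht.
Qed.

Let q0 := (r, r, false).

Lemma input_pair i : i < p ->
  [/\ nth 0 input (m + 3 * i + 3) = (nth q0 ps i).1.1,
      nth 0 input (m + 3 * i + 4) = (nth q0 ps i).1.2
    & nth 0 input (m + 3 * i + 5) = (nth q0 ps i).2].
Proof.
move=> hi.
have shift d : nth 0 input (m + 3 * i + 3 + d) = nth 0 (flatten
    [seq [:: nat_of_ord q.1.1; nat_of_ord q.1.2; nat_of_bool q.2] | q <- ps]) (3 * i + d).
  rewrite /encode_input nth_cat ifF /=; last by lia.
  rewrite nth_cat size_map size_enum_ord ifF; last by lia.
  by congr nth; lia.
have [h1 h2 h3] := nth_flatten3 q0 (fun q => nat_of_ord q.1.1)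
  (fun q => nat_of_ord q.1.2) (fun q => nat_of_bool q.2) hi.
by split; [rewrite -[RHS]h1 -[m + _ + _]addn0 shift addn0
  |rewrite -[RHS]h2 -shift; congr nth; lia|rewrite -[RHS]h3 -shift; congr nth; lia].
Qed.

Lemma input_bound a : nth 0 input a < m + 3 * p + 3.
Proof.
have [lt|ge] := ltnP a (size input); last by rewrite nth_default //; lia.
have : all (fun x => x < m + 3 * p + 3) input; last first.
  by move/allP; apply; apply: mem_nth.
have hr := ltn_ord r.
rewrite /encode_input /= all_cat; apply/and4P; split; try lia.
apply/andP; split.
  apply/allP => x /mapP[i _ ->]; case: (par i) => [j|] /=; last by lia.
  by have := ltn_ord j; lia.
apply/allP => x /flattenP[l /mapP[q _ ->]]; rewrite !inE.
have mp : m <= m + 3 * p + 3 by lia.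
case/or3P=> /eqP->; [exact: leq_trans (ltn_ord _) mp.. |].
by apply: leq_ltn_trans (leq_b1 _) _; lia.
Qed.

Lemma num_pairsE : num_pairs M = p.
Proof.
have := perm_size ps_pairs; rewrite size_cat !size_map => ->.
by rewrite /num_pairs !cardE.
Qed.

Lemma mem_ps (q : 'I_m * 'I_m * bool) : q \in ps ->
  [set q.1.1; q.1.2] \in pairs /\ q.2 = ([set q.1.1; q.1.2] \in stm_B M).
Proof.
move=> qs; have : ([set q.1.1; q.1.2], q.2) \in
    [seq ([set q.1.1; q.1.2], q.2) | q <- ps] by apply/mapP; exists q.
rewrite (perm_mem ps_pairs) mem_cat => /orP[|] /mapP[P]; rewrite mem_enum => hP [-> ->].
  split; first by rewrite inE hP.
  by have /pred0P/(_ P)/= := stm_disjoint M; rewrite hP.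
by rewrite inE hP orbT.
Qed.

Lemma ps_complete (u w : 'I_m) : [set u; w] \in pairs ->
  exists2 q, q \in ps & (q.1.1 = u /\ q.1.2 = w) \/ (q.1.1 = w /\ q.1.2 = u).
Proof.
move=> hP; have [a [b [eP nab _ _]]] := stm_transversal hP.
have nuw : u != w.
  apply: contraNneq nab => e; have := set21 a b; have := set22 a b.
  by rewrite -eP e !inE !orbb => /eqP-> /eqP->.
have [s] : exists s, ([set u; w], s) \in [seq ([set q.1.1; q.1.2], q.2) | q <- ps].
  move: hP; rewrite inE => /orP[h|h]; [exists false | exists true];
    rewrite (perm_mem ps_pairs) mem_cat; apply/orP; [left | right];
    by apply/mapP; exists [set u; w]; rewrite ?mem_enum.
case/mapP=> q qs [e _]; exists q => //.
have := set21 u w; have := set22 u w; rewrite e !inE.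
move=> /orP[] /eqP hw /orP[] /eqP hu; [|right|left|] => //;
  by move: nuw; rewrite hu hw eqxx.
Qed.

(** This and the next two definitions repeat the arithmetic of [ph_items] at [t = e.-1], so that the
    values read by the program agree with them by conversion. *)
Definition item_u e : nat :=
  (nth 0 input (m + 3 * (e.-1 %/ 2) + 3 + (e.-1 - 2 * (e.-1 %/ 2)))).+1.
Definition item_v e : nat :=
  (nth 0 input (m + 3 * (e.-1 %/ 2) + 3 + 1 - (e.-1 - 2 * (e.-1 %/ 2)))).+1.
Definition item_s e : nat := nth 0 input (m + 3 * (e.-1 %/ 2) + 3 + 2).

Lemma item_cases e : 0 < e <= 2 * p -> exists2 q, q \in ps &
  item_s e = q.2 /\
  ((item_u e = q.1.1.+1 /\ item_v e = q.1.2.+1) \/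
   (item_u e = q.1.2.+1 /\ item_v e = q.1.1.+1)).
Proof.
move=> he; set i := e.-1 %/ 2; have hi : i < p by rewrite /i; lia.
have [h1 h2 h3] := input_pair hi.
exists (nth q0 ps i); first exact: mem_nth.
split; first by rewrite -h3 /item_s -/i; congr nth; lia.
have : e.-1 - 2 * i = 0 \/ e.-1 - 2 * i = 1 by rewrite /i; lia.
rewrite /item_u /item_v -/i => -[] ->; [left | right].
  by rewrite addn0 h1 subn0 -h2; split=> //; congr (nth _ _ _).+1; lia.
by rewrite addnK h1 -h2; split=> //; congr (nth _ _ _).+1; lia.
Qed.

Lemma item_onto q : q \in ps ->
  (exists2 e, 0 < e <= 2 * p & item_u e = q.1.1.+1 /\ item_v e = q.1.2.+1) /\
  (exists2 e, 0 < e <= 2 * p & item_u e = q.1.2.+1 /\ item_v e = q.1.1.+1).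
Proof.
move=> /(nthP q0)[i hi' <-]; have hi : i < p := hi'.
have [h1 h2 _] := input_pair hi; clear hi'.
split; [exists (2 * i).+1 | exists (2 * i).+2]; try lia; rewrite /item_u /item_v.
  have -> : (2 * i).+1.-1 %/ 2 = i by lia.
  rewrite [(2 * i).+1.-1]/= subnn addn0 subn0 h1 -h2; split=> //; congr (nth _ _ _).+1; lia.
have -> : (2 * i).+2.-1 %/ 2 = i by lia.
have -> : (2 * i).+2.-1 - 2 * i = 1 by lia.
rewrite addnK h1 -h2; split=> //; congr (nth _ _ _).+1; lia.
Qed.

End Input.

(** * The phases put together *)

Section Run.
Variables (m : nat) (M : signed_tree_model 'I_m).
Variables (ps : seq ('I_m * 'I_m * bool)) (r : 'I_m) (X : nat).
Local Notation par := (tree_parent M).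
Local Notation anc := (ancestor (tree_parent M)).
Local Notation input := (encode_input M ps r).
Local Notation p := (size ps).
Local Notation B := (m + 3 * p + 3).
Hypothesis ps_pairs : lists_pairs M ps.
Hypothesis r_leaf : leaf par r.
Hypothesis X_big : 8 * (B * B) < X.

Definition start := Ast (fun=> 0) (fun _ _ => 0) (nth 0 input).

Definition covered (a b : nat) : Prop := exists x y : 'I_m,
  [/\ a = x.+1, b = y.+1 & exists2 P, P \in stm_B M & covers M P x y].

(** The time is still in terms of the tree size [m] and the segment tree height [k]; the last clause
    relates [m] to the number of leaves. *)
Definition run_result t (out : nat -> nat) : Prop :=
  exists k od hd qs js par',
  [/\ t <= 5000 * (m + 1 + p * k.+1), 2 ^ k <= 2 * m,
      forall i, i < m -> out i = par' i.+1,
      bfs_facts od hd covered r.+1 (size qs) (size qs) qs js par'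
    & [/\ perm_eq od (iota 1 m), forall x : 'I_m, (hd x.+1 == 0) = leaf par x
        & m.+1 = 2 * count (fun a => hd a == 0) od]].

Lemma wp_program : wp X B program (fun t s => run_result t (io s)) start.
Proof.
have m0 : 0 < m by apply: leq_ltn_trans (ltn_ord r).
have BX : 8 * B < X.
  by apply: leq_ltn_trans X_big; rewrite leq_mul2l leq_pmulr //; lia.
(* The segment tree nodes must have numbers below [X]. With the crude estimate [k.+1 <= 2 * m] there
   are at most [4 * m + 8 * (m * p)] of them, which is why [X_big] asks for the square of the input
   length. *)
have FX k : k < 2 * m -> 2 ^ k <= 2 * m -> 2 * 2 ^ k + 2 * k.+1 * (2 * p) + 1 < X.
  move=> k1 k2; apply: leq_ltn_trans X_big; move: (2 ^ k) k2 => N k2.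
  have h1 : k.+1 * p <= 2 * m * p by rewrite leq_mul2r k1 orbT.
  have -> : 2 * k.+1 * (2 * p) = 4 * (k.+1 * p) by rewrite mulnACA.
  apply: (@leq_trans (4 * m + 8 * (m * p) + 1)); first by lia.
  by rewrite !(mulnDl, mulnDr); lia.
clear X_big.
have rooted := tree_rooted M; have full := tree_full_binary M.
rewrite /program; apply: wp_seq; apply: (@wp_conseq _ _ _ (fun t s =>
  [/\ t <= 100, rg s rM = m, rg s rP = 2 * p & rg s rV = r.+1])).
  rewrite /ph_read; have := ltn_ord r => hr.
  by do 5!step; split=> //=; clear; lia.
move=> t1 s1 [kr1 ka1 kio1] [ht1 eM1 eP1 eV1]; rewrite /= in ka1.
apply: wp_seq; apply: wp_conseq; first by apply: (@wp_size _ _ _ m) => //; clear -BX m0; lia.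
move=> t2 s2 [kr2 ka2 kio2] [k [ht2 eN2 mk km]].
have k2m : k < 2 * m by apply: leq_trans km; apply: ltn_expl.
have eM2 : rg s2 rM = m by rewrite kr2.
apply: wp_seq; apply: wp_conseq.
  apply: (@wp_children _ _ _ m (parent_code par)) => //; try by clear -BX m0; lia.
  - by move=> t ht; rewrite kio2 // kio1 //; apply: input_parent.
  - by move=> i; rewrite ka2 // ka1.
move=> t3 s3 [kr3 ka3 kio3] [ht3 bk3 htp3].
have [T [lk hd0 nx0 uT [pT aT]]] := bintree_exists rooted full bk3.
set od := labels T in uT pT.
have so : size od = m by rewrite (perm_size pT) size_iota.
have od_mem a : (a \in od) = (0 < a <= m) by rewrite (perm_mem pT) mem_iota; clear; lia.
have o0 : 0 \notin od by rewrite od_mem.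
have od_all (y : 'I_m) : y.+1 \in od by rewrite od_mem ltn_ord.
have eN3 : rg s3 rN = 2 ^ k by rewrite kr3.
apply: wp_seq; apply: wp_conseq.
  by apply: (@wp_traverse _ _ _ (2 ^ k) m T) => //; clear -BX km; lia.
move=> t4 s4 [kr4 ka4 kio4] [ht4 val4 val4' pos4 esc4]; rewrite -/od in val4 pos4 esc4.
have eN4 : rg s4 rN = 2 ^ k by rewrite kr4.
apply: wp_seq; apply: wp_conseq.
  by apply: (@wp_full _ _ _ (2 ^ k)) => //; clear -BX km mk; lia.
move=> t5 s5 [kr5 ka5 kio5] [ht5 L5 R5].
have eM5 : rg s5 rM = m by rewrite kr5 // kr4 // kr3.
have eP5 : rg s5 rP = 2 * p by rewrite kr5 // kr4 // kr3 // kr2.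
have io5 : io s5 = nth 0 input by rewrite kio5 // kio4 // kio3 // kio2 // kio1.
pose iu := item_u M ps r; pose iv := item_v M ps r; pose si := item_s M ps r.
have iuv e : 0 < e <= 2 * p -> iu e <= m /\ iv e <= m.
  rewrite /iu /iv => /(item_cases M r)[q _ [_ []]] [-> ->]; split; exact: ltn_ord.
apply: wp_seq; apply: wp_conseq.
  apply: (@wp_items _ _ _ m p iu iv si) => //; try by clear -BX; lia.
  - by move=> t ht; rewrite io5.
  - by move=> i; rewrite ka5 // ka4 // ka3 // ka2 // ka1.
move=> t6 s6 [kr6 ka6 kio6] [ht6 bk6 it6].
have eM6 : rg s6 rM = m by rewrite kr6.
have eN6 : rg s6 rN = 2 ^ k by rewrite kr6 // kr5.
have val6 t : t < m -> ar s6 aVal (2 ^ k + t) = nth 0 od t.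
  by move=> ht; rewrite ka6 // ka5 // val4.
have ilist e : (e \in rev (iota 1 (2 * p))) = (0 < e <= 2 * p).
  by rewrite mem_rev mem_iota; clear; lia.
apply: wp_seq; apply: wp_conseq.
  apply: (@wp_sort _ _ _ (2 ^ k) m od (rev (iota 1 (2 * p))) iu iv) => //.
  - by rewrite rev_uniq iota_uniq.
  - move=> e; rewrite ilist => he; have [-> _ _] := it6 e he.
    by split=> //; rewrite od_mem; have [_ ->] := iuv e he.
  - by move=> i; rewrite ka6 // ka5 // ka4 // ka3 // ka2 // ka1.
move=> t7 s7 [kr7 ka7 kio7] [ht7 [l2 [bk7 pl2 sl2]]].
rewrite size_rev size_iota in ht7.
have sz2 : size l2 = 2 * p by rewrite (perm_size pl2) size_rev size_iota.
have mem2 e : (e \in l2) = (0 < e <= 2 * p) by rewrite (perm_mem pl2) ilist.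
have eM7 : rg s7 rM = m by rewrite kr7.
have eN7 : rg s7 rN = 2 ^ k by rewrite kr7.
have L7 i : ar s7 aL i = if 0 < i < 2 ^ k then 2 * i else 0.
  by rewrite ka7 // ka6 // L5 ka4 // ka3 // ka2 // ka1.
have R7 i : ar s7 aR i = if 0 < i < 2 ^ k then (2 * i).+1 else 0.
  by rewrite ka7 // ka6 // R5 ka4 // ka3 // ka2 // ka1.
have V7 t : ar s7 aVal (2 ^ k + t) = nth 0 od t.
  rewrite ka7 // ka6 // ka5 //; have [lt|ge] := ltnP t m; first exact: val4.
  rewrite val4'; last by clear -ge; lia.
  by rewrite ka3 // ka2 // ka1 // nth_default // so.
have V7' i : i < 2 ^ k -> ar s7 aVal i = 0.
  by move=> hi; rewrite ka7 // ka6 // ka5 // val4' ?ka3 ?ka2 ?ka1 //; clear -hi; lia.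
pose F0 := 2 * 2 ^ k.
have cst7 (b : bool) : reps od s7 F0 k b 0 (fun=> b).
  case: b; last by apply: rep_null; rewrite ?L7 ?R7 ?V7' /F0 //; clear -mk; lia.
  apply: rep_full => // [i hi|q hq]; first by rewrite L7 R7 hi V7' //; clear -hi; lia.
  by rewrite L7 R7 V7 !ifF //; clear; lia.
pose lo e := index (iv e) od.
pose hi e := lo e + size (labels (subtree_at T (lo e))).
pose sg e := si e == 1.
have ivod e : e \in l2 -> iv e \in od.
  by rewrite mem2 od_mem => he; have [_ ->] := iuv e he.
have Pos7 : ar s7 aPos = ar s4 aPos by rewrite ka7 // ka6 // ka5.
have Nx7 : ar s7 aNx = ar s4 aNx by rewrite ka7 // ka6 // ka5.
have data7 e : e \in l2 -> item_data k lo hi sg s7 e.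
  move=> he; have he' := he; rewrite mem2 in he'.
  have [eu ev es] := it6 e he'; have vo := ivod e he.
  have lt : lo e < m by rewrite /lo -so index_mem.
  have ev7 : ar s7 aV e = nth 0 od (lo e) by rewrite ka7 // ev nth_index.
  have le : hi e <= m by rewrite -so; apply: subtree_at_end; rewrite -/od so.
  rewrite /item_data ev7 Pos7 Nx7; split.
  - rewrite ka7 // es /sg /si; have [q _ [-> _]] := item_cases M r he'.
    by case: (q.2).
  - exact: pos4.
  - exact: esc4.
  - exact: ltn_trans lt mk.
  - exact: leq_ltn_trans le mk.
have intervals (w y : 'I_m) : (index w.+1 od <= index y.+1 od <
    index w.+1 od + size (labels (subtree_at T (index w.+1 od)))) = anc w y.
  rewrite -mem_subtree_at //; last by rewrite index_mem.
  by apply: aT; rewrite nth_index.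
have anc_index (w y : 'I_m) : anc w y -> index w.+1 od <= index y.+1 od.
  by rewrite -intervals => /andP[].
have itemP e : e \in l2 -> exists u w : 'I_m,
    [/\ iu e = u.+1, iv e = w.+1, [set u; w] \in stm_A M :|: stm_B M,
        sg e = ([set u; w] \in stm_B M)
      & forall y : 'I_m, (lo e <= index y.+1 od < hi e) = anc w y].
  rewrite mem2 => /(item_cases M r)[q qs [es h]]; have [Pp sP] := mem_ps ps_pairs qs.
  have esg : sg e = ([set q.1.1; q.1.2] \in stm_B M).
    by rewrite -sP /sg /si es; case: (q.2).
  case: h => -[eu ev]; [exists q.1.1, q.1.2 | exists q.1.2, q.1.1]; split=> //.
  - by move=> y; rewrite /hi /lo /iv ev intervals.
  - by rewrite setUC.
  - by rewrite esg setUC.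
  - by move=> y; rewrite /hi /lo /iv ev intervals.
have item_exists (u w : 'I_m) : [set u; w] \in stm_A M :|: stm_B M ->
    exists2 e, e \in l2 & iu e = u.+1 /\ iv e = w.+1.
  case/(ps_complete ps_pairs)=> q /(item_onto M r)[[e1 h1 h2] [e2 h3 h4]] [] [<- <-].
    by exists e1; rewrite ?mem2.
  by exists e2; rewrite ?mem2.
have od_ord a : a \in od -> exists x : 'I_m, a = x.+1.
  rewrite od_mem => ha; have lt : a.-1 < m by clear -ha; lia.
  by exists (Ordinal lt) => /=; clear -ha; lia.
have F0X : F0 + 2 * k.+1 * size l2 + 1 < X.
  by rewrite sz2; apply: FX.
apply: wp_seq; apply: wp_conseq.
  apply: (@wp_versions _ _ od k lo hi sg _ m F0 l2 iu (parent_code par)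
    (cover_spec M od)) => //.
  - by clear -BX; lia.
  - move=> i hi'; rewrite ka7 // ka6 // ka5 // ka4 // htp3 //.
    by rewrite -od_mem mem_nth ?so.
  - move=> i im; have oi : nth 0 od i \in od by rewrite mem_nth ?so.
    have [x ex] := od_ord _ oi; rewrite ex parent_codeE.
    case px: (par x) => [x'|]; [right | by left].
    exists (index x'.+1 od); last by rewrite nth_index.
    have ei : i = index x.+1 od by rewrite -ex index_uniq ?so.
    rewrite ltn_neqAle {2}ei anc_index ?andbT; last exact: anc_parent px.
    apply: contra (parent_neq rooted px) => /eqP e; apply/eqP/val_inj.
    by move: ex; rewrite -e nth_index // => -[].
  - by rewrite ka7 // ka6 // ka5 // ka4 // ka3 // ka2 // ka1.
  - exact: cover_spec0.
  - move=> u S uo; apply: (@paint_cover_spec _ M od l2 iu iv) => //; exact: od_ord.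
move=> t8 s8 [kr8 ka8 kio8] [ht8 [F [eF8 hF8 sb8 rt8]]].
pose hd := ar s3 aHd.
have hd_leaf (x : 'I_m) : (hd x.+1 == 0) = leaf par x.
  rewrite (chain_head0 (bk3 x.+1)) -/(kids par x.+1) -size_eq0 size_kids.
  by rewrite cards_eq0.
have Hd8 : ar s8 aHd = hd by rewrite ka8 // ka7 // ka6 // ka5 // ka4.
have zero8 j i : j \in [:: aVis; aDisc; aPar] -> ar s8 j i = 0.
  by rewrite !inE => /or3P[] /eqP->;
    rewrite ka8 // ka7 // ka6 // ka5 // ka4 // ka3 // ka2 // ka1.
have [] := sb8 0; first by rewrite /F0; clear -mk; lia.
rewrite L7 R7 V7' /=; last by clear -mk; lia.
move=> L80 R80 V80.
apply: wp_seq; apply: wp_conseq.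
  apply: (@wp_bfs od hd covered r.+1 X B k F m) => //.
  - by rewrite /hd hd0; apply: contraNneq o0 => <-; apply: label_in.
  - by clear -BX; lia.
  - by rewrite kr8 // kr7 // kr6 // kr5 // kr4 // kr3 // kr2.
  - by apply/eqP; rewrite hd_leaf.
  - by move=> i; apply: zero8.
  - by move=> i; apply: zero8.
  - by move=> i; apply: zero8.
  - exact: ltnW.
  - move=> x xo hx; have [S rS sS] := rt8 x xo; exists S => // y yo _.
    have [y' ey] := od_ord y yo; rewrite ey; split.
      by case/sS=> x' [-> cov]; exists x', y'.
    by case=> x' [y'' [ex [/val_inj <-] cov]]; apply/sS; exists x'.
move=> t9 s9 [kr9 ka9 kio9] [ht9 [qs [js bf]]].
apply: wp_conseq.
  apply: (@wp_output _ _ _ m) => //; try by clear -BX; lia.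
  by rewrite kr9 // kr8.
move=> t10 s10 _ [ht10 out].
exists k, od, hd, qs, js, (ar s9 aPar); split=> //.
  have e1 : (400 * k + 500) * (2 * p) <= 1000 * (p * k.+1).
    by rewrite [p * _]mulnC; clear; nia.
  have e2 : 2 * k.+1 * (2 * p) = 4 * (p * k.+1) by rewrite mulnACA [p * _]mulnC.
  have e3 : p <= p * k.+1 by apply: leq_pmulr.
  rewrite sz2 e2 in hF8; rewrite sz2 in ht8; rewrite /F0 in hF8.
  move: (p * k.+1) ((400 * k + 500) * (2 * p)) e1 e3 hF8 ht8 => kp kq e1 e3 hF8 ht8.
  move: (2 ^ k) km ht5 hF8 => N km ht5 hF8.
  clear -ht1 ht2 ht3 ht4 ht5 ht6 ht7 ht8 ht9 ht10 km hF8 e1 e3; lia.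
split=> //.
have := labels_leaves lk o0; rewrite -/od so; exact.
Qed.
End Run.

(** * Decoding the output *)

Lemma covers_sym (V : finType) (M : signed_tree_model V) P u v :
  covers M P u v -> covers M P v u.
Proof.
case=> u' [v' [-> hu hv h]]; exists v', u'; split=> //; first by rewrite setUC.
by move=> u'' v'' hP h1 h2 h3 h4; rewrite setUC; apply: h => //; rewrite setUC.
Qed.

Section Output.
Variables (m : nat) (M : signed_tree_model 'I_m) (G : rel (leaf_of M)).
Variables (v : leaf_of M) (od qs js : seq nat) (hd par : nat -> nat).
Hypothesis G_repr : represents G.
Hypothesis od_ids : perm_eq od (iota 1 m).
Hypothesis hd_leaf : forall x : 'I_m, (hd x.+1 == 0) = leaf (tree_parent M) x.
Hypothesis facts :
  bfs_facts od hd (covered M) (val v).+1 (size qs) (size qs) qs js par.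

(** The default [v] only makes the function total: on the numbers in the queue it inverts the
    numbering of the leaves. *)
Definition to_leaf (a : nat) : leaf_of M :=
  if insub a.-1 is Some x then insubd v (x : 'I_m) else v.

Lemma to_leafK (x : leaf_of M) : to_leaf (val x).+1 = x.
Proof. by rewrite /to_leaf /= valK valKd. Qed.

Lemma leaf_id a : a \in od -> hd a = 0 -> (val (to_leaf a)).+1 = a.
Proof.
rewrite (perm_mem od_ids) mem_iota => ha h0; have lt : a.-1 < m by lia.
have ea : a = (Ordinal lt).+1 by rewrite /=; lia.
have lf : leaf (tree_parent M) (Ordinal lt) by rewrite -hd_leaf -ea h0.
by rewrite {1}ea -[Ordinal lt]/(val (Sub (Ordinal lt) lf : leaf_of M)) to_leafK -ea.
Qed.

Lemma queue_id a : a \in qs -> (val (to_leaf a)).+1 = a.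
Proof. by case: facts => _ h _ _ _ /h[]; apply: leaf_id. Qed.

Lemma leaf_in (x : leaf_of M) : (val x).+1 \in od /\ hd (val x).+1 = 0.
Proof.
split; last by apply/eqP; rewrite hd_leaf; apply: valP.
by rewrite (perm_mem od_ids) mem_iota /= ltnS.
Qed.

Lemma coveredP (x y : leaf_of M) : covered M (val x).+1 (val y).+1 <-> G x y.
Proof.
split=> [[x' [y' [[/val_inj <-] [/val_inj <-] h]]]|/G_repr h]; first exact/G_repr.
by exists (val x), (val y).
Qed.

Definition output_parent (y : leaf_of M) : option (leaf_of M) :=
  if par (val y).+1 == 0 then None else Some (to_leaf (par (val y).+1)).

Let leaves := map to_leaf qs.

Lemma nth_leaves i : i < size qs -> (val (nth v leaves i)).+1 = nth 0 qs i.
Proof. by move=> hi; rewrite (nth_map 0) // queue_id // mem_nth. Qed.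

Lemma mem_leaves y : (y \in leaves) = ((val y).+1 \in qs).
Proof.
apply/mapP/idP => [[a aq ->]|yq]; first by rewrite queue_id.
by exists (val y).+1 => //; rewrite to_leafK.
Qed.

Lemma leaves_uniq : uniq leaves.
Proof.
case: facts => -[uq _ _ _] _ _ _ _; rewrite map_inj_in_uniq // => a b aq bq e.
by rewrite -(queue_id aq) e queue_id.
Qed.

Lemma output_parentE y :
  encode_opt (omap val (output_parent y)) = par (val y).+1.
Proof.
rewrite /output_parent; case: eqP => [-> //|/eqP nz] /=.
case: facts => -[uq q0 sq sj] _ [j0 hj] [_ hp] _.
have yq : (val y).+1 \in qs.
  by apply: contraNT nz => h; rewrite hp // h.
have ny : (val y).+1 != (val v).+1.
  by apply: contraNneq nz => h; rewrite hp // h eqxx orbT.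
have hi : 0 < index (val y).+1 qs < size qs.
  rewrite index_mem yq andbT lt0n; apply: contraNneq ny => e.
  by rewrite -q0 -e nth_index.
have [lt _ e _] := hj _ hi; rewrite nth_index // in e; rewrite e.
by apply/queue_id/mem_nth; apply: ltn_trans lt _; case/andP: hi.
Qed.

Lemma output_tree : shortest_path_tree G v (parent_edges output_parent).
Proof.
have G_sym : symmetric G.
  by move=> x y; apply/idP/idP => /G_repr[P PB /covers_sym h]; apply/G_repr; exists P.
case: (facts) => -[uq q0 sq sj] hq [j0 hj] [hm hp] hc.
have nzq a : a \in qs -> a != 0 by move=> /queue_id <-.
apply: (@queue_shortest_path_tree _ G v leaves (nth 0 js)) => //.
- exact: leaves_uniq.
- by rewrite size_map.
- by rewrite (nth_map 0) // q0 to_leafK.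
- by rewrite /output_parent hp ?eqxx ?orbT.
- by move=> y; rewrite mem_leaves => yq; rewrite /output_parent hp ?yq.
- move=> i; rewrite size_map => hi; have [h1 _ h2 h3] := hj i hi.
  have l1 : i < size qs by lia.
  have l2 : nth 0 js i < size qs by lia.
  split=> //; last by apply/coveredP; rewrite !nth_leaves.
  rewrite /output_parent nth_leaves // h2 ifF; last exact/negbTE/nzq/mem_nth.
  by rewrite (nth_map 0).
- by move=> i i'; rewrite size_map; apply: hm.
- move=> i y; rewrite size_map => hi /coveredP; rewrite nth_leaves // => cov.
  have [yo hy] := leaf_in y; have [yq le] := hc i _ hi yo hy cov.
  split; first by rewrite mem_leaves.
  suff -> : index y leaves = index (val y).+1 qs by [].
  have lt : index (val y).+1 qs < size leaves by rewrite size_map index_mem.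
  rewrite -{1}(index_uniq v lt leaves_uniq); congr index.
  by rewrite (nth_map 0) ?index_mem // nth_index // to_leafK.
Qed.

Lemma count_leaves :
  count (fun a => hd a == 0) od = #|{: leaf_of M}|.
Proof.
rewrite (permP od_ids).
have -> : iota 1 m = map succn (map val (enum 'I_m)).
  by rewrite val_enum_ord (iotaDl 1 0).
rewrite -map_comp count_map card_sig cardE size_filter -enumT.
by apply: eq_count => x; rewrite /= hd_leaf.
Qed.

End Output.

(** * Running time and the theorem *)

Definition input_length : expr :=
  Op OpAdd (Op OpAdd (Const 3) (Fetch (Const 0)))
           (Op OpMul (Const 3) (Fetch (Const 1))).

(** If there is a pair, then [n >= 2] and the logarithm [l] is at least 1. As [2 ^ k < 4 * n], this
    gives [k.+1 <= l + 3 <= 4 * l], which absorbs the additive constants. Without pairs only the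
    linear term remains. The 10 pays for computing the input length. *)
Lemma running_time m n p k : m.+1 = 2 * n -> 0 < m -> 2 ^ k <= 2 * m ->
  (0 < p -> 1 < m) ->
  10 + 5000 * (m + 1 + p * k.+1) <= 100 * 210 * (n + p * trunc_log 2 n).
Proof.
move=> mn m0 km pm; have [->|p0] := posnP p; first by rewrite !mul0n; lia.
have n2 : 1 < n by have := pm p0; lia.
set l := trunc_log 2 n.
have l1 : 0 < l by apply: trunc_log_max => //; lia.
have kl : k <= l + 2.
  have : 2 ^ k < 2 ^ (l + 3).
    have := @trunc_log_ltn 2 n isT; rewrite -/l expnS => h.
    by rewrite expnD; lia.
  by rewrite ltn_exp2l //; lia.
have : p * k.+1 <= p * (4 * l) by rewrite leq_mul2l; lia.
by rewrite mulnCA; move: (p * _) (p * _) => a b; lia.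
Qed.

(** The summand [n] in the bound reflects the format of the output, which has a cell for every
    leaf. *)
Theorem theorem1p2 :
  exists (prog : cmd) (C c : nat),
    forall (m : nat) (M : signed_tree_model 'I_m) (G : rel (leaf_of M))
           (v : leaf_of M) (ps : seq ('I_m * 'I_m * bool)) (w : nat),
      represents G ->
      lists_pairs M ps ->
      let input := encode_input M ps (val v) in
      let n := #|{: leaf_of M}| in
      let p := num_pairs M in
      size input ^ c <= 2 ^ w ->
      exists (t : nat) (s : state),
        [/\ exec w prog (init_state input) t s,
            t <= C * (n + p * trunc_log 2 n)
          & outputs_shortest_path_tree G v s].
Proof.
(* The exponent 9 is [4 + 5]: [B ^ 4] exceeds every number the program stores, and
   [1024 = 4 ^ 5 <= B ^ 5] is the slack that the simulation requires. *)
exists (Seq (Assign 0 input_length) (compile program)), (100 * 210), 9.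
move=> m M G v ps w G_repr ps_pairs input n p.
rewrite /p (num_pairsE ps_pairs) size_input; set B := m + 3 * size ps + 3 => hw.
have m0 : 0 < m by apply: leq_ltn_trans (ltn_ord (val v)).
have B4 : 4 <= B by rewrite /B; lia.
set X := B ^ 4.
have XW : 1024 * X <= 2 ^ w.
  apply: leq_trans hw; rewrite -[9]/(5 + 4) expnD leq_mul2r.
  by rewrite (@leq_exp2r 4 B 5) // B4 orbT.
have BX : B <= X by rewrite -[B in B <= _]expn1 leq_exp2l //; lia.
have X_big : 8 * (B * B) < X.
  rewrite /X -[4]/(2 + 2) expnD -!mulnn ltn_mul2r muln_gt0.
  have : 4 * 4 <= B * B by apply: leq_mul.
  lia.
have X1 : 1 < X by lia.
have /wpP[t [s [h res]]] := wp_program ps_pairs (valP v) X_big.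
pose z0 := State (upd (fun=> 0) 0 B) (fun a => nth 0 input a).
have x0 : exec w (Assign 0 input_length) (init_state input) 10 z0.
  have -> : z0 = State (upd (regs (init_state input)) 0
      (eval w (init_state input) input_length)) (memory (init_state input)).
    have [i0 i1 _] := input_head M ps (val v).
    have mod_lt a : a <= X -> a %% 2 ^ w = a by move=> ha; rewrite modn_small //; lia.
    congr (State (upd _ _ _) _); rewrite /= -/input !mod_lt /B //=; try lia.
  exact: ExecAssign.
have sim0 : simulates B (start M ps (val v)) z0.
  split=> //= j i _; rewrite nth_default // size_input -/B; lia.
have bd0 : bounded X (start M ps (val v)).
  split=> //= [r|j i|a]; [lia.. |].
  exact: leq_trans (input_bound M ps (val v) a) BX.
have [z [hz [_ _ _ sim] _]] := aexec_simulation X1 BX XW h wf_program sim0 bd0.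
exists (10 + t), z; case: res => k [od [hd [qs [js [par' [ht km out bf [pod lf cnt]]]]]]].
split; first exact: ExecSeq x0 hz.
  apply: leq_trans (leq_add (leqnn 10) ht) _; apply: running_time => //.
    by rewrite cnt (count_leaves pod lf).
  move=> p0; case: (ps) ps_pairs p0 => // q s' h' _.
  have [/stm_transversal[a [b [_ nab _ _]]] _] := mem_ps h' (mem_head q s').
  have := ltn_ord a; have := ltn_ord b; move: nab; rewrite -val_eqE /=; lia.
exists (output_parent v par'); split.
- move=> x; rewrite (output_parentE pod lf bf) -out ?sim //.
  by have := ltn_ord (val x); rewrite /B; lia.
- case: bf => _ _ _ [_ hp] _.
  by rewrite /output_parent hp // eqxx orbT.
- exact: (output_tree G_repr pod lf bf).
Qed.
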